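(* Let $N=\mathrm{sh}_{\{n\}}\setminus G\cdot[v_{\{n\}}]$. Then: 1. $N$ is the variety of singular points of $\mathrm{sh}_{\{n\}}$. 2. There exist a line bundle $\mathcal{E}$ on $\mathrm{sh}_{\{n\}}$ and sections $s_1,s_2\in H^0(\mathcal{E},\mathrm{sh}_{\{n\}})$ such that $N=\{s_1=0\}\cap\{s_2=0\}$.
   Context: Everything is over $\mathbb{C}$. Fusion product: for positive integers $A=(a_1,\dots,a_n)$ choose pairwise distinct $z_1,\dots,z_n\in\mathbb{C}$ and let $\mathbb{C}^{a_i}(z_i)$ be the evaluation module of $\mathfrak{sl}_2\otimes\mathbb{C}[t]$, i.e. the irreducible $a_i$-dimensional $\mathfrak{sl}_2$-module on which $x_k:=x\otimes t^k$ acts as $z_i^k x$. The tensor product $V=\bigotimes_i\mathbb{C}^{a_i}(z_i)$ is cyclic, generated by the tensor product $v$ of lowest weight vectors. Filter $V$ by the subspaces $V^{(m)}$ spanned by $x^{(1)}_{k_1}\cdots x^{(r)}_{k_r}v$ with $x^{(l)}\in\mathfrak{sl}_2$ and $k_1+\dots+k_r\le m$. The fusion product $M^A$ is the associated graded $\mathfrak{sl}_2\otimes\mathbb{C}[t]$-module; it is (known to be) independent of the $z_i$ and is an $\mathfrak{sl}_2\otimes(\mathbb{C}[t]/t^n)$-module. Let $v_A\in M^A$ be the image of $v$. $G=\mathrm{SL}_2(\mathbb{C}[t]/t^n)$ acts on $\mathbb{P}(M^A)$. For $A=(2^n)=(2,\dots,2)$ ($n$ twos) put $[v_{\{n\}}]=[v_A]=\mathbb{C}v_A\in\mathbb{P}(M^A)$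 and $\mathrm{sh}_{\{n\}}=\overline{G\cdot[v_{\{n\}}]}\subset\mathbb{P}(M^{(2^n)})$, a projective variety. It is known (for $n\ge2$, with $\mathrm{sh}_{\{0\}}$ a point) that $N\simeq\mathrm{sh}_{\{n-2\}}$. *)

(* Defs.v *)
From HB Require Import structures.
From mathcomp Require Import all_boot all_order all_algebra.
From mathcomp Require Import boolp classical_sets reals complex mpoly ring.

Set Implicit Arguments.
Unset Strict Implicit.
Unset Printing Implicit Defensive.

Import Order.TTheory GRing.Theory Num.Theory.
Local Open Scope classical_set_scope.
Local Open Scope ring_scope.

Section Projective.
Context {K : numClosedFieldType} (M : vectType K).

Definition proj := {L : {vspace M} | \dim L == 1%N}.

Definition proj_rep (L : proj) : M := vpick (val L).

(* Polynomial functions on M, in the coordinates of a fixed basis; all the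
   notions below are independent of that basis. *)
Definition coordv (x : M) (i : 'I_(\dim {:M})) : K := coord (vbasis {:M}) i x.

Definition pevalv (p : {mpoly K[\dim {:M}]}) (x : M) : K := p.@[coordv x].

(* The value of a polynomial at a point of P(M) only makes sense for the
   representative [proj_rep L]; the vanishing of a homogeneous polynomial, and
   the quotient of two homogeneous polynomials of the same degree, do not
   depend on it. *)
Definition pevalp (p : {mpoly K[\dim {:M}]}) (L : proj) : K :=
  pevalv p (proj_rep L).

Definition zariski_closed (Z : set proj) : Prop :=
  exists S : set {mpoly K[\dim {:M}]},
    (forall p, S p -> exists d : nat, p \is d.-homog) /\
    Z = [set L | forall p, S p -> pevalp p L = 0].

Definition zariski_open (U : set proj) : Prop := zariski_closed (~` U).

Definition zariski_closure (A : set proj) : set proj :=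
  \bigcap_(Z in [set Z | zariski_closed Z /\ A `<=` Z]) Z.

Definition regular_on (U : set proj) (f : proj -> K) : Prop :=
  forall L, U L -> exists W : set proj, [/\ zariski_open W, W L &
    exists (d : nat) (p q : {mpoly K[\dim {:M}]}),
      [/\ p \is d.-homog, q \is d.-homog &
          forall L', U L' -> W L' ->
            pevalp q L' != 0 /\ f L' = pevalp p L' / pevalp q L']].

(* The k rational functions (p i) / q on the irreducible variety X are
   algebraically independent over K; rational functions are brought to a common
   denominator q, which must not vanish identically on X. *)
Definition has_independent_rational_functions (X : set proj) (k : nat) : Prop :=
  exists (d : nat) (p : 'I_k -> {mpoly K[\dim {:M}]})
         (q : {mpoly K[\dim {:M}]}),
    [/\ forall i, p i \is d.-homog, q \is d.-homog,
        exists2 L, X L & pevalp q L != 0 &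
        forall F : {mpoly K[k]},
          (forall L, X L -> pevalp q L != 0 ->
             F.@[fun i => pevalp (p i) L / pevalp q L] = 0) ->
          F = 0].

(* Dimension of an irreducible variety: the transcendence degree of its
   function field. *)
Definition variety_dim (X : set proj) (d : nat) : Prop :=
  has_independent_rational_functions X d /\
  forall k, has_independent_rational_functions X k -> (k <= d)%N.

(* The linear subspace of M cut out by the differentials at L of all homogeneous
   equations of X. It contains the line L, and its projectivisation is the
   embedded projective tangent space: its dimension is dim T_L X + 1. *)
Definition tangent_vector (X : set proj) (L : proj) (w : M) : Prop :=
  forall (d : nat) (p : {mpoly K[\dim {:M}]}),
    p \is d.-homog -> (forall L', X L' -> pevalp p L' = 0) ->
    \sum_i pevalp p^`M(i) L * coordv w i = 0.

Definition singular_locus (X : set proj) : set proj :=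
  [set L | X L /\ exists (d : nat) (T : {vspace M}),
     [/\ variety_dim X d, forall w, w \in T <-> tangent_vector X L w &
         (d.+1 < \dim T)%N]].

(* A line bundle on the closed subvariety X, given by transition functions over
   a finite trivialising open cover. The last two axioms make the transition
   functions invertible on overlaps. *)
Record line_bundle (X : set proj) := LineBundle {
  lb_size : nat;
  lb_open : 'I_lb_size -> set proj;
  lb_trans : 'I_lb_size -> 'I_lb_size -> proj -> K;
  lb_openP : forall i, zariski_open (lb_open i);
  lb_cover : forall L, X L -> exists i, lb_open i L;
  lb_regular : forall i j,
    regular_on (X `&` lb_open i `&` lb_open j) (lb_trans i j);
  lb_trans_id : forall i L, X L -> lb_open i L -> lb_trans i i L = 1;
  lb_cocycle : forall i j k L,
    X L -> lb_open i L -> lb_open j L -> lb_open k L ->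
    lb_trans i j L * lb_trans j k L = lb_trans i k L }.

Arguments lb_open {X} l _ _.
Arguments lb_trans {X} l _ _ _.

Record global_section (X : set proj) (E : line_bundle X) := GlobalSection {
  gs_fun : 'I_(lb_size E) -> proj -> K;
  gs_regular : forall i, regular_on (X `&` lb_open E i) (gs_fun i);
  gs_compat : forall i j L, X L -> lb_open E i L -> lb_open E j L ->
    gs_fun i L = lb_trans E i j L * gs_fun j L }.

Definition zero_locus (X : set proj) (E : line_bundle X)
    (s : global_section E) : set proj :=
  [set L | X L /\ forall i, lb_open E i L -> gs_fun s i L = 0].

End Projective.

Arguments proj {K} M.
Arguments lb_open {K M X} l _ _.
Arguments lb_trans {K M X} l _ _ _.

(* sl_2 is the space of 2x2 matrices of trace 0, and x_k = x (x) t^k acts on a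
   module by [act x k]. *)
Section AssociatedGraded.
Context {K : numClosedFieldType} {V : vectType K}.
Variables (F : nat -> set V) (act : 'M[K]_2 -> nat -> V -> V).

Definition filtration_pred (m : nat) : set V :=
  if m is m'.+1 then F m' else [set 0].

(* The associated graded module up to isomorphism: a module together with the
   maps F m -> F m / F (m - 1) into it, the direct sum of whose images is the
   whole module. The values of [gr_symbol m] outside F m, and of [gr_act] on
   matrices of nonzero trace, are irrelevant. *)
Record assoc_graded := AssocGraded {
  gr_space :> vectType K;
  gr_symbol : nat -> 'Hom(V, gr_space);
  gr_act : 'M[K]_2 -> nat -> 'End(gr_space);
  gr_symbol_ker : forall m u, F m u ->
    gr_symbol m u = 0 <-> filtration_pred m u;
  gr_symbol_sum : forall y : gr_space, exists (d : nat) (u : nat -> V),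
    (forall m, F m (u m)) /\ y = \sum_(m < d) gr_symbol m (u m);
  gr_symbol_direct : forall (d : nat) (u : nat -> V),
    (forall m, F m (u m)) -> \sum_(m < d) gr_symbol m (u m) = 0 ->
    forall m, (m < d)%N -> gr_symbol m (u m) = 0;
  gr_act_symbol : forall x k m u, \tr x = 0 -> F m u ->
    gr_act x k (gr_symbol m u) = gr_symbol (m + k)%N (act x k u) }.

Section Existence.
Hypothesis act_linear : forall x k, linear (act x k).
Hypothesis F0 : forall m, F m 0.
Hypothesis F_lin : forall m c u v, F m u -> F m v -> F m (c *: u + v).
Hypothesis F_mono : forall m u, F m u -> F m.+1 u.
Hypothesis F_act : forall x k m u, \tr x = 0 -> F m u -> F (m + k)%N (act x k u).

Lemma lin_closed_vspace (S : set V) :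
  S 0 -> (forall c u v, S u -> S v -> S (c *: u + v)) ->
  exists U : {vspace V}, forall u, u \in U <-> S u.
Proof.
move=> S0 Sl.
pose P d := `[< exists U : {vspace V}, \dim U = d /\ forall u, u \in U -> S u >].
have exP : exists d, P d.
  exists 0%N; apply/asboolP; exists 0%VS; split; first exact: dimv0.
  by move=> u; rewrite memv0 => /eqP ->.
have ubP d : P d -> (d <= \dim {:V})%N.
  by move/asboolP=> [U [<- _]]; apply: dimvS; apply: subvf.
have [d /asboolP[U [dU US]] dmax] := ex_maxnP exP ubP.
exists U => u; split; first exact: US.
move=> Su; have /dmax : P (\dim (U + <[u]>)).
  apply/asboolP; exists (U + <[u]>)%VS; split=> // w.
  case/memv_addP=> a Ua [b /vlineP[c ->] ->]; rewrite addrC; apply: Sl => //.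
  exact: US.
rewrite -dU => le; have /eqP eU : U == (U + <[u]>)%VS.
  by rewrite eqEdim addvSl.
by rewrite eU; apply: (subvP (addvSr _ _)); apply: memv_line.
Qed.

Lemma assoc_graded_exists : inhabited assoc_graded.
Proof.
have /choice[U UP] : forall m, exists U : {vspace V}, forall u, u \in U <-> F m u.
  by move=> m; apply: lin_closed_vspace; [exact: F0 | exact: F_lin].
have Usub m : (U m <= U m.+1)%VS.
  by apply/subvP => u /UP /F_mono /UP.
have Ule m m' : (m <= m')%N -> (U m <= U m')%VS.
  move=> /subnK <-; elim: (m' - m)%N => [|k IH]; first by rewrite add0n subvv.
  by apply: subv_trans IH _; rewrite addSn Usub.
have [D UD] : exists D, forall m, (U m <= U D)%VS.
  pose P d := `[< exists m, \dim (U m) = d >].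
  have exP : exists d, P d by exists (\dim (U 0%N)); apply/asboolP; exists 0%N.
  have ubP d : P d -> (d <= \dim {:V})%N.
    by move/asboolP=> [m <-]; apply: dimvS; apply: subvf.
  have [d /asboolP[D dD] dmax] := ex_maxnP exP ubP.
  exists D => m; case: (leqP m D) => [|/ltnW le]; first exact: Ule.
  have /eqP <- // : U D == U m.
  by rewrite eqEdim (Ule _ _ le) dD; apply: dmax; apply/asboolP; exists m.
pose P m := if m is m'.+1 then U m' else 0%VS.
have PU m : (P m <= U m)%VS by case: m => [|m]; [exact: sub0v | exact: Usub].
pose C m := (U m :\: P m)%VS; pose S m := addv_pi1 (U m) (P m).
have PP m u : u \in P m <-> filtration_pred m u.
  by case: m => [|m]; [split; rewrite memv0 => /eqP | exact: UP].
have SC m u : S m u \in C m by exact: memv_pi.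
have CU m : (C m <= U D)%VS by apply: subv_trans (diffvSl _ _) (UD m).
have Spi m u : u \in U m -> S m u + addv_pi2 (U m) (P m) u = u.
  by move=> Uu; apply: addv_pi1_pi2; apply: (subvP (addvSl _ _)).
have SP m u : u \in P m -> S m u = 0.
  move=> Pu; have := Spi m u (subvP (PU m) u Pu).
  by rewrite addv_pi2_id // => /(canRL (addrK _)); rewrite subrr.
have S0P m u : u \in U m -> S m u = 0 -> u \in P m.
  by move=> /Spi; case: (S m u =P 0) => [->|//]; rewrite add0r => <- _; apply: memv_pi.
have Smem m u : u \in U m -> u - S m u \in P m.
  by move=> Uu; rewrite -{1}(Spi _ _ Uu) addrC addKr; apply: memv_pi.
have sumC k : (\sum_(m < k.+1) C m)%VS = U k.
  elim: k => [|k IH]; first by rewrite big_ord1 -[LHS]addv0 /C /= addv_diff addv0.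
  by rewrite big_ord_recr /= IH addvC addv_diff addvC; apply/addv_idPr.
have indep k (u : nat -> V) : (forall m, u m \in C m) ->
    \sum_(m < k) u m = 0 -> forall m, (m < k)%N -> u m = 0.
  move=> uC; elim: k => [|k IH] //; rewrite big_ord_recr /= => s0.
  suff uk0 : u k = 0.
    move=> m; rewrite ltnS leq_eqVlt => /orP[/eqP -> //|]; apply: IH.
    by move: s0; rewrite uk0 addr0.
  have Puk : u k \in P k.
    move/eqP: s0; rewrite addrC addr_eq0 => /eqP ->; rewrite memvN.
    case: k {IH} => [|k]; first by rewrite big_ord0 mem0v.
    rewrite /= -sumC; apply: memv_sumr => i _; exact: uC.
  have : u k \in (C k :&: P k)%VS by rewrite memv_cap uC Puk.
  by rewrite capv_diff memv0 => /eqP.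
pose dec := sumv_pi_for (esym (sumC D)).
have decC (i : 'I_D.+1) v : dec i v \in C i by exact: memv_sum_pi.
have dec_id (i j : 'I_D.+1) v : v \in C j -> dec i v = if i == j then v else 0.
  move=> Cv; have Uv : v \in U D by apply: subvP Cv; apply: CU.
  pose w (m : nat) := (if insub m is Some l then
       dec l v - (if l == j then v else 0) else 0) : V.
  have wC m : w m \in C m.
    rewrite /w; case: insubP => [l _ <-|_]; last exact: mem0v.
    by apply: rpredB; [exact: decC | case: eqP => [->|_] //; exact: mem0v].
  have := indep D.+1 w wC _ i (ltn_ord i).
  rewrite /w valK => h; apply/eqP; rewrite -subr_eq0; apply/eqP; apply: h.
  transitivity (\sum_(l < D.+1) dec l v - \sum_(l < D.+1) (if l == j then v else 0)).
    by rewrite -sumrB; apply: eq_bigr => l _; rewrite valK.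
  by rewrite -big_mkcond big_pred1_eq sumv_pi_sum // subrr.
have /choice[lact0 lact0E] : forall xk, exists f : 'End(V), forall u, f u = act xk.1 xk.2 u.
  move=> [x k]; pose fM := GRing.isLinear.Build _ _ _ _ _ (act_linear x k).
  pose fL : {linear V -> V} := HB.pack (act x k) fM.
  by exists (linfun fL) => u; rewrite lfunE.
pose lact x k : 'End(V) := lact0 (x, k).
have lactE x k u : lact x k u = act x k u by rewrite lact0E.
pose inj : 'Hom(subvs_of (U D), V) := linfun vsval.
pose prj : 'Hom(V, subvs_of (U D)) := linfun (vsproj (U D)).
pose sy m : 'Hom(V, subvs_of (U D)) := (prj \o S m)%VF.
pose ga x k : 'End(subvs_of (U D)) :=
  (\sum_(i < D.+1) (sy (i + k)%N \o lact x k \o dec i \o inj))%VF.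
have gaE x k y : ga x k y =
    \sum_(i < D.+1) sy (i + k)%N (act x k (dec i (inj y))).
  by rewrite /ga sum_lfunE; apply: eq_bigr => i _; rewrite 3!comp_lfunE lactE.
have inj_inj : injective inj.
  by move=> u v; rewrite /inj !lfunE /=; exact: subvs_inj.
have injsy m u : inj (sy m u) = S m u.
  rewrite /inj /sy /prj !lfunE /= !lfunE /= vsprojK //.
  by apply: subvP (SC m u); apply: CU.
have sy0 m u : sy m u = 0 <-> S m u = 0.
  split=> [h|h]; first by rewrite -injsy h linear0.
  by rewrite /sy lfunE /= h linear0.
apply: inhabits; apply: (@AssocGraded (subvs_of (U D)) sy ga).
- move=> m u /UP Uu; split; first by move/sy0/S0P => /(_ Uu) /PP.
  by move/PP/SP/sy0.
- move=> y; exists D.+1, (fun m => if insub m is Some i then dec i (inj y) else 0).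
  split=> [m|].
    apply/UP; case: insubP => [l _ <-|_]; last exact: mem0v.
    exact: subvP (diffvSl _ _) _ (decC _ _).
  apply: inj_inj; rewrite linear_sum /=.
  rewrite -{1}[inj y](sumv_pi_sum (esym (sumC D))); last first.
    by rewrite /inj lfunE; exact: subvsP.
  apply: eq_bigr => i _; rewrite valK injsy.
  by rewrite /S /addv_pi1 daddv_pi_id ?capv_diff.
- move=> d u FU s0 m md; apply/sy0; apply: (indep d (fun m => S m (u m))) => //.
  move/(congr1 inj): s0; rewrite linear0 linear_sum /= => s1.
  rewrite -[RHS]s1; by apply: eq_bigr => i _; rewrite injsy.
- move=> x k m u tx Fu; have Uu : u \in U m by apply/UP.
  have kill v : v \in P m -> S (m + k)%N (act x k v) = 0.
    move=> Pv; apply: SP; case: (m) Pv => [|m'] /=.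
      rewrite memv0 => /eqP ->; rewrite -lactE linear0; exact: mem0v.
    by move/UP/(F_act k tx)/UP.
  have Sact : S (m + k)%N (act x k (S m u)) = S (m + k)%N (act x k u).
    have aB : act x k (u - S m u) = act x k u - act x k (S m u).
      by rewrite -!lactE linearB.
    apply/esym/eqP; rewrite -subr_eq0 -linearB /= -aB kill //; exact: Smem.
  have -> : sy (m + k)%N (act x k u) = sy (m + k)%N (act x k (S m u)).
    by rewrite /sy !lfunE /= Sact.
  rewrite gaE injsy.
  case: (ltnP m D.+1) => mD.
    rewrite (bigD1 (Ordinal mD)) //= (dec_id _ (Ordinal mD)) ?SC // eqxx.
    rewrite big1 ?addr0 // => i ne.
    by rewrite (dec_id i (Ordinal mD)) ?SC // (negPf ne) -lactE !linear0.
  have -> : S m u = 0.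
    apply: SP; case: (m) mD Uu => // m' mD; apply: subvP.
    exact: subv_trans (UD _) (Ule _ _ _).
  rewrite -lactE !linear0 big1 // => i _.
  by rewrite -lactE !linear0.
Qed.

End Existence.
End AssociatedGraded.

Arguments gr_symbol {K V F act} a m.
Arguments gr_act {K V F act} a x k.

Section CyclicFiltration.
Context {K : numClosedFieldType} {V : vectType K}.
Variables (act : 'M[K]_2 -> nat -> V -> V) (v : V).

(* The word x1_k1 ... xr_kr of elements of sl_2[t], leftmost factor first. *)
Definition word := seq ('M[K]_2 * nat).

Definition is_sl2_word (m : nat) (w : word) : bool :=
  all (fun y => \tr y.1 == 0) w && (\sum_(y <- w) y.2 <= m)%N.

Definition word_act (w : word) (u : V) : V :=
  foldr (fun y => act y.1 y.2) u w.

Definition cyclic_filtration (m : nat) : set V :=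
  [set u | exists s : seq (K * word),
     all (fun y => is_sl2_word m y.2) s /\
     u = \sum_(y <- s) y.1 *: word_act y.2 v].

End CyclicFiltration.

(* The irreducible a-dimensional sl_2-module, in the basis w_0, ..., w_(a-1)
   with h w_j = (a - 1 - 2j) w_j, f w_j = w_(j+1), e w_j = j(a - j) w_(j-1);
   column j is the image of w_j, and a matrix x of trace 0 is
   x 0 0 * h + x 0 1 * e + x 1 0 * f. For a = 2 it is x |-> x. *)
Definition irrep {K : numClosedFieldType} (a : nat) (x : 'M[K]_2) : 'M[K]_a :=
  \matrix_(i, j) (x 0 0 * (a.-1%:R - j.*2%:R) *+ (i == j)
                  + x 1 0 *+ (i == j.+1 :> nat)
                  + x 0 1 * (j * (a - j))%:R *+ (j == i.+1 :> nat)).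

Section Fusion.
Context {K : numClosedFieldType} {n : nat} (a : 'I_n -> nat) (z : 'I_n -> K).

Definition tensor_index := {dffun forall i : 'I_n, 'I_(a i)}.

(* The function b |-> u b stands for the sum of the u b times the basis tensors
   w_(b 0) (x) ... (x) w_(b (n-1)). *)
Definition tensor_space : vectType K := {ffun tensor_index -> K^o}.

Definition eval_act (x : 'M[K]_2) (k : nat) (u : tensor_space) : tensor_space :=
  [ffun b : tensor_index => \sum_i z i ^+ k *
     \sum_(c : 'I_(a i)) irrep (a i) x (b i) c * u (finfun (dfwith b c))].

Definition lowest_vector : tensor_space :=
  [ffun b : tensor_index => [forall i, (b i).+1 == a i]%:R].

Definition fusion_product :=
  assoc_graded (cyclic_filtration eval_act lowest_vector) eval_act.

Definition fusion_vector (M : fusion_product) : M :=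
  gr_symbol M 0 lowest_vector.

Lemma eval_act_linear x k : linear (eval_act x k).
Proof.
move=> c u v; apply/ffunP => b; have sE (y : K^o) : c *: y = c * y by [].
rewrite !ffunE sE mulr_sumr; apply/esym.
apply: etrans (esym (big_split _ _ _ _ _)) _; apply: eq_bigr => i _ /=.
rewrite mulrCA mulr_sumr -mulrDr -big_split /=.
congr (_ * _); apply: eq_bigr => j _.
by rewrite !ffunE sE mulrDr mulrCA.
Qed.

Lemma fusion_product_exists : inhabited fusion_product.
Proof.
have al := eval_act_linear.
apply: assoc_graded_exists => //.
- by move=> m; exists [::]; rewrite big_nil.
- move=> m c _ _ [s [sw ->]] [t [tw ->]].
  exists ([seq (c * y.1, y.2) | y <- s] ++ t); split.
    by rewrite all_cat tw andbT all_map.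
  rewrite big_cat big_map scaler_sumr; congr (_ + _).
  by apply: eq_bigr => y _; rewrite scalerA.
- move=> m _ [s [sw ->]]; exists s; split=> //; apply: sub_all sw => y.
  by case/andP=> tr le; rewrite /is_sl2_word tr /= (leq_trans le).
- move=> x k m _ tx [s [sw ->]].
  exists [seq (y.1, (x, k) :: y.2) | y <- s]; split.
    rewrite all_map; apply: sub_all sw => y /andP[tr le].
    by rewrite /is_sl2_word /= tx eqxx tr /= big_cons addnC leq_add2r.
  have [f fE] : exists f : 'End(tensor_space), forall u, f u = eval_act x k u.
    pose fM := GRing.isLinear.Build _ _ _ _ _ (al x k).
    pose fL : {linear tensor_space -> tensor_space} := HB.pack (eval_act x k) fM.
    by exists (linfun fL) => u; rewrite lfunE.
  rewrite -fE linear_sum big_map; apply: eq_bigr => y _.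
  by rewrite linearZ /= fE.
Qed.

End Fusion.

Notation trunc_poly K n := {poly %/ ('X^n : {poly K})}.

Lemma SL2_elementary_ind (A : comUnitRingType) :
  (forall a b c d : A, a * d - b * c = 1 ->
     a \is a GRing.unit \/ a + c \is a GRing.unit) ->
  forall Q : 'M[A]_2 -> Prop, Q 1%:M ->
  (forall p h, Q h -> Q ((1%:M + p *: delta_mx 0 1) *m h)) ->
  (forall p h, Q h -> Q ((1%:M + p *: delta_mx 1 0) *m h)) ->
  forall g, \det g = 1 -> Q g.
Proof.
move=> locA Q Q1 Qe0 Qf0.
pose e p : 'M[A]_2 := 1%:M + p *: delta_mx 0 1.
pose f p : 'M[A]_2 := 1%:M + p *: delta_mx 1 0.
have Qe p h : Q h -> Q (e p *m h) by exact: Qe0.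
have Qf p h : Q h -> Q (f p *m h) by exact: Qf0.
have ord2 (i : 'I_2) : i = 0 \/ i = 1.
  by case: i => [[|[|]]] // ?; [left | right]; apply: val_inj.
have mul2 (B C : 'M[A]_2) i j : (B *m C) i j = B i 0 * C 0 j + B i 1 * C 1 j.
  rewrite mxE !big_ord_recl big_ord0 addr0.
  by congr (_ + B _ _ * C _ _); apply: val_inj.
pose simp := (mulr1n, mulr0n, mulr0, mulr1, addr0, add0r, mul1r, mul0r).
have eE p (h : 'M[A]_2) : e p *m h =
    \matrix_(i, j) (if i == 0 then h 0 j + p * h 1 j else h 1 j).
  apply/matrixP => i j; rewrite mul2 !mxE.
  by case: (ord2 i) => -> /=; rewrite !simp.
have fE p (h : 'M[A]_2) : f p *m h =
    \matrix_(i, j) (if i == 0 then h 0 j else h 1 j + p * h 0 j).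
  apply/matrixP => i j; rewrite mul2 !mxE.
  by case: (ord2 i) => -> /=; rewrite !simp // addrC.
have detE (h : 'M[A]_2) : \det h = h 0 0 * h 1 1 - h 0 1 * h 1 0.
  rewrite (expand_det_row _ 0) !big_ord_recl big_ord0 addr0 /cofactor.
  rewrite !det_mx11 !mxE /= expr0 expr1 mul1r mulN1r mulrN.
  by congr (_ * h _ _ - h _ _ * h _ _); apply: val_inj.
have Qunit (h : 'M[A]_2) : h 0 0 \is a GRing.unit -> \det h = 1 -> Q h.
  move=> uh; rewrite detE => dh; set u := h 0 0 in uh dh *; pose v := u^-1.
  have uv : u * v = 1 by rewrite mulrV.
  have wE (k : 'M[A]_2) : e (-1) *m (f 1 *m (e (-1) *m k)) =
      \matrix_(i, j) (if i == 0 then - k 1 j else k 0 j).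
    apply/matrixP => i j; rewrite eE fE eE !mxE /=.
    by case: (ord2 i) => -> /=; ring.
  have dE (k : 'M[A]_2) : e u *m (f (- v) *m (e u *m k)) =
      \matrix_(i, j) (if i == 0 then u * k 1 j else - (v * k 0 j)).
    apply/matrixP => i j; rewrite eE fE eE !mxE /=.
    by case: (ord2 i) => -> /=; [ring: uv | ring: uv].
  have -> : h = f (h 1 0 * v) *m (e u *m (f (- v) *m (e u *m
                (e (-1) *m (f 1 *m (e (-1) *m (e (v * h 0 1) *m 1%:M))))))).
    rewrite wE dE fE eE; apply/matrixP => i j; rewrite !mxE.
    case: (ord2 i) => ->; case: (ord2 j) => -> /=; rewrite ?(mulr1n, mulr0n) -/u.
    - by ring.
    - by ring: uv.
    - by ring: uv.
    - have -> : h 1 1 = v + v * (h 0 1 * h 1 0) by rewrite -{1}[v]mulr1 -dh; ring: uv.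
      by ring: uv.
  apply: (Qf); apply: (Qe); apply: (Qf); apply: (Qe); apply: (Qe).
  by apply: (Qf); apply: (Qe); apply: (Qe).
move=> g dg; have := dg; rewrite detE.
case/locA => [ua|uac]; first exact: Qunit.
have -> : g = e (-1) *m (e 1 *m g).
  apply/matrixP => i j; rewrite !eE !mxE.
  by case: (ord2 i) => -> /=; ring.
apply: (Qe (-1)); apply: Qunit; first by rewrite eE mxE /= mul1r.
by move: dg; rewrite eE !detE !mxE /= => <-; ring.
Qed.

Lemma trunc_poly_local (K : fieldType) (n : nat) (a b c d : trunc_poly K n) :
  a * d - b * c = 1 -> a \is a GRing.unit \/ a + c \is a GRing.unit.
Proof.
move=> dg.
have [ua|na] := boolP (a \is a GRing.unit); [by left | right].
apply: contraT => nac.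
have nonunit (p : trunc_poly K n) : p \isn't a GRing.unit ->
    exists q, p = qpolyX 'X^n * q.
  move=> np; have : ('X %| (p : {poly K}))%R.
    move: np; rewrite qualifE /=; move: (qpoly.polyn p) => p0.
    rewrite mk_monic_Xn coprimep_pexpl // coprimep_sym.
    by rewrite -['X]subr0 -polyC0 coprimep_XsubC negbK -dvdp_XsubCl.
  case/dvdpP=> q qE; exists (in_qpoly _ q); rewrite mulrC -rmorphM /= -qE.
  by apply: val_inj; rewrite /= Pdiv.CommonRing.rmodp_small // size_mk_monic.
have [q aE] := nonunit _ na; have [r acE] := nonunit _ nac.
have X0 : qpolyX ('X^n : {poly K}) ^+ n.-1.+1 = 0.
  rewrite -rmorphXn /=; apply: val_inj => /=.
  by rewrite -mk_monic_Xn Pdiv.RingMonic.rmodpp // monic_mk_monic.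
have e1 : a * d - b * c = qpolyX 'X^n * (q * (d + b) - b * r).
  by rewrite mulrBr (mulrCA _ b) -acE mulrA -aE; ring.
have := congr1 (fun y => y ^+ n.-1.+1) dg; rewrite /= expr1n e1.
by rewrite exprMn X0 mul0r => /esym/eqP; rewrite oner_eq0.
Qed.

Section GroupAction.
Context {K : numClosedFieldType} {n : nat} {a : 'I_n -> nat} {z : 'I_n -> K}.
Variable M : fusion_product a z.

Definition gr_act_poly (x : 'M[K]_2) (p : trunc_poly K n) : 'End(M) :=
  \sum_(k < n) (p : {poly K})`_k *: gr_act M x k.

(* The exponential of a nilpotent endomorphism of M. *)
Definition exp_nilp (f : 'End(M)) : 'End(M) :=
  \sum_(k < \dim {:M}) k`!%:R^-1 *: iter k (comp_lfun f) \1%VF.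

(* [SL2_acts g f]: g acts on M as f. This is the graph of the representation
   of SL_2(K[t]/t^n) integrating the action of sl_2 (x) K[t]/t^n: the
   one-parameter subgroups of the nilpotent elements e (x) p and f (x) p act by
   exponentials, and they generate the group (see [SL2_acts_total]). *)
Inductive SL2_acts : 'M[trunc_poly K n]_2 -> 'End(M) -> Prop :=
| SL2_acts1 : SL2_acts 1%:M \1%VF
| SL2_acts_e p g f : SL2_acts g f ->
    SL2_acts ((1%:M + p *: delta_mx 0 1) *m g)
             (exp_nilp (gr_act_poly (delta_mx 0 1) p) \o f)%VF
| SL2_acts_f p g f : SL2_acts g f ->
    SL2_acts ((1%:M + p *: delta_mx 1 0) *m g)
             (exp_nilp (gr_act_poly (delta_mx 1 0) p) \o f)%VF.

Definition SL2_orbit (v : M) : set (proj M) :=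
  [set L | exists (g : 'M[trunc_poly K n]_2) (f : 'End(M)),
     [/\ \det g = 1, SL2_acts g f & val L = <[f v]>%VS]].

Definition fusion_orbit : set (proj M) := SL2_orbit (fusion_vector M).

Definition fusion_variety : set (proj M) := zariski_closure fusion_orbit.

Lemma SL2_acts_total (g : 'M[trunc_poly K n]_2) :
  \det g = 1 -> exists f, SL2_acts g f.
Proof.
move: g; refine (@SL2_elementary_ind (trunc_poly K n) (@trunc_poly_local K n)
  (fun h => exists f, SL2_acts h f) _ _ _).
- by exists \1%VF; apply: SL2_acts1.
- by move=> p h [f hf]; eexists; apply: SL2_acts_e hf.
- by move=> p h [f hf]; eexists; apply: SL2_acts_f hf.
Qed.

End GroupAction.

Arguments fusion_orbit {K n a z} M _.
Arguments fusion_variety {K n a z} M _.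

(* Main.v *)
(** Let x, y be the basis vectors of lowest and highest weight of C^2.  In the limit
    z -> 0 the factors C^2(z_r) of the fusion product become C^2 (x) C[t]/t^n: the
    alternants of a tensor u against the functionals z_r^l, normalized by the
    Vandermonde determinant of z, are compatible with the filtration, and their leading
    terms define an equivariant map Psi from M to the n-th tensor power of
    (C[t]/t^n)^2, sending v to the n x n minors (Pluecker coordinates) of the subspace
    C[t]/t^n x.  The image contains the minors of the subspaces generated by x + p y;
    they span a space of dimension at least 2^n, so Psi is injective.  Hence sh is a
    variety of n-dimensional subspaces U of (C[t]/t^n)^2.

    The condition that U be t-stable is closed, and the orbit of [v] consists of the
    cyclic subspaces.  By unipotent elements of G every t-stable U is moved to
    U_k = <t^k x, t^(n-k) y> with 0 <= k < n, and U_k is a limit of cyclic subspaces;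
    thus sh is the variety of all t-stable subspaces and N is the locus k > 0, where
    U is contained in t (C[t]/t^n)^2.  It is cut out by the two extreme Pluecker
    coordinates, which are sections of O(1).

    For k > 0 each pencil U_k + s D of t-stable subspaces gives a tangent vector, and
    together with U_k itself n + 2 independent ones are obtained in the cone, whereas
    at v the equations of the minors leave a tangent space of dimension at most n + 1.
    As sh is the closure of the image of an affine space of dimension n, counting
    monomials shows dim sh = n. *)

(* Limits are replaced by polynomial identities. Everything is tested on the open cell of the
   vectors exp(e p) v. A form vanishing along a polynomial curve for all but finitely many s
   vanishes identically in s, with its derivative; this yields both limit points and tangent
   vectors. The cell is enough because exp(f p) maps it into its own closed cone.

   The number 2^n plays two roles. The graded module is no larger than the tensor product, of
   dimension 2^n, and the minors of the cell span that much, so [Psi] is injective without any basis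
   of the fusion product. Moreover minors have degree at most n along B + s B N with N^2 = 0, so the
   exponential series, cut off at dim M = 2^n > n, acts on minors exactly as right multiplication by
   1 + N.

   The extra tangent direction at U_k is the delicate one. Deforming t^k x to t^k x - s t^(k-1) x
   alone destroys t-stability; both generators must be deformed by the same vector with opposite
   signs. *)
Require Import Defs.
From HB Require Import structures.
From mathcomp Require Import all_boot all_order all_fingroup all_algebra.
From mathcomp Require Import boolp classical_sets reals complex mpoly zify ring.

Set Implicit Arguments.
Unset Strict Implicit.
Unset Printing Implicit Defensive.

Import Order.TTheory GRing.Theory Num.Theory.
Local Open Scope classical_set_scope.
Local Open Scope ring_scope.

(** * Truncated polynomials and minors *)

Section Toeplitz.
Variables (K : fieldType) (n : nat).
Implicit Types p q : {poly K}.

(** Multiplication by [p] on K[t]/t^n, acting on rows of coefficients. Ordinary polynomials serve as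
    representatives, since only the coefficients below [n] enter. *)
Definition toep p : 'M[K]_n := \matrix_(i, j) ('X^i * p)`_j.

Lemma coef_low_mul p q r (j : nat) : (j < n)%N ->
  (forall k, (k < n)%N -> p`_k = q`_k) -> (r * p)`_j = (r * q)`_j.
Proof.
move=> jn pq; rewrite !coefM; apply: eq_bigr => k _; congr (_ * _).
by apply: pq; apply: leq_ltn_trans jn; apply: leq_subr.
Qed.

Lemma toep_coef p q : (forall k, (k < n)%N -> p`_k = q`_k) -> toep p = toep q.
Proof. by move=> pq; apply/matrixP => i j; rewrite !mxE; apply: coef_low_mul. Qed.

Lemma poly_rV_toep p q : poly_rV p *m toep q = poly_rV (p * q).
Proof.
apply/rowP => j; rewrite !mxE.
transitivity ((q * \poly_(i < n) p`_i)`_j).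
  rewrite poly_def mulr_sumr coef_sum; apply: eq_bigr => k _.
  by rewrite !mxE -scalerAr coefZ mulrC [q * _]mulrC mulrC.
rewrite [p * q]mulrC; apply: coef_low_mul (ltn_ord j) _ => k kn.
by rewrite coef_poly kn.
Qed.

Lemma row_toep p i : row i (toep p) = poly_rV ('X^i * p).
Proof. by apply/rowP => j; rewrite !mxE. Qed.

Lemma toepM p q : toep (p * q) = toep p *m toep q.
Proof.
apply/row_matrixP => i.
by rewrite row_mul !row_toep poly_rV_toep mulrA.
Qed.

Lemma toep1 : toep 1 = 1%:M.
Proof. by apply/matrixP => i j; rewrite !mxE mulr1 coefXn eq_sym. Qed.

Lemma toepD p q : toep (p + q) = toep p + toep q.
Proof. by apply/matrixP => i j; rewrite !mxE mulrDr coefD. Qed.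

Lemma toepZ c p : toep (c *: p) = c *: toep p.
Proof. by apply/matrixP => i j; rewrite !mxE -scalerAr coefZ. Qed.

Lemma toep0 : toep 0 = 0.
Proof. by apply/matrixP => i j; rewrite !mxE mulr0 coef0. Qed.

Lemma toepN p : toep (- p) = - toep p.
Proof. by rewrite -scaleN1r toepZ scaleN1r. Qed.

Lemma toepC p q : toep p *m toep q = toep q *m toep p.
Proof. by rewrite -!toepM mulrC. Qed.

Lemma det_toep p : \det (toep p) = p`_0 ^+ n.
Proof.
rewrite -det_tr det_trig; last first.
  by apply/is_trig_mxP => i j ij; rewrite !mxE coefXnM ij.
rewrite (eq_bigr (fun=> p`_0)) ?prodr_const ?card_ord // => i _.
by rewrite !mxE coefXnM ltnn subnn.
Qed.

Lemma trunc_inverse p : p`_0 != 0 -> exists q, toep (p * q) = 1%:M.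
Proof.
move=> p0; have /Bezout_eq1_coprimepP[[u v] /= uv] : coprimep p ('X^n).
  apply: coprimep_expr; by rewrite -['X]subr0 -polyC0 coprimep_XsubC /root horner_coef0.
exists u; rewrite -toep1; apply: toep_coef => k kn.
rewrite -uv coefD coefMXn kn addr0 mulrC //.
Qed.

End Toeplitz.

Section Minors.
Variables (K : fieldType) (n : nat).

Definition tensor_idx := {ffun 'I_n -> 'I_(n + n)}.
Definition tensors : vectType K := {ffun tensor_idx -> K^o}.
Implicit Types (B : 'M[K]_(n, n + n)) (i : tensor_idx).

(** Pluecker coordinates indexed by all n-tuples of columns, not only increasing ones: replacing one
    entry of an index stays within the index set and needs no sign. *)
Definition minors B : tensors := [ffun i : tensor_idx => \det (colsub i B)].

Lemma colsub_mul (m k l : nat) (P : 'M[K]_(m, k)) (B : 'M[K]_(k, l)) (f : 'I_n -> 'I_l) :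
  colsub f (P *m B) = P *m colsub f B.
Proof. by apply/matrixP => i j; rewrite !mxE; apply: eq_bigr => r _; rewrite !mxE. Qed.

Lemma minors_mul (P : 'M[K]_n) B : minors (P *m B) = \det P *: minors B.
Proof. by apply/ffunP => i; rewrite !ffunE colsub_mul det_mulmx. Qed.

Definition idx_set i (q : 'I_n) (j : 'I_(n + n)) : tensor_idx :=
  [ffun r => if r == q then j else i r].

(* The derivation of the n-th tensor power of K^(2n) induced by the endomorphism
   [A], acting on row vectors. *)
Definition tensor_act (A : 'M[K]_(n + n)) (F : tensors) : tensors :=
  [ffun i : tensor_idx => \sum_q \sum_j A j (i q) * F (idx_set i q j)].

Lemma tensor_act_is_linear A : linear (tensor_act A).
Proof.
move=> c u v; apply/ffunP => i; have sE (y : K^o) : c *: y = c * y by [].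
rewrite !ffunE sE mulr_sumr -big_split; apply: eq_bigr => q _ /=.
rewrite mulr_sumr -big_split; apply: eq_bigr => j _ /=.
by rewrite !ffunE sE mulrDr mulrCA.
Qed.

Definition pencil (B D : 'M[K]_(n, n + n)) : 'M[{poly K}]_(n, n + n) :=
  map_mx polyC B + 'X *: map_mx polyC D.

Definition minor_pencil B D i : {poly K} := \det (colsub i (pencil B D)).

Lemma horner_minor_pencil B D i s : (minor_pencil B D i).[s] = minors (B + s *: D) i.
Proof.
rewrite ffunE -[LHS]/(horner_eval s _) -det_map_mx; congr (\det _).
by apply/matrixP => a b; rewrite !mxE /= /horner_eval !hornerE.
Qed.

Definition setcol (m : nat) (R : Type) (M : 'M[R]_m) (q : 'I_m) (v : 'I_m -> R) :=
  \matrix_(r, c) if c == q then v r else M r c.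

Lemma det_setcol (m : nat) (R : comPzRingType) (M : 'M[R]_m) q v :
  \det (setcol M q v) = \sum_r v r * cofactor M r q.
Proof.
rewrite (expand_det_col _ q); apply: eq_bigr => r _; rewrite mxE eqxx; congr (_ * _).
rewrite /cofactor; congr (_ * \det _).
by apply/matrixP => a b; rewrite !mxE (eq_sym _ q) (negPf (neq_lift _ _)).
Qed.

Lemma deriv_prod_seq (I : eqType) (r : seq I) (F : I -> {poly K}) : uniq r ->
  (\prod_(i <- r) F i)^`() =
  \sum_(i <- r) \prod_(j <- r) (if j == i then (F j)^`() else F j).
Proof.
elim: r => [|x r IH] /=; first by rewrite !big_nil derivC.
case/andP=> xr ur; rewrite !big_cons derivM eqxx; congr (_ * _ + _).
  apply: eq_big_seq => j jr; case: eqP => // jx; by rewrite -jx jr in xr.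
rewrite IH // mulr_sumr; apply: eq_big_seq => i ir.
by rewrite big_cons; case: eqP => // xi; rewrite xi ir in xr.
Qed.

Lemma deriv_det (m : nat) (M : 'M[{poly K}]_m) :
  (\det M)^`() = \sum_q \det (setcol M q (fun r => (M r q)^`())).
Proof.
rewrite linear_sum exchange_big /=; apply: eq_bigr => s _.
transitivity (\sum_q (-1) ^+ s * \prod_i (if i == q then (M i (s i))^`() else M i (s i))).
  rewrite -mulr_sumr -deriv_prod_seq ?index_enum_uniq //.
  by case: (odd_perm s); rewrite ?expr0 ?expr1 ?mul1r // !mulN1r derivN.
rewrite (reindex_inj (@perm_inj _ s^-1%g)); apply: eq_bigr => q _; congr (_ * _).
apply: eq_bigr => r _; rewrite mxE.
have -> : (r == s^-1%g q) = (s r == q) by rewrite (canF_eq (permK s)).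
by case: eqP => [->|].
Qed.

Lemma deriv_minor_pencil B D i s :
  (minor_pencil B D i)^`().[s] =
  \sum_q \det (setcol (colsub i (B + s *: D)) q (fun r => D r (i q))).
Proof.
rewrite deriv_det horner_sum; apply: eq_bigr => q _.
rewrite -[LHS]/(horner_eval s _) -det_map_mx; congr (\det _).
apply/matrixP => a b; rewrite !mxE /= /horner_eval; case: eqP => _ /=.
  by rewrite derivD derivM derivX !derivC !hornerE ?mulr0 ?addr0 ?add0r ?mul1r.
by rewrite !hornerE.
Qed.

(** Expansion along the replaced column gives the sum of determinants of [deriv_minor_pencil], so
    the derivation differentiates the minors along B + s B A at s = 0. *)
Lemma tensor_act_minors A B i :
  tensor_act A (minors B) i =
  \sum_q \det (setcol (colsub i B) q (fun r => (B *m A) r (i q))).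
Proof.
rewrite ffunE; apply: eq_bigr => q _; rewrite det_setcol.
transitivity (\sum_j \sum_r A j (i q) * (B r j * cofactor (colsub i B) r q)).
  apply: eq_bigr => j _; rewrite -mulr_sumr; congr (_ * _).
  rewrite ffunE -(det_setcol _ _ (fun r => B r j)); congr (\det _).
  by apply/matrixP => a b; rewrite !mxE ffunE; case: eqP.
rewrite exchange_big; apply: eq_bigr => r _ /=.
rewrite mxE mulr_suml; apply: eq_bigr => j _.
by rewrite mulrCA mulrA.
Qed.

(** On the minors of B this is adj(B_S) B by Cramer's rule ([slice_minors]), so where the
    [S]-coordinate is nonzero it recovers the row space of B. *)
Definition slice (F : tensors) (S : tensor_idx) : 'M[K]_(n, n + n) :=
  \matrix_(q, l) F (idx_set S q l).

Lemma slice_minors B S : slice (minors B) S = \adj (colsub S B) *m B.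
Proof.
apply/matrixP => q l; rewrite !mxE ffunE.
have -> : colsub (idx_set S q l) B = setcol (colsub S B) q (fun r => B r l).
  by apply/matrixP => a b; rewrite !mxE ffunE; case: eqP.
by rewrite det_setcol; apply: eq_bigr => r _; rewrite !mxE mulrC.
Qed.

Lemma det_setcol1 (q : 'I_n) (v : 'I_n -> K) : \det (setcol 1%:M q v) = v q.
Proof.
rewrite det_setcol (bigD1 q) //= big1 ?addr0 => [|r ne].
  have := congr1 (fun A : 'M[K]_n => A q q) (adj1 K n); rewrite !mxE eqxx => ->.
  by rewrite mulr1.
have := congr1 (fun A : 'M[K]_n => A q r) (adj1 K n); rewrite !mxE eq_sym (negPf ne) => ->.
by rewrite mulr0.
Qed.

Lemma tensorsZE (c : K) (F : tensors) i : (c *: F) i = c * F i.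
Proof. by rewrite ffunE. Qed.

Definition all_x : tensor_idx := [ffun q => lshift n q].

Definition all_y : tensor_idx := [ffun q => rshift n q].

Lemma minors_all_x (A B : 'M[K]_n) : minors (row_mx A B) all_x = \det A.
Proof.
by rewrite ffunE; congr (\det _); apply/matrixP => i j; rewrite !mxE ffunE (unsplitK (inl _)).
Qed.

Lemma minors_all_y (A B : 'M[K]_n) : minors (row_mx A B) all_y = \det B.
Proof.
by rewrite ffunE; congr (\det _); apply/matrixP => i j; rewrite !mxE ffunE (unsplitK (inr _)).
Qed.

End Minors.

Arguments all_x {n}.
Arguments all_y {n}.

Section PolyVanishing.
Variable K : numFieldType.
Implicit Types p b : {poly K}.

Lemma poly_all_roots p : (forall s, p.[s] = 0) -> p = 0.
Proof.
move=> p0; apply/eqP; apply/negPn/negP => pn0.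
pose rs : seq K := [seq i%:R | i <- iota 0 (size p)].
have urs : uniq rs by rewrite map_inj_uniq ?iota_uniq //; apply: mulrIn; rewrite oner_eq0.
have ars : all (root p) rs by apply/allP => x _; apply/rootP.
by have := max_poly_roots pn0 ars urs; rewrite size_map size_iota ltnn.
Qed.

Lemma poly_cofinite_roots b p : b != 0 ->
  (forall s, b.[s] != 0 -> p.[s] = 0) -> p = 0.
Proof.
move=> b0 bp; have : b * p = 0.
  apply: poly_all_roots => s; rewrite hornerM.
  by case: (eqVneq b.[s] 0) => [->|/bp ->]; rewrite ?mul0r ?mulr0.
by move/eqP; rewrite mulf_eq0 (negPf b0) => /eqP.
Qed.

End PolyVanishing.

Section TensorExp.
Variables (K : numFieldType) (n : nat).
Implicit Types (B D : 'M[K]_(n, n + n)).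

Lemma size_minor_pencil B D i : (size (minor_pencil B D i) <= n.+1)%N.
Proof.
apply: (leq_trans (size_sum _ _ _)); apply/bigmax_leqP => s _.
have -> : ((-1) ^+ s : {poly K}) = ((-1) ^+ s)%:P.
  by case: (odd_perm s); rewrite ?expr0 ?expr1 // polyCN.
rewrite mul_polyC; apply: (leq_trans (size_scale_leq _ _)).
apply: (leq_trans (size_prod_leq _ _)); rewrite card_ord.
have : (\sum_(q < n) size (colsub i (pencil B D) q (s q)) <= \sum_(q < n) 2)%N.
  apply: leq_sum => q _; rewrite !mxE addrC mulrC mul_polyC.
  by rewrite -mul_polyC size_MXaddC; case: ifP => // _; apply: leq_ltn_trans (size_polyC_leq1 _) _.
rewrite sum_nat_const card_ord muln2 -addnn => le.
by rewrite leq_subLR addnS ltnS.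
Qed.

Lemma deriv_minor_pencil_act (N : 'M[K]_(n + n)) B i : N *m N = 0 ->
  (minor_pencil B (B *m N) i)^`() =
  \sum_q \sum_j N j (i q) *: minor_pencil B (B *m N) (idx_set i q j).
Proof.
move=> NN; apply/eqP; rewrite -subr_eq0; apply/eqP; apply: poly_all_roots => s.
rewrite hornerD hornerN deriv_minor_pencil horner_sum.
(* Since N^2 = 0, the direction B N is the same at every point of the pencil, so the identity holds
   at all s and not only at 0. *)
have BN : (B + s *: (B *m N)) *m N = B *m N.
  by rewrite mulmxDl -scalemxAl -mulmxA NN mulmx0 scaler0 addr0.
have := tensor_act_minors N (B + s *: (B *m N)) i; rewrite BN => <-.
rewrite ffunE; apply/eqP; rewrite subr_eq0; apply/eqP.
apply: eq_bigr => q _; rewrite horner_sum; apply: eq_bigr => j _.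
by rewrite hornerZ horner_minor_pencil.
Qed.

(** The k-th iterate is the k-th derivative at 0 of a polynomial of degree at most [n], so the sum
    is its Taylor expansion evaluated at 1; [n < m] ensures that no term is lost. *)
Lemma tensor_exp_minors (N : 'M[K]_(n + n)) B m : N *m N = 0 -> (n < m)%N ->
  \sum_(k < m) k`!%:R^-1 *: iter k (tensor_act N) (minors B) =
  minors (B *m (1%:M + N)).
Proof.
move=> NN nm; apply/ffunP => i.
have it k j : iter k (tensor_act N) (minors B) j =
    (minor_pencil B (B *m N) j)^`(k).[0].
  elim: k j => [|k IH] j; first by rewrite /= horner_minor_pencil scale0r addr0.
  rewrite iterS ffunE derivSn deriv_minor_pencil_act // linear_sum horner_sum.
  apply: eq_bigr => q _; rewrite linear_sum horner_sum; apply: eq_bigr => l _.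
  by rewrite IH linearZ /= hornerZ.
rewrite mulmxDr mulmx1 -[B *m N]scale1r -horner_minor_pencil.
rewrite -[X in _.[X]]add0r.
rewrite (@nderiv_taylor_wide _ m _ 0 1); first last.
- exact: leq_trans (size_minor_pencil _ _ _) nm.
- exact: commr1.
rewrite sum_ffunE; apply: eq_bigr => k _; rewrite expr1n mulr1 ffunE it.
have sE (c : K) (y : K^o) : c *: y = c * y by [].
rewrite sE nderivn_def hornerMn -[_.[0] *+ _]mulr_natl mulrA mulVf ?mul1r // pnatr_eq0.
by rewrite -lt0n fact_gt0.
Qed.

End TensorExp.

(** * Linear independence of the minors of the cell *)

Section CellMinors.

(* [(b, l)] stands for the column of t^l y (if [b]) or t^l x. *)
Fixpoint cell_cols (s : bitseq) (q : nat) : bool * nat :=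
  if s is b :: s' then
    if b then if q is q'.+1 then let: (c, l) := cell_cols s' q' in (c, l.+1)
              else (true, 0%N)
    else if q == size s' then (false, size s')
         else let: (c, l) := cell_cols s' q in (c, if c then l.+1 else l)
  else (false, 0%N).

(** Entries of the block matrix (1 | toep a), over an arbitrary ring so that a_0 can later be made
    an indeterminate. *)
Definition cell_entry (R : pzRingType) (a : nat -> R) (r : nat) (bl : bool * nat) : R :=
  if bl.1 then (if (r <= bl.2)%N then a (bl.2 - r)%N else 0) else (r == bl.2)%:R.

Definition cell_minor (R : comPzRingType) (a : nat -> R) (s : bitseq) : R :=
  \det (\matrix_(r < size s, q < size s) cell_entry a r (cell_cols s q)).

Lemma cell_cols_lt s q : (q < size s)%N -> ((cell_cols s q).2 < size s)%N.
Proof.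
elim: s q => [|[] s IH] q //= qs.
  by case: q qs => // q qs; case: (cell_cols s q) (IH q qs).
case: eqP => [_|/eqP ne] //=.
have h : (q < size s)%N by rewrite ltn_neqAle ne.
by case: (cell_cols s q) (IH _ h) => [[]] l //= /ltnW.
Qed.

(** The first column is that of y, equal to a_0 times the first basis vector. *)
Lemma cell_minor_true (R : comNzRingType) (a : nat -> R) s :
  cell_minor a (true :: s) = a 0%N * cell_minor a s.
Proof.
rewrite /cell_minor (expand_det_col _ ord0) (bigD1 ord0) //= big1 ?addr0; last first.
  by move=> [[|r] hr] // _; rewrite mxE /= /cell_entry /= mul0r.
rewrite mxE /cell_entry /= subn0 /cofactor addn0 expr0 mul1r; congr (_ * \det _).
apply/matrixP => i j; rewrite !mxE /= /bump /= !add1n.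
by case: (cell_cols s j) => [[] l]; rewrite /cell_entry //= ltnS subSS.
Qed.

(** The last column is that of t^(size s) x, the last basis vector. In the remaining minor the
    y-columns have power l + 1 instead of l; as a_0 = 0, this amounts to shifting the sequence. *)
Lemma cell_minor_false (R : comNzRingType) (a : nat -> R) s : a 0%N = 0 ->
  cell_minor a (false :: s) = cell_minor (fun k => a k.+1) s.
Proof.
move=> a0; rewrite /cell_minor (expand_det_col _ ord_max) (bigD1 ord_max) //= big1 ?addr0.
  rewrite mxE /= eqxx /cell_entry /= eqxx mul1r /cofactor -signr_odd oddD addbb expr0 mul1r.
  congr (\det _); apply/matrixP => i j; rewrite !mxE /= /bump /=.
  rewrite ![(size s <= _)%N]leqNgt !ltn_ord !add0n (ltn_eqF (ltn_ord j)).
  case: (cell_cols s j) => [[] l] //=; rewrite /cell_entry /=.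
  case: (ltngtP i l) => il.
  - have -> : (i <= l.+1)%N by apply: leqW; apply: ltnW.
    by rewrite subSn //; apply: ltnW.
  - case: ltnP => // il'; have -> : val i = l.+1 by apply/eqP; rewrite eqn_leq il' il.
    by rewrite subnn.
  - by rewrite il leqnSn subSn // subnn.
move=> r; rewrite -val_eqE /= => ne; rewrite mxE /= eqxx /cell_entry /=.
by rewrite (negPf ne) mul0r.
Qed.

Fixpoint bitseqs (n : nat) : seq bitseq :=
  if n is n'.+1 then
    [seq true :: s | s <- bitseqs n'] ++ [seq false :: s | s <- bitseqs n']
  else [:: [::]].

Lemma size_bitseqs n : size (bitseqs n) = (2 ^ n)%N.
Proof. by elim: n => //= n IH; rewrite size_cat !size_map IH addnn -mul2n expnS. Qed.

Lemma bitseqs_size n s : s \in bitseqs n -> size s = n.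
Proof.
elim: n s => [|n IH] s /=; first by rewrite inE => /eqP ->.
by rewrite mem_cat => /orP[] /mapP[t /IH <- ->].
Qed.

Lemma uniq_bitseqs n : uniq (bitseqs n).
Proof.
elim: n => //= n IH; rewrite cat_uniq !map_inj_uniq ?IH => [|x y []|x y []] //.
by rewrite andbT; apply/hasPn => _ /mapP[t _ ->]; apply/negP => /mapP[].
Qed.

(* Setting a_0 = 0 isolates the terms with leading bit [false]; the remaining
   ones are divisible by a_0. *)
Lemma cell_minors_independent (K : numFieldType) n (c : bitseq -> K) :
  (forall a, \sum_(s <- bitseqs n) c s * cell_minor a s = 0) ->
  forall s, s \in bitseqs n -> c s = 0.
Proof.
elim: n c => [|n IH] c h s /=.
  rewrite inE => /eqP ->; have := h (fun=> 0); rewrite big_seq1 /cell_minor.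
  by rewrite det_mx00 mulr1.
have split_sum a : \sum_(s <- bitseqs n.+1) c s * cell_minor a s =
    a 0%N * (\sum_(s <- bitseqs n) c (true :: s) * cell_minor a s)
    + \sum_(s <- bitseqs n) c (false :: s) * cell_minor a (false :: s).
  rewrite /= big_cat !big_map mulr_sumr; congr (_ + _); apply: eq_bigr => t _.
  by rewrite cell_minor_true mulrCA.
have cF t : t \in bitseqs n -> c (false :: t) = 0.
  apply: (IH (fun t => c (false :: t))) => a.
  have := h (fun k => if k is k'.+1 then a k' else 0); rewrite split_sum mul0r add0r => e.
  rewrite -[RHS]e; by apply: eq_bigr => u _; rewrite cell_minor_false.
have cT t : t \in bitseqs n -> c (true :: t) = 0.
  apply: (IH (fun t => c (true :: t))) => a.
  (* The relation is only known after multiplication by a_0. With X + a_0 in place of a_0 the other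
     factor becomes a polynomial in X that vanishes off one point, hence everywhere; X = 0 gives
     back [a], even if a_0 = 0. *)
  pose A k : {poly K} := if k is k'.+1 then (a k'.+1)%:P else 'X + (a 0%N)%:P.
  pose G := \sum_(u <- bitseqs n) (c (true :: u))%:P * cell_minor A u.
  have hA x u : (cell_minor A u).[x] = cell_minor (fun k => (A k).[x]) u.
    rewrite -[LHS]/(horner_eval x _) -det_map_mx; congr (\det _); apply/matrixP => i j.
    rewrite !mxE /= /horner_eval /cell_entry; case: ifP => _; last first.
      by case: (_ == _); rewrite /= ?mulr1n ?mulr0n -?polyC1 -?polyC0 ?hornerC.
    by case: ifP => _ //; rewrite horner0.
  have hG x : G.[x] = \sum_(u <- bitseqs n) c (true :: u) * cell_minor (fun k => (A k).[x]) u.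
    by rewrite horner_sum; apply: eq_bigr => u _; rewrite hornerCM hA.
  have G0 : G = 0.
    apply: (@poly_cofinite_roots _ ('X + (a 0%N)%:P)).
      by rewrite -size_poly_gt0 size_XaddC.
    move=> x xa; have := h (fun k => (A k).[x]); rewrite split_sum.
    have -> : \sum_(u <- bitseqs n) c (false :: u)
                * cell_minor (fun k => (A k).[x]) (false :: u) = 0.
      by rewrite big_seq big1 // => u /cF ->; rewrite mul0r.
    rewrite addr0 -hG => /eqP; rewrite mulf_eq0 /= => /orP[|/eqP //].
    by rewrite (negPf xa).
  have := hG 0; rewrite G0 horner0 => e; rewrite [RHS]e; apply: eq_bigr => u _; congr (_ * \det _).
  apply/matrixP => i j; rewrite !mxE /cell_entry; case: ifP => // _; case: ifP => // _.
  by case: (_ - _)%N => [|k] /=; rewrite !hornerE // add0r.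
by rewrite mem_cat => /orP[] /mapP[t tn ->]; [apply: cT | apply: cF].
Qed.

End CellMinors.

Lemma dim_ffun_regular (K : fieldType) (I : finType) :
  \dim (fullv : {vspace {ffun I -> K^o}}) = #|I|.
Proof. by rewrite dimvf /dim /= muln1. Qed.

Lemma ffun_basisE (K : fieldType) (I : finType) (u : {ffun I -> K^o}) :
  u = \sum_i u i *: [ffun k => (k == i)%:R : K^o].
Proof.
apply/ffunP => j; rewrite sum_ffunE (bigD1 j) //= big1 ?addr0 => [|i ne].
  by rewrite !ffunE eqxx; exact: (esym (mulr1 _)).
by rewrite !ffunE eq_sym (negPf ne); exact: mulr0.
Qed.

(** The functional is a nonzero coordinate of the complementary projection [\1 - projv U], which
    kills [U]. *)
Lemma proper_vspace_functional (K : fieldType) (I : finType)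
    (U : {vspace {ffun I -> K^o}}) : U != fullv ->
  exists c : I -> K, (exists i, c i != 0) /\
    forall u : {ffun I -> K^o}, u \in U -> \sum_i c i * u i = 0.
Proof.
move=> nfull; pose f := (\1 - projv U)%VF.
have fU u : u \in U -> f u = 0.
  by move=> uU; rewrite add_lfunE opp_lfunE id_lfunE projv_id // subrr.
have [i0 [j0 ne]] : exists i j, f [ffun k => (k == i)%:R] j != 0.
  apply: contrapT => h; case/negP: nfull; apply/eqP/vspaceP => u; rewrite memvf.
  have {h} f0 i : f [ffun k => (k == i)%:R] = 0.
    apply/ffunP => j; rewrite [RHS]ffunE; apply: contrapT => /eqP ne.
    by apply: h; exists i, j.
  have : f u = 0.
    by rewrite [u]ffun_basisE linear_sum big1 // => i _; rewrite linearZ /= f0 scaler0.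
  rewrite add_lfunE opp_lfunE id_lfunE => /eqP; rewrite subr_eq0 => /eqP ->.
  by rewrite memv_proj.
exists (fun i => f [ffun k => (k == i)%:R] j0); split; first by exists i0.
move=> u /fU fu; have := congr1 (fun g : {ffun I -> K^o} => g j0) fu.
rewrite {1}[u]ffun_basisE linear_sum sum_ffunE [RHS]ffunE => {2}<-.
by apply: eq_bigr => i _; rewrite linearZ /= ffunE mulrC.
Qed.

Lemma dim_inj_img (K : fieldType) (M : vectType K) (f : 'End(M)) (T : {vspace M}) :
  injective f -> \dim (f @: T) = \dim T.
Proof.
by move=> /lker0P fi; apply: limg_dim_eq; rewrite (eqP fi) capv0.
Qed.

Section CellSpan.
Variables (K : numFieldType) (n : nat).

Definition cell_idx (s : bitseq) : tensor_idx n :=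
  [ffun q : 'I_n => let: (b, l) := cell_cols s q in
     if insub l is Some o then if b then rshift n o else lshift n o else lshift n q].

Definition cell_frame (p : {poly K}) : 'M[K]_(n, n + n) := row_mx 1%:M (toep n p).

Lemma minors_cell_idx p s : size s = n ->
  minors (cell_frame p) (cell_idx s) = cell_minor (fun k => p`_k) s.
Proof.
rewrite /cell_idx /cell_frame => <-; rewrite ffunE; congr (\det _); apply/matrixP => r q.
rewrite !mxE ffunE; have := cell_cols_lt (ltn_ord q).
case: (cell_cols s q) => b l /= ls; rewrite insubT /cell_entry /=; case: b.
  by rewrite (unsplitK (inr _)) mxE coefXnM /= ltnNge; case: leqP.
by rewrite (unsplitK (inl _)) mxE.
Qed.

(** If evaluation at the 2^n indices [cell_idx] did not map Y onto all functions, a functional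
    vanishing on the image would be a linear relation against [cell_minors_independent]. *)
Lemma cell_span_dim (Y : {vspace tensors K n}) :
  (forall p, minors (cell_frame p) \in Y) -> (2 ^ n <= \dim Y)%N.
Proof.
move=> Yp; pose N := (2 ^ n)%N.
pose E : vectType K := {ffun 'I_N -> K^o}.
pose ev0 (F : tensors K n) : E :=
  [ffun j : 'I_N => F (cell_idx (nth [::] (bitseqs n) j))].
have ev_lin : linear ev0 by move=> c u v; apply/ffunP => j; rewrite !ffunE.
pose evM := GRing.isLinear.Build _ _ _ _ _ ev_lin.
pose evL : {linear tensors K n -> E} := HB.pack ev0 evM.
pose ev := linfun evL.
have ev_full : (ev @: Y = fullv)%VS.
  apply/eqP/negPn/negP => /proper_vspace_functional[c [[i ci] cY]].
  pose c' s := if insub (index s (bitseqs n)) is Some j then c j else 0.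
  have Nn : size (bitseqs n) = N by rewrite size_bitseqs.
  have c'E (j : 'I_N) : c' (nth [::] (bitseqs n) j) = c j.
    by rewrite /c' index_uniq ?uniq_bitseqs ?Nn // valK.
  have c'0 s : s \in bitseqs n -> c' s = 0.
    apply: cell_minors_independent => a; pose p := \poly_(k < n) a k.
    have /cY : ev (minors (cell_frame p)) \in (ev @: Y)%VS by apply: memv_img.
    rewrite (big_nth [::]) Nn big_mkord => e; rewrite -[RHS]e; apply: eq_bigr => j _.
    have sj : size (nth [::] (bitseqs n) j) = n.
      by apply: bitseqs_size; apply: mem_nth; rewrite Nn.
    rewrite c'E lfunE /= ffunE minors_cell_idx //; congr (_ * _).
    congr (\det _); apply/matrixP => r q; rewrite !mxE /cell_entry; case: ifP => // _.
    case: ifP => // le; rewrite coef_poly; case: ltnP => //.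
    have := cell_cols_lt (ltn_ord q); rewrite {2}sj => lt.
    by rewrite leqNgt (leq_ltn_trans (leq_subr _ _) lt).
  by case/eqP: ci; rewrite -c'E c'0 // mem_nth // Nn.
have : (\dim (ev @: Y) <= \dim Y)%N by rewrite -(limg_ker_dim ev Y) leq_addl.
by rewrite ev_full dim_ffun_regular card_ord.
Qed.

(** At [all_x] the frame has the identity block, so exchanging one column reads off a single entry;
    for y-columns these are coefficients of [p], the affine coordinates of the cell. *)
Lemma cell_coord p q c :
  minors (cell_frame p) (idx_set all_x q c) = cell_frame p q c :> K.
Proof.
have -> : minors (cell_frame p) (idx_set all_x q c) = slice (minors (cell_frame p)) all_x q c.
  by rewrite mxE.
rewrite slice_minors.
have -> : colsub all_x (cell_frame p) = 1%:M.
  by apply/matrixP => i j; rewrite !mxE ffunE (unsplitK (inl _)) mxE.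
by rewrite adj1 mul1mx.
Qed.

Lemma cell_coord_x p : minors (cell_frame p) all_x = 1 :> K.
Proof. by rewrite minors_all_x det1. Qed.

End CellSpan.

(** * Homogeneous equations, cones and tangent spaces *)

Section MPolyCalculus.

Lemma mpoly_ring_ind (n : nat) (R : comNzRingType) (P : {mpoly R[n]} -> Prop) :
  (forall c, P c%:MP) -> (forall i, P 'X_i) ->
  (forall p q, P p -> P q -> P (p + q)) ->
  (forall p q, P p -> P q -> P (p * q)) -> forall p, P p.
Proof.
move=> PC PX PD PM; apply: mpolyind => [|c m p _ _ Pp]; first exact: (PC 0).
apply: (PD) => //; rewrite -mul_mpolyC; apply: (PM) => //; rewrite mpolyXE_id.
elim/big_rec: _ => [|i x _ Px]; first exact: (PC 1).
apply: (PM) => //; elim: (m i) => [|k IH]; first exact: (PC 1).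
by rewrite exprS; apply: (PM).
Qed.

Lemma det_homog (K : comNzRingType) (m d : nat) (A : 'M[{mpoly K[d]}]_m) :
  (forall i j, A i j \is 1.-homog) -> \det A \is m.-homog.
Proof.
move=> hA; apply: rpred_sum => s _.
have -> : ((-1) ^+ s : {mpoly K[d]}) = ((-1) ^+ s : K)%:MP.
  by case: (odd_perm s); rewrite ?expr0 ?expr1 // mpolyCN mpolyC1.
rewrite mul_mpolyC; apply: rpredZ.
have prod_homog k (f : 'I_k -> {mpoly K[d]}) : (forall i, f i \is 1.-homog) ->
    \prod_i f i \is k.-homog.
  elim: k f => [|k IH] f hf; first by rewrite big_ord0 dhomog1.
  by rewrite big_ord_recl; apply: (@dhomogM _ _ _ 1%N _ k) => //; apply: IH.
by apply: prod_homog.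
Qed.

Variables (K : numClosedFieldType) (n : nat).
Implicit Types (p : {mpoly K[n]}) (r : 'I_n -> {poly K}).

Definition mpoly_curve p r : {poly K} := mmap (@polyC K) r p.

Lemma horner_mpoly_curve p r s : (mpoly_curve p r).[s] = p.@[fun i => (r i).[s]].
Proof.
rewrite /mpoly_curve; elim/mpoly_ring_ind: p => [c|i|p q IHp IHq|p q IHp IHq].
- by rewrite mmapC mevalC hornerC.
- by rewrite mmapX mmap1U mevalXU.
- by rewrite mmapD mevalD hornerD IHp IHq.
- by rewrite rmorphM mevalM hornerM IHp IHq.
Qed.

Lemma deriv_mpoly_curve p r :
  (mpoly_curve p r)^`() = \sum_j mpoly_curve p^`M(j) r * (r j)^`().
Proof.
rewrite /mpoly_curve; elim/mpoly_ring_ind: p => [c|i|p q IHp IHq|p q IHp IHq].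
- by rewrite mmapC derivC big1 // => j _; rewrite mderivC mmap0 mul0r.
- rewrite mmapX mmap1U (bigD1 i) //= big1 ?addr0 => [|j ne].
    rewrite mderivX mnm1E eqxx scale1r.
    have -> : (U_(i) - U_(i) = 0)%MM by apply/mnmP => k; rewrite mnmBE mnm0E subnn.
    by rewrite mpolyX0 rmorph1 mul1r.
  by rewrite mderivX mnm1E eq_sym (negPf ne) scale0r mmap0 mul0r.
- rewrite mmapD derivD IHp IHq -big_split; apply: eq_bigr => j _.
  by rewrite mderivD mmapD mulrDl.
- rewrite rmorphM derivM IHp IHq mulr_suml mulr_sumr -big_split; apply: eq_bigr => j _.
  by rewrite mderivM mmapD !rmorphM /= mulrDl mulrAC mulrA.
Qed.

Lemma dhomog_meval_scale d p c v : p \is d.-homog ->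
  p.@[fun i => c * v i] = c ^+ d * p.@[v].
Proof.
move=> /dhomogP hp; rewrite !mevalE mulr_sumr; apply: eq_big_seq => m /hp md.
rewrite mulrCA; congr (_ * _); rewrite -md /= mdegE -prodrXr -big_split.
by apply: eq_bigr => i _; rewrite exprMn.
Qed.

Lemma dhomog_mderiv d p j : p \is d.-homog -> p^`M(j) \is d.-1.-homog.
Proof.
move=> /dhomogP hp; apply/dhomogP => m; rewrite mcoeff_msupp mcoeff_mderiv => ne.
have : (m + U_(j))%MM \in msupp p.
  by rewrite mcoeff_msupp; apply: contraNneq ne => ->; rewrite mul0rn.
by move/hp => <-; rewrite /= mdegD mdeg1 addn1.
Qed.

End MPolyCalculus.

Section Cones.
Context {K : numClosedFieldType} {M : vectType K}.
Local Notation dM := (\dim {: M}).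
Implicit Types (p : {mpoly K[dM]}) (x y w : M).

Definition vec_of (c : 'I_dM -> K) : M := \sum_j c j *: (vbasis {: M})`_j.

Lemma coordv_vec_of c j : coordv (vec_of c) j = c j.
Proof. by rewrite /coordv coord_sum_free // (basis_free (vbasisP _)). Qed.

Lemma vec_of_coordv x : vec_of (coordv x) = x.
Proof. exact/esym/coord_vbasis/memvf. Qed.

Lemma coordv_lin c x y j : coordv (c *: x + y) j = c * coordv x j + coordv y j.
Proof. by rewrite /coordv linearP. Qed.

Lemma coordv_scale c x j : coordv (c *: x) j = c * coordv x j.
Proof. by rewrite /coordv linearZ. Qed.

Lemma pevalv_vec_of p c : pevalv p (vec_of c) = p.@[c].
Proof. by apply: meval_eq => j; rewrite coordv_vec_of. Qed.

Lemma pevalv_scale d p c x : p \is d.-homog -> pevalv p (c *: x) = c ^+ d * pevalv p x.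
Proof.
move=> hp; rewrite -(dhomog_meval_scale _ _ hp); apply: meval_eq => j.
exact: coordv_scale.
Qed.

Definition lin_mpoly (f : M -> K) : {mpoly K[dM]} :=
  \sum_(j < dM) f (vbasis {: M})`_j *: 'X_j.

Lemma lin_mpoly_homog f : lin_mpoly f \is 1.-homog.
Proof. by apply: rpred_sum => j _; apply: rpredZ; rewrite dhomogX /= mdeg1. Qed.

Lemma pevalv_lin_mpoly (f : M -> K) x :
  (forall c u v, f (c *: u + v) = c * f u + f v) -> pevalv (lin_mpoly f) x = f x.
Proof.
move=> fl; have f0 : f 0 = 0.
  by have := fl 1 0 0; rewrite scale1r mul1r addr0 => /eqP;
     rewrite -subr_eq0 opprD addNKr oppr_eq0 => /eqP.
rewrite -{2}[x]vec_of_coordv /vec_of /pevalv rmorph_sum /=.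
transitivity (\sum_(j < dM) coordv x j * f (vbasis {: M})`_j).
  by apply: eq_bigr => j _; rewrite mevalZ mevalXU mulrC.
by elim/big_rec2: _ => [|j u v _ ->] //; rewrite fl.
Qed.

Definition dir_deriv p x w : K := \sum_j pevalv p^`M(j) x * coordv w j.

Definition line x w : 'I_dM -> {poly K} := fun j => (coordv x j)%:P + (coordv w j) *: 'X.

Lemma horner_line p x w s : (mpoly_curve p (line x w)).[s] = pevalv p (x + s *: w).
Proof.
rewrite horner_mpoly_curve; apply: meval_eq => j.
by rewrite addrC coordv_lin !hornerE addrC mulrC.
Qed.

Lemma deriv_line p x w : (mpoly_curve p (line x w))^`().[0] = dir_deriv p x w.
Proof.
rewrite deriv_mpoly_curve horner_sum; apply: eq_bigr => j _.
rewrite hornerM horner_line scale0r addr0; congr (_ * _).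
by rewrite derivD derivC derivZ derivX add0r !hornerE.
Qed.

(* The equations of the cone over the projective closure of [A], and of its
   tangent space at [y]. *)
Definition in_cone (A : set M) (y : M) : Prop := forall d p,
  p \is d.-homog -> (forall a, A a -> pevalv p a = 0) -> pevalv p y = 0.

Definition cone_tangent (A : set M) (y w : M) : Prop := forall d p,
  p \is d.-homog -> (forall a, A a -> pevalv p a = 0) -> dir_deriv p y w = 0.

Lemma in_cone_scale A c y : in_cone A y -> in_cone A (c *: y).
Proof. by move=> h d p hp p0; rewrite (pevalv_scale _ _ hp) (h d p) ?mulr0. Qed.

Lemma cone_tangent_scale A c y w : cone_tangent A y w -> cone_tangent A (c *: y) w.
Proof.
move=> h d p hp p0; have := h d p hp p0; rewrite /dir_deriv.
move/(congr1 ( *%R (c ^+ d.-1))); rewrite mulr0 => e; rewrite -[RHS]e mulr_sumr.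
by apply: eq_bigr => j _; rewrite (pevalv_scale _ _ (dhomog_mderiv j hp)) mulrA.
Qed.

Lemma cone_tangentE A c y w : c != 0 -> cone_tangent A (c *: y) w <-> cone_tangent A y w.
Proof.
move=> c0; split=> [|/cone_tangent_scale//]; move/(@cone_tangent_scale _ c^-1).
by rewrite scalerA mulVf // scale1r.
Qed.

Lemma cone_tangent_lin A y c u w :
  cone_tangent A y u -> cone_tangent A y w -> cone_tangent A y (c *: u + w).
Proof.
move=> hu hw d p hp p0; have := hu d p hp p0; have := hw d p hp p0.
rewrite /dir_deriv => e1 e2.
transitivity (c * (\sum_j pevalv p^`M(j) y * coordv u j) + \sum_j pevalv p^`M(j) y * coordv w j).
  rewrite mulr_sumr -big_split; apply: eq_bigr => j _.
  by rewrite coordv_lin mulrDr mulrCA.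
by rewrite e1 e2 mulr0 addr0.
Qed.

Lemma dir_deriv_affine p x w a b :
  (forall s, pevalv p (x + s *: w) = a + s * b) -> dir_deriv p x w = b.
Proof.
move=> h; rewrite -deriv_line.
have -> : mpoly_curve p (line x w) = a%:P + b *: 'X.
  apply/eqP; rewrite -subr_eq0; apply/eqP; apply: poly_all_roots => s.
  by rewrite hornerD hornerN horner_line h !hornerE [b * s]mulrC subrr.
by rewrite derivD derivC derivZ derivX add0r !hornerE.
Qed.

Lemma cone_tangent_self A y : in_cone A y -> cone_tangent A y y.
Proof.
move=> cy d p hp p0; apply: (@dir_deriv_affine p y y 0) => s.
by rewrite -[X in X + _]scale1r -scalerDl (pevalv_scale _ _ hp) (cy d p) // !mulr0 addr0.
Qed.

(** The substitute for limits: along the curve an equation of the cone is a polynomial in s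
    vanishing off the roots of [b], hence zero. So it also vanishes at the exceptional s, and its
    derivative gives the tangent vector by the chain rule. *)
Lemma cone_curve A (r : 'I_dM -> {poly K}) (b : {poly K}) : b != 0 ->
  (forall s, b.[s] != 0 -> in_cone A (vec_of (fun j => (r j).[s]))) ->
  forall s, in_cone A (vec_of (fun j => (r j).[s])) /\
    cone_tangent A (vec_of (fun j => (r j).[s])) (vec_of (fun j => (r j)^`().[s])).
Proof.
move=> b0 hr s.
have z d p : p \is d.-homog -> (forall a, A a -> pevalv p a = 0) -> mpoly_curve p r = 0.
  move=> hp p0; apply: (poly_cofinite_roots b0) => t bt.
  by rewrite horner_mpoly_curve -pevalv_vec_of; apply: (hr t bt d).
split=> d p hp p0.
  by rewrite pevalv_vec_of -horner_mpoly_curve (z d) // horner0.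
have := deriv_mpoly_curve p r; rewrite (z d) // derivC => /(congr1 (horner^~ s)).
rewrite horner0 horner_sum => e; rewrite [RHS]e; apply: eq_bigr => j _.
by rewrite hornerM horner_mpoly_curve coordv_vec_of -pevalv_vec_of.
Qed.

(** Equations are pulled back along [f]: substitution of linear forms preserves homogeneity, and the
    pull-back vanishes on [A] whenever the equation does. *)
Lemma cone_map A (f : 'End(M)) : (forall a, A a -> in_cone A (f a)) -> forall y,
  (in_cone A y -> in_cone A (f y)) /\
  (forall w, cone_tangent A y w -> cone_tangent A (f y) (f w)).
Proof.
move=> fA y.
pose pull p := p \mPo [tuple lin_mpoly (fun x => coordv (f x) i) | i < dM].
have pullE p x : pevalv (pull p) x = pevalv p (f x).
  rewrite /pevalv comp_mpoly_meval; apply: meval_eq => j; rewrite tnth_mktuple.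
  rewrite -/(pevalv _ _) pevalv_lin_mpoly // => c u v; by rewrite linearP coordv_lin.
have pull_homog d p : p \is d.-homog -> pull p \is d.-homog.
  move=> /dhomogP hp; rewrite /pull comp_mpolyEX; rewrite big_seq.
  apply: rpred_sum => m /hp <-; apply: rpredZ; rewrite comp_mpolyX /= mdegE.
  elim/big_rec2: _ => [|i q e _ IH]; first exact: dhomog1.
  rewrite tnth_mktuple; apply: dhomogM => //; rewrite -[X in X.-homog]mul1n.
  exact/dhomogMn/lin_mpoly_homog.
have pull0 d p : p \is d.-homog -> (forall a, A a -> pevalv p a = 0) ->
    forall a, A a -> pevalv (pull p) a = 0.
  by move=> hp p0 a Aa; rewrite pullE; apply: (fA a Aa d).
split=> [cy d p hp p0|w tw d p hp p0].
  by rewrite -pullE; apply: (cy d); [apply: pull_homog | apply: pull0 hp _].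
have := tw d _ (pull_homog _ _ hp) (pull0 _ _ hp p0).
rewrite -!deriv_line => e; rewrite -[RHS]e; congr (deriv _).[0].
apply/eqP; rewrite -subr_eq0; apply/eqP.
apply: poly_all_roots => s; rewrite hornerD hornerN !horner_line pullE.
by rewrite linearD linearZ subrr.
Qed.

End Cones.

(** * Algebraic dependence by counting monomials *)

Section MPolyDependence.
Variables (K : numClosedFieldType).

Lemma meval_at0 n (F : {mpoly K[n]}) : F.@[fun=> 0] = F@_0%MM.
Proof.
elim/mpoly_ring_ind: F => [c|i|p q IHp IHq|p q IHp IHq].
- by rewrite mevalC mcoeffC eqxx mulr1.
- rewrite mevalXU mcoeffX; case: eqP => // /(congr1 (@mdeg n)).
  by rewrite mdeg1 mdeg0.
- by rewrite mevalD mcoeffD IHp IHq.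
- by rewrite mevalM rmorphM /= IHp IHq.
Qed.

(** The partial derivatives of F vanish at every point too, and in characteristic 0 a coefficient of
    positive degree is, up to a nonzero integer, a coefficient of one of them. *)
Lemma mpoly_all_roots n (F : {mpoly K[n]}) : (forall v, F.@[v] = 0) -> F = 0.
Proof.
move=> F0; apply/mpolyP => m; rewrite mcoeff0.
have [d] := ubnP (mdeg m); elim: d => // d IH in m F F0 *; rewrite ltnS => md.
have [m0|nz] := eqVneq m 0%MM.
  by rewrite m0 -meval_at0.
have [i mi] : exists i, m i != 0%N.
  apply: contrapT => h; case/eqP: nz; apply/mnmP => i; rewrite mnm0E.
  by apply: contrapT => /eqP ne; apply: h; exists i.
have e : (m - U_(i) + U_(i) = m)%MM.
  by apply: submK; rewrite lep1mP.
have Fi0 v : F^`M(i).@[v] = 0.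
  pose r j : {poly K} := (v j)%:P + (j == i)%:R *: 'X.
  have z : mpoly_curve F r = 0.
    by apply: poly_all_roots => s; rewrite horner_mpoly_curve F0.
  have := deriv_mpoly_curve F r; rewrite z derivC => /(congr1 (horner^~ 0)).
  rewrite horner0 horner_sum (bigD1 i) //= big1 ?addr0 => [|j ne].
    rewrite hornerM horner_mpoly_curve derivD derivC derivZ derivX eqxx scale1r add0r.
    rewrite hornerE mulr1 => ->; apply: meval_eq => j.
    by rewrite !hornerE.
  by rewrite derivD derivC derivZ (negPf ne) scale0r addr0 mulr0 horner0.
have := IH (m - U_(i))%MM _ Fi0; rewrite mcoeff_mderiv e => h.
have /eqP : F@_m *+ ((m - U_(i))%MM i).+1 = 0.
  by apply: h; move: md; rewrite -{1}e mdegD mdeg1 addn1.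
by rewrite mulrn_eq0 /= => /eqP.
Qed.

Definition deg_le n (d : nat) (F : {mpoly K[n]}) : Prop :=
  forall m, m \in msupp F -> (mdeg m <= d)%N.

Lemma deg_leM n d e (F G : {mpoly K[n]}) :
  deg_le d F -> deg_le e G -> deg_le (d + e) (F * G).
Proof.
move=> hF hG m /msuppM_le/allpairsP[[m1 m2] [/= /hF h1 /hG h2 ->]].
by rewrite mdegD leq_add.
Qed.

Lemma deg_le1 n : deg_le 0 (1 : {mpoly K[n]}).
Proof. by move=> m; rewrite msupp1 inE => /eqP ->; rewrite mdeg0. Qed.

Lemma deg_leX n d k (F : {mpoly K[n]}) : deg_le d F -> deg_le (d * k) (F ^+ k).
Proof.
move=> hF; elim: k => [|k IH]; first by rewrite expr0 muln0; apply: deg_le1.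
by rewrite exprS mulnS; apply: deg_leM.
Qed.

Lemma deg_le_exists n (F : {mpoly K[n]}) : exists d, deg_le d F.
Proof.
exists (msize F) => m mF; apply: ltnW; exact: msize_mdeg_lt.
Qed.

Lemma deg_le_leq n d d' (F : {mpoly K[n]}) : (d <= d')%N -> deg_le d F -> deg_le d' F.
Proof. by move=> dd h m /h h'; apply: leq_trans h' dd. Qed.

(* More polynomials than variables are algebraically dependent: D^k monomials of
   degree < D in each argument against (k D e + 1)^n coefficients. *)
Lemma mpoly_dependence n k (P : 'I_k -> {mpoly K[n]}) (Q : {mpoly K[n]}) : (n < k)%N ->
  exists (D : nat) (u : {ffun 'I_k -> 'I_D} -> K), (exists b, u b != 0) /\
    \sum_b u b *: (\prod_i P i ^+ b i * Q ^+ (k * D - \sum_i b i)) = 0.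
Proof.
move=> nk.
have [e [eP eQ]] : exists e, (forall i, deg_le e (P i)) /\ deg_le e Q.
  have /choice[dP hP] : forall i, exists d, deg_le d (P i) by move=> i; apply: deg_le_exists.
  have [dQ hQ] := deg_le_exists Q; exists (maxn (\max_i dP i) dQ); split=> [i|].
    by apply: deg_le_leq (hP i); apply: leq_trans (leq_maxl _ _); apply: leq_bigmax.
  by apply: deg_le_leq hQ; apply: leq_maxr.
(* With D - 1 = (ke + 1)^n one gets (kDe + 1)^n <= D^n (ke + 1)^n < D^(n+1) <= D^k. *)
pose D := ((k * e).+1 ^ n).+1; exists D.
pose N := (k * D * e)%N.
pose B : finType := {ffun 'I_k -> 'I_D}; pose C : finType := {ffun 'I_n -> 'I_N.+1}.
(* The power of Q brings every product to kD factors, so that dividing by Q^(kD) gives a relation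
   between the fractions P_i / Q. *)
pose G (b : B) := \prod_i P i ^+ b i * Q ^+ (k * D - \sum_i b i).
have sb (b : B) : (\sum_i b i <= k * D)%N.
  rewrite -[k in (k * D)%N]card_ord -sum_nat_const; apply: leq_sum => i _; exact: ltnW.
have GN b : deg_le N (G b).
  have -> : N = (\sum_i e * b i + e * (k * D - \sum_i b i))%N.
    by rewrite -big_distrr -mulnDr subnKC //= /N mulnC.
  apply: deg_leM; last exact: deg_leX.
  elim/big_rec2: _ => [|i y1 y2 _ IH]; first exact: deg_le1.
  by apply: deg_leM => //; apply: deg_leX.
pose mon (c : C) : 'X_{1..n} := [multinom val (c i) | i < n].
pose A : 'M[K]_(#|B|, #|C|) := \matrix_(i, j) (G (enum_val i))@_(mon (enum_val j)).
have lt : (#|C| < #|B|)%N.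
  rewrite !card_ffun !card_ord.
  have le : (N.+1 <= D * (k * e).+1)%N.
    by rewrite mulnS /N -mulnA [(D * e)%N]mulnC mulnA mulnC -add1n leq_add2r.
  have le_exp j : (N.+1 ^ j <= (D * (k * e).+1) ^ j)%N by case: j => // j; rewrite leq_exp2r.
  apply: leq_ltn_trans (le_exp n) _.
  rewrite expnMn; apply: (@leq_trans (D ^ n * D)).
    by rewrite ltn_pmul2l // expn_gt0.
  by rewrite -expnSr leq_pexp2l.
have : kermx A != 0.
  rewrite kermx_eq0 /row_free neq_ltn; apply/orP; left.
  by apply: leq_ltn_trans lt; apply: rank_leq_col.
case/rowV0Pn => w /sub_kermxP wA w0.
exists (fun b => w 0 (enum_rank b)); split.
  have /rV0Pn[i wi] := w0; exists (enum_val i); by rewrite enum_valK.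
apply/mpolyP => m; rewrite mcoeff0 raddf_sum /=.
have [mN|mN] := leqP (mdeg m) N; last first.
  rewrite big1 // => b _; rewrite mcoeffZ; apply/eqP; rewrite mulf_eq0 mcoeff_eq0.
  by apply/orP; right; apply/negP => /GN; rewrite leqNgt mN.
have mi i : (m i < N.+1)%N.
  by rewrite ltnS; apply: leq_trans mN; rewrite mdegE (bigD1 i) //= leq_addr.
pose c : C := [ffun i => Ordinal (mi i)].
have mc : mon c = m by apply/mnmP => i; rewrite mnmE ffunE.
have := congr1 (fun X : 'rV[K]_#|C| => X 0 (enum_rank c)) wA; rewrite !mxE => e0.
rewrite -[RHS]e0 (reindex_onto enum_rank enum_val) /=; last by move=> i _; rewrite enum_valK.
apply: eq_big => [b|b _]; first by rewrite enum_rankK eqxx.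
by rewrite mcoeffZ mxE !enum_rankK mc.
Qed.

End MPolyDependence.

(** * Projective closures, their tangent spaces, and the bundle O(1) *)

Section ProjectiveTheory.
Context {K : numClosedFieldType} {M : vectType K}.
Local Notation dM := (\dim {: M}).
Implicit Types (L : proj M) (X O : set (proj M)) (p q : {mpoly K[dM]}).

Lemma proj_rep_neq0 L : proj_rep L != 0.
Proof. by rewrite vpick0 -dimv_eq0 (eqP (valP L)). Qed.

Lemma proj_repE L : val L = <[proj_rep L]>%VS.
Proof.
apply/eqP; rewrite eq_sym eqEdim -memvE memv_pick.
by rewrite (eqP (valP L)) dim_vline proj_rep_neq0.
Qed.

Lemma proj_rep_line L y : val L = <[y]>%VS -> y != 0 /\ exists2 c, c != 0 & proj_rep L = c *: y.
Proof.
move=> Ly; have y0 : y != 0.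
  by have := eqP (valP L); rewrite Ly dim_vline; case: (y != 0).
have : proj_rep L \in <[y]>%VS by rewrite -Ly memv_pick.
case/vlineP => c e; split=> //; exists c => //.
by apply: contraNneq (proj_rep_neq0 L); rewrite e => ->; rewrite scale0r.
Qed.

Lemma proj_of y : y != 0 -> exists L : proj M, val L = <[y]>%VS.
Proof.
move=> y0; have dy : \dim <[y]>%VS == 1%N by rewrite dim_vline y0.
by exists (exist (fun L : {vspace M} => \dim L == 1%N) _ dy).
Qed.

Lemma zariski_closureP O L : zariski_closure O L <->
  forall d p, p \is d.-homog -> (forall L', O L' -> pevalp p L' = 0) -> pevalp p L = 0.
Proof.
split=> [h d p hp p0|h Z [[S [hS ->]] OZ] p Sp].
  apply: (h [set L | forall q, [set p] q -> pevalp q L = 0]) => //; split.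
    by exists [set p]; split=> // q ->; exists d.
  by move=> L' OL' q ->; apply: p0.
have [d hp] := hS p Sp; apply: (h d p hp) => L' /OZ; exact.
Qed.

Section ClosureOfCone.
Variables (O : set (proj M)) (A : set M).
Hypothesis OA : forall L, O L -> in_cone A (proj_rep L).
Hypothesis AO : forall a, A a -> exists2 L, O L & val L = <[a]>%VS.

(** The two hypotheses make the forms vanishing on [O] and on [A] the same, so that closure and
    tangent spaces of an orbit can be tested on a much smaller set of vectors. *)
Lemma vanish_cone d p : p \is d.-homog ->
  (forall L, zariski_closure O L -> pevalp p L = 0) <-> (forall a, A a -> pevalv p a = 0).
Proof.
move=> hp; split=> [h a /AO[L OL La]|h L /zariski_closureP/(_ d p hp)]; last first.
  by apply=> L' /OA /(_ d p hp); apply.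
have [_ [c c0 e]] := proj_rep_line La.
have : pevalp p L = 0 by apply: h; apply/zariski_closureP => d' q _; apply.
by rewrite /pevalp e (pevalv_scale _ _ hp) => /eqP;
   rewrite mulf_eq0 expf_eq0 (negPf c0) andbF => /eqP.
Qed.

Lemma zariski_closure_cone L : zariski_closure O L <-> in_cone A (proj_rep L).
Proof.
split=> [OL d p hp p0|h]; first by move/(vanish_cone hp): p0; apply.
apply/zariski_closureP => d p hp p0; apply: (h d p hp); apply/(vanish_cone hp) => L'.
by move/zariski_closureP => h'; apply: (h' d p hp p0).
Qed.

Lemma tangent_vector_cone L w :
  tangent_vector (zariski_closure O) L w <-> cone_tangent A (proj_rep L) w.
Proof. by split=> h d p hp p0; apply: (h d p hp); apply/(vanish_cone hp). Qed.

End ClosureOfCone.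

Lemma zariski_openT : zariski_open (setT : set (proj M)).
Proof.
exists [set 1]; split; first by move=> p ->; exists 0%N; apply: dhomog1.
rewrite setCT; apply/seteqP; split=> // L /(_ 1 erefl) /eqP.
by rewrite /pevalp /pevalv meval1 oner_eq0.
Qed.

Lemma regular_on_ratio (U : set (proj M)) (f : proj M -> K) d p q :
  p \is d.-homog -> q \is d.-homog ->
  (forall L, U L -> pevalp q L != 0 /\ f L = pevalp p L / pevalp q L) -> regular_on U f.
Proof.
move=> hp hq h L UL; exists setT; split=> //; first exact: zariski_openT.
by exists d, p, q; split=> // L' UL' _; apply: h.
Qed.

Section HyperplaneBundle.
Variable X : set (proj M).

Definition coord_form (i : 'I_dM) L : K := coordv (proj_rep L) i.

Lemma pevalpX (i : 'I_dM) L : pevalp 'X_i L = coord_form i L.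
Proof. by rewrite /pevalp /pevalv mevalXU. Qed.

Lemma X_homog (i : 'I_dM) : ('X_i : {mpoly K[dM]}) \is 1.-homog.
Proof. by rewrite dhomogX /= mdeg1. Qed.

Lemma hyperplane_open (i : 'I_dM) : zariski_open [set L | coord_form i L != 0].
Proof.
exists [set 'X_i]; split; first by move=> p ->; exists 1%N; apply: X_homog.
apply/seteqP; split=> L /=.
  by move/negP; rewrite negbK => /eqP h p ->; rewrite pevalpX.
by move/(_ _ erefl); rewrite pevalpX => ->; rewrite eqxx.
Qed.

Lemma hyperplane_cover L : X L -> exists i, coord_form i L != 0.
Proof.
move=> _; apply: contrapT => h; have := proj_rep_neq0 L; rewrite -(vec_of_coordv (proj_rep L)).
rewrite /vec_of big1 ?eqxx // => i _; case: (eqVneq (coordv (proj_rep L) i) 0) => [->|ne].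
  by rewrite scale0r.
by case: h; exists i.
Qed.

(** This is O(1): over the chart c_i != 0 a linear form f is represented by f / c_i. The proof ends
    with [Defined] because [linear_section] computes with these charts. *)
Definition hyperplane_bundle : line_bundle X.
Proof.
refine (@LineBundle K M X dM (fun i => [set L | coord_form i L != 0])
  (fun i j L => coord_form j L / coord_form i L) hyperplane_open hyperplane_cover _ _ _).
- move=> i j; apply: (regular_on_ratio (X_homog j) (X_homog i)) => L [[_ /= i0] _].
  by rewrite !pevalpX.
- by move=> i L _ /= i0; rewrite divff.
- by move=> i j k L _ /= i0 j0 k0; rewrite mulrC mulrA divfK.
Defined.

Lemma linear_section (f : 'Hom(M, K^o)) : exists s : global_section hyperplane_bundle,
  zero_locus s = [set L | X L /\ f (proj_rep L) = 0].
Proof.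
have fE L : pevalp (lin_mpoly f) L = f (proj_rep L).
  by rewrite /pevalp pevalv_lin_mpoly // => c u v; rewrite linearP.
unshelve eexists (@GlobalSection K M X hyperplane_bundle
  (fun i L => f (proj_rep L) / coord_form i L) _ _).
- move=> i; apply: (regular_on_ratio (lin_mpoly_homog f) (X_homog i)) => L [_ /= i0].
  by rewrite fE pevalpX.
- by move=> i j L _ /= i0 j0; rewrite [RHS]mulrC mulrA divfK.
apply/seteqP; split=> L /= [XL h]; split=> //.
  have [i i0] := hyperplane_cover XL; have /eqP := h i i0.
  by rewrite mulf_eq0 invr_eq0 (negPf i0) orbF => /eqP.
move=> i _; apply/eqP; rewrite mulf_eq0; apply/orP; left; apply/eqP; exact: h.
Qed.

End HyperplaneBundle.
End ProjectiveTheory.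

(** * The fusion product inside a tensor power *)

Section AssocGraded.
Context {K : numClosedFieldType} {V : vectType K}.
Variables (F : nat -> set V) (act : 'M[K]_2 -> nat -> V -> V).
Hypothesis F0 : forall m, F m 0.
Hypothesis F_lin : forall m c u v, F m u -> F m v -> F m (c *: u + v).
Hypothesis F_mono : forall m u, F m u -> F m.+1 u.
Variable gr : assoc_graded F act.

Let F_sub m u v : F m u -> F m v -> F m (u - v).
Proof. by move=> Fu Fv; rewrite addrC -scaleN1r; apply: F_lin. Qed.

(** Well-definedness is the point: the difference of two expressions of an element as a sum of
    symbols has all its symbols zero by directness, so its components lie in the previous step of
    the filtration, where [lam] vanishes. *)
Lemma assoc_graded_hom (E : vectType K) (lam : nat -> 'Hom(V, E)) :
  (forall m u, F m u -> filtration_pred F m u -> lam m u = 0) ->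
  exists Psi : 'Hom(gr, E), forall m u, F m u -> Psi (gr_symbol gr m u) = lam m u.
Proof.
move=> lam0.
have widen (X : vectType K) (f : nat -> 'Hom(V, X)) d D (u : nat -> V) : (d <= D)%N ->
    \sum_(m < d) f m (u m) = \sum_(m < D) f m (if (m < d)%N then u m else 0).
  move=> dD; rewrite (big_ord_widen _ (fun m => f m (u m)) dD) big_mkcond.
  by apply: eq_bigr => m _; case: ifP => // _; rewrite linear0.
have key d d' (u u' : nat -> V) : (forall m, F m (u m)) -> (forall m, F m (u' m)) ->
    \sum_(m < d) gr_symbol gr m (u m) = \sum_(m < d') gr_symbol gr m (u' m) ->
    \sum_(m < d) lam m (u m) = \sum_(m < d') lam m (u' m).
  move=> Fu Fu'; have dD := leq_maxl d d'; have d'D := leq_maxr d d'.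
  rewrite !(widen _ _ d _ _ dD) !(widen _ _ d' _ _ d'D) => /eqP.
  rewrite -subr_eq0 -sumrB => /eqP s0; apply/eqP; rewrite -subr_eq0 -sumrB; apply/eqP.
  pose w m := (if (m < d)%N then u m else 0) - (if (m < d')%N then u' m else 0).
  have Fw m : F m (w m) by apply: F_sub; case: ifP.
  rewrite big1 // => m _; rewrite -linearB; apply: (lam0 m (w m)) => //.
  apply/(gr_symbol_ker gr (Fw m)); apply: (gr_symbol_direct Fw _ (ltn_ord m)).
  by rewrite -[RHS]s0; apply: eq_bigr => i _; rewrite linearB.
have /choice[r rP] : forall y : gr, exists du : nat * (nat -> V),
    (forall m, F m (du.2 m)) /\ y = \sum_(m < du.1) gr_symbol gr m (du.2 m).
  by move=> y; have [d [u [Fu yE]]] := gr_symbol_sum y; exists (d, u).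
pose psi (y : gr) : E := \sum_(m < (r y).1) lam m ((r y).2 m).
have psiE d u (y : gr) : (forall m, F m (u m)) -> y = \sum_(m < d) gr_symbol gr m (u m) ->
    psi y = \sum_(m < d) lam m (u m).
  by move=> Fu yE; have [Fr rE] := rP y; apply: key => //; rewrite -yE -rE.
have psi_lin : linear psi.
  move=> c y y'; have [Fu yE] := rP y; have [Fu' y'E] := rP y'.
  set d := (r y).1 in yE *; set u := (r y).2 in Fu yE *.
  set d' := (r y').1 in y'E *; set u' := (r y').2 in Fu' y'E *.
  have dD := leq_maxl d d'; have d'D := leq_maxr d d'; pose D := maxn d d'.
  pose w m := c *: (if (m < d)%N then u m else 0) + (if (m < d')%N then u' m else 0).
  have Fw m : F m (w m) by apply: F_lin; case: ifP.
  rewrite (psiE D w) // ?(psiE d u y) // ?(psiE d' u' y') //.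
    rewrite (widen _ _ d _ _ dD) (widen _ _ d' _ _ d'D) scaler_sumr -big_split.
    by apply: eq_bigr => m _; rewrite linearP.
  rewrite yE y'E (widen _ _ d _ _ dD) (widen _ _ d' _ _ d'D) scaler_sumr -big_split.
  by apply: eq_bigr => m _; rewrite linearP.
pose psiM := GRing.isLinear.Build _ _ _ _ _ psi_lin.
pose psiL : {linear gr -> E} := HB.pack psi psiM.
exists (linfun psiL) => m u Fu; rewrite lfunE /=.
pose w k := if k == m then u else 0.
rewrite (psiE m.+1 w).
- rewrite big_ord_recr /= /w eqxx big1 ?add0r // => i _.
  by rewrite ltn_eqF // linear0.
- by move=> k; rewrite /w; case: eqP => [->|_].
rewrite big_ord_recr /= /w eqxx big1 ?add0r // => i _.
by rewrite ltn_eqF // linear0.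
Qed.

(** By induction the symbols up to degree d span at most dim F_d: the symbol map of degree d + 1
    kills F_d, so it adds at most dim F_(d+1) - dim F_d. *)
Lemma assoc_graded_dim : (\dim {: gr} <= \dim {: V})%N.
Proof.
have /choice[U UP] : forall m, exists U : {vspace V}, forall u, u \in U <-> F m u.
  by move=> m; apply: lin_closed_vspace; [exact: F0 | exact: F_lin].
pose S d := (\sum_(m < d) (gr_symbol gr m @: U m))%VS.
have dimS d : (\dim (S d.+1) <= \dim (U d))%N.
  elim: d => [|d IH].
    by rewrite /S big_ord1 -(limg_ker_dim (gr_symbol gr 0)) leq_addl.
  rewrite /S big_ord_recr /=; apply: leq_trans (dimv_add_leqif _ _) _.
  rewrite -(limg_ker_dim (gr_symbol gr d.+1) (U d.+1)) leq_add2r.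
  apply: leq_trans IH _; apply: dimvS; apply/subvP => u /UP Fu.
  rewrite memv_cap; apply/andP; split; first by apply/UP/F_mono.
  by rewrite memv_ker; apply/eqP; apply/(gr_symbol_ker gr (F_mono Fu)).
have [D SD] : exists D, (fullv <= S D.+1)%VS.
  have /choice[d dP] : forall i : 'I_(\dim {: gr}), exists d, (vbasis {: gr})`_i \in S d.
    move=> i; have [d [u [Fu ->]]] := gr_symbol_sum (vbasis {: gr})`_i; exists d.
    by apply: memv_sumr => m _; apply: memv_img; apply/UP.
  exists (\max_i d i); apply: subv_trans (_ : (<<vbasis {: gr}>> <= _)%VS).
    by rewrite (span_basis (vbasisP {: gr})) subvv.
  apply/span_subvP => y yb; have [i id <-] := elimT (@nthP _ (vbasis {: gr}) y 0) yb.
  rewrite size_tuple in id.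
  have le : (d (Ordinal id) <= (\max_i d i).+1)%N by apply: leqW; apply: leq_bigmax.
  apply: subvP (dP (Ordinal id)).
  apply/subv_sumP => m _.
  exact: (@sumv_sup _ _ _ (widen_ord le m) _ _ (fun m : 'I__ => gr_symbol gr m @: U m)%VS).
by apply: leq_trans (dimvS SD) _; apply: leq_trans (dimS D) _; apply: dimvS; apply: subvf.
Qed.

End AssocGraded.

Definition upd (T : eqType) (U : Type) (f : T -> U) (q : T) (v : U) : T -> U :=
  fun r => if r == q then v else f r.

(** After sorting, the i-th of n distinct naturals is at least i, and equality of the sums forces
    equality throughout. This decides which determinants of powers z_r^(l q) of low degree can be
    nonzero. *)
Lemma sum_inj_leq n (l : 'I_n -> nat) : injective l ->
  (\sum_(q < n) q <= \sum_q l q)%N /\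
  ((\sum_q l q <= \sum_(q < n) q)%N -> forall q, (l q < n)%N).
Proof.
move=> linj; pose s := sort leq [seq l q | q <- enum 'I_n].
have sz : size s = n by rewrite size_sort size_map size_enum_ord.
have us : uniq s by rewrite sort_uniq map_inj_uniq ?enum_uniq.
have ss : sorted ltn s by rewrite ltn_sorted_uniq_leq us sort_sorted //; exact: leq_total.
have ge i : (i < n)%N -> (i <= nth 0%N s i)%N.
  elim: i => // i IH lt; apply: leq_ltn_trans (IH (ltnW lt)) _.
  by apply: (sortedP 0%N ss); rewrite sz.
have sE : (\sum_q l q = \sum_(i < n) nth 0%N s i)%N.
  transitivity (\sum_(x <- s) x)%N.
    rewrite (perm_big [seq l q | q <- enum 'I_n]) /=; last by rewrite perm_sort.
    by rewrite big_map big_enum.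
  by rewrite (big_nth 0%N) sz big_mkord.
have lif := @leqif_sum _ (fun i : 'I_n => true) (fun i => val i == nth 0%N s i)
  (fun i => val i) (fun i => nth 0%N s i) (fun i _ => leqif_eq (ge i (ltn_ord i))).
split; first by rewrite sE lif.
rewrite sE => le q; have : (l q) \in s by rewrite mem_sort map_f // mem_enum.
case/(nthP 0%N) => i; rewrite sz => lt <-.
have /eqP := anti_leq (introT andP (conj (lif : (_ <= _)%N) le)).
rewrite lif => /forall_inP /(_ (Ordinal lt) isT) /= /eqP <-; exact: lt.
Qed.

Lemma irrep2 (K : numClosedFieldType) (x : 'M[K]_2) : \tr x = 0 -> irrep 2 x = x.
Proof.
move=> tx; have ord2 (i : 'I_2) : i = 0 \/ i = 1.
  by case: i => [[|[|]]] // ?; [left | right]; apply: val_inj.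
have x11 : x 1 1 = - x 0 0.
  apply/eqP; rewrite -addr_eq0 addrC -tx /mxtrace !big_ord_recl big_ord0 addr0.
  by apply/eqP; congr (_ + x _ _); apply: val_inj.
apply/matrixP => i j; rewrite mxE.
case: (ord2 i) => ->; case: (ord2 j) => -> /=;
  rewrite ?mulr0n ?mulr1n ?mulr0 ?addr0 ?add0r ?subr0 ?mulr1 //.
by rewrite x11 -[2%:R]/(1 + 1) opprD addrA subrr add0r mulrN1.
Qed.

(** * Alternants of a tensor against powers of the evaluation points *)

Section Alternants.
Context {K : numClosedFieldType} {n : nat}.
Variable z : 'I_n -> K.
Local Notation two := (fun _ : 'I_n => 2%N).
Local Notation V := (@tensor_space K n two).

(* The coordinates of the image of [u] under the embedding of the tensor product
   of the C^2(z_r) into the n-th exterior power of their direct sum, with respect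
   to the family of functionals (d, l) : w_d (x) epsilon_r |-> z_r^l. *)
Definition alternant (u : V) (c : 'I_n -> 'I_2) (l : 'I_n -> nat) : K :=
  \sum_(s : 'S_n) (-1) ^+ s * (\prod_r z r ^+ l (s r)) *
    u (finfun (fun r => c (s r)) : tensor_index two).

Lemma alternant_linear c l k u v :
  alternant (k *: u + v) c l = k * alternant u c l + alternant v c l.
Proof.
rewrite /alternant mulr_sumr -big_split; apply: eq_bigr => s _ /=.
by rewrite !ffunE mulrDr -[k *: _]/(k * _) mulrCA.
Qed.

(** The action of x_k on the factor r carries z_r^k, which turns z_r^l into z_r^(l+k): on
    functionals it raises one exponent by k. *)
Lemma alternant_act x k u c l : \tr x = 0 ->
  alternant (eval_act z x k u) c l =
  \sum_q \sum_(d : 'I_2) x (c q) d * alternant u (upd c q d) (upd l q (l q + k)%N).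
Proof.
move=> tx; rewrite /alternant.
transitivity (\sum_(s : 'S_n) \sum_q \sum_(d : 'I_2) x (c q) d *
   ((-1) ^+ s * (\prod_r z r ^+ (upd l q (l q + k)%N) (s r)) *
    u (finfun (fun r => (upd c q d) (s r)) : tensor_index two))).
  (* For a fixed permutation s the tensor factor i carries the functional of slot s(i), so the sum
     over factors becomes a sum over slots. *)
  apply: eq_bigr => s _; rewrite ffunE mulr_sumr [RHS](reindex_inj (@perm_inj _ s)) /=.
  apply: eq_bigr => i _; rewrite mulrA mulr_sumr; apply: eq_bigr => d _.
  rewrite !ffunE irrep2 // [RHS]mulrCA mulrA [LHS]mulrA; congr (_ * u _); last first.
    apply/ffunP => r; rewrite !ffunE /upd.
    case: (eqVneq r i) => [->|ne]; first by rewrite dfwith_in eqxx.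
    rewrite dfwith_out 1?eq_sym // ffunE; case: eqP => // /perm_inj ri.
    by rewrite ri eqxx in ne.
  rewrite [RHS]mulrC -!mulrA [RHS]mulrCA; congr (_ * _); rewrite mulrA [RHS]mulrC.
  congr (_ * _); rewrite (bigD1 i) // [in RHS](bigD1 i) //= /upd eqxx exprD mulrAC.
  congr (_ * _); apply: eq_bigr => r ne.
  by case: eqP => // /perm_inj ri; rewrite ri eqxx in ne.
rewrite exchange_big; apply: eq_bigr => q _ /=.
by rewrite exchange_big; apply: eq_bigr => d _ /=; rewrite mulr_sumr.
Qed.

End Alternants.

Section CyclicFiltrationTheory.
Context {K : numClosedFieldType} {V : vectType K}.
Variables (act : 'M[K]_2 -> nat -> V -> V) (v : V).
Hypothesis act_linear : forall x k, linear (act x k).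
Local Notation F := (cyclic_filtration act v).

Lemma cyclic_filtration0 m : F m 0.
Proof. by exists [::]; rewrite big_nil. Qed.

Lemma cyclic_filtration_gen : F 0%N v.
Proof.
exists [:: (1, [::])]; rewrite /= /is_sl2_word /= big_nil; split=> //.
by rewrite big_seq1 scale1r.
Qed.

Lemma cyclic_filtration_lin m c u w : F m u -> F m w -> F m (c *: u + w).
Proof.
move=> [s [sw ->]] [t [tw ->]].
exists ([seq (c * y.1, y.2) | y <- s] ++ t); split.
  by rewrite all_cat tw andbT all_map.
rewrite big_cat big_map scaler_sumr; congr (_ + _).
by apply: eq_bigr => y _; rewrite scalerA.
Qed.

Lemma cyclic_filtration_mono m u : F m u -> F m.+1 u.
Proof.
move=> [s [sw ->]]; exists s; split=> //; apply: sub_all sw => y.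
by case/andP=> tr le; rewrite /is_sl2_word tr /= (leq_trans le).
Qed.

Lemma cyclic_filtration_act x k m u : \tr x = 0 -> F m u -> F (m + k)%N (act x k u).
Proof.
move=> tx [s [sw ->]]; exists [seq (y.1, (x, k) :: y.2) | y <- s]; split.
  rewrite all_map; apply: sub_all sw => y /andP[tr le].
  by rewrite /is_sl2_word /= tx eqxx tr /= big_cons addnC leq_add2r.
pose fM := GRing.isLinear.Build _ _ _ _ _ (act_linear x k).
pose fL : {linear V -> V} := HB.pack (act x k) fM.
rewrite -[LHS]/(fL _) linear_sum big_map; apply: eq_bigr => y _.
by rewrite linearZ.
Qed.

Lemma cyclic_filtration_ind (P : nat -> V -> Prop) :
  (forall m, P m 0) -> P 0%N v ->
  (forall m c u w, P m u -> P m w -> P m (c *: u + w)) ->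
  (forall m m' u, (m <= m')%N -> P m u -> P m' u) ->
  (forall x k m u, \tr x = 0 -> P m u -> P (m + k)%N (act x k u)) ->
  forall m u, F m u -> P m u.
Proof.
move=> P0 Pv Plin Pmono Pact m _ [s [sw ->]].
elim: s sw => [|[c w] s IH] /=; first by rewrite big_nil.
case/andP => /andP[/= tw le] /IH Ps; rewrite big_cons /=; apply: Plin => //.
apply: Pmono le _; elim: w tw => [|[x k] w IHw] /=; first by rewrite big_nil.
by case/andP => /eqP tx /IHw Pw; rewrite big_cons addnC; apply: Pact.
Qed.

End CyclicFiltrationTheory.

Section AlternantFiltration.
Context {K : numClosedFieldType} {n : nat}.
Variable z : 'I_n -> K.
Local Notation two := (fun _ : 'I_n => 2%N).
Local Notation V := (@tensor_space K n two).
Local Notation d0 := (\sum_(q < n) q)%N.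

Lemma alternant_ext (u : V) c c' l l' : c =1 c' -> l =1 l' ->
  alternant z u c l = alternant z u c' l'.
Proof.
move=> cc ll; apply: eq_bigr => s _; congr (_ * _ * u _).
  by apply: eq_bigr => r _; rewrite ll.
by apply/ffunP => r; rewrite !ffunE cc.
Qed.

Lemma alternant_lowest (c : 'I_n -> 'I_2) l :
  alternant z (@lowest_vector K n two) c l =
  if [forall q, c q == 1] then \det (\matrix_(r, q) z r ^+ l q) else 0.
Proof.
have lowE (s : 'S_n) : @lowest_vector K n two (finfun (fun r => c (s r))) =
    [forall q, c q == 1]%:R.
  rewrite ffunE; congr (_%:R); congr nat_of_bool; apply/forallP/forallP => h q.
    have := h (s^-1%g q); rewrite ffunE permKV => /eqP [e]; apply/eqP/val_inj; exact: e.
  by rewrite ffunE (eqP (h (s q))).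
rewrite /alternant; case: ifP => ca.
  apply: eq_bigr => s _; rewrite lowE ca mulr1; congr (_ * _).
  by apply: eq_bigr => r _; rewrite mxE.
by rewrite big1 // => s _; rewrite lowE ca mulr0.
Qed.

Lemma det_col_eq (R : comPzRingType) (A : 'M[R]_n) q1 q2 : q1 != q2 ->
  (forall r, A r q1 = A r q2) -> \det A = 0.
Proof.
by move=> ne h; rewrite -det_tr (determinant_alternate ne) // => r; rewrite !mxE.
Qed.

(** Here d0 is the degree of the Vandermonde determinant. The first alternative makes leading terms
    well defined; the second makes t^n act as 0 on them. *)
Definition alternant_low (m : nat) (u : V) : Prop := forall c l,
  (\sum_q l q + m <= d0)%N -> (\sum_q l q + m < d0)%N \/ (exists q, (n <= l q)%N) ->
  alternant z u c l = 0.

(** On v an alternant is a determinant of powers of the z_r, and in this range either two exponents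
    agree or [sum_inj_leq] is contradicted. Each x_k raises the total exponent by as much as it
    raises the filtration degree. *)
Lemma cyclic_alternant_low m u :
  cyclic_filtration (eval_act z) (@lowest_vector K n two) m u -> alternant_low m u.
Proof.
apply: cyclic_filtration_ind m u.
- move=> m c l _ _; apply: big1 => s _; by rewrite ffunE mulr0.
- move=> c l; rewrite !addn0 => le lo; rewrite alternant_lowest; case: ifP => // _.
  have [linj|] := pselect (injective l).
    have [ge lt] := sum_inj_leq linj.
    case: lo => [|[q]]; first by rewrite ltnNge ge.
    by rewrite leqNgt (lt le).
  move/existsNP => [q1 /existsNP[q2 /not_implyP[e /eqP ne]]].
  by apply: (det_col_eq ne) => r; rewrite !mxE e.
- by move=> m k u w lu lw c l le lo; rewrite alternant_linear lu // lw // mulr0 addr0.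
- move=> m m' u mm' lu c l le lo; apply: lu.
    by apply: leq_trans le; rewrite leq_add2l.
  case: lo => [lt|]; [left | by right].
  by apply: leq_ltn_trans lt; rewrite leq_add2l.
- move=> x k m u tx lu c l le lo; rewrite alternant_act // big1 // => q _.
  rewrite big1 // => d _.
  have sE : (\sum_r upd l q (l q + k) r = \sum_r l r + k)%N.
    rewrite (bigD1 q) //= /upd eqxx [in RHS](bigD1 q) //= addnAC; congr (_ + _ + _)%N.
    by apply: eq_bigr => r /negPf ->.
  rewrite lu ?mulr0 // sE -addnA [(k + m)%N]addnC //.
  case: lo => [|[r nr]]; [by left | right; exists r].
  by rewrite /upd; case: eqP => [<-|//]; apply: leq_trans (leq_addr _ _).
Qed.

End AlternantFiltration.

Section FusionTensors.
Context {K : numClosedFieldType} {n : nat}.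
Variable z : 'I_n -> K.
Hypothesis z_inj : injective z.
Local Notation two := (fun _ : 'I_n => 2%N).
Local Notation V := (@tensor_space K n two).
Local Notation d0 := (\sum_(q < n) q)%N.
Variable M : fusion_product two z.
Local Notation F := (cyclic_filtration (eval_act z) (@lowest_vector K n two)).

(* A column j of an n x 2n matrix is a pair of a letter (x is the lowest weight
   vector w_1, y is w_0) and a power of t; [colev] reverses the powers since
   [alternant] is expressed in a dual basis. *)
Definition colty (j : 'I_(n + n)) : 'I_2 := if split j is inl _ then 1 else 0.
Definition colev (j : 'I_(n + n)) : 'I_n :=
  match split j with inl o => rev_ord o | inr o => rev_ord o end.

(** The matrix of x tensor t^k on row vectors. Since [colev] reverses the powers, multiplication by
    t^k lowers [colev] by k. *)
Definition current_mx (x : 'M[K]_2) (k : nat) : 'M[K]_(n + n) :=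
  \matrix_(j, j') (x (colty j') (colty j) *+ (colev j == colev j' + k :> nat)%N).

Lemma colty_l o : colty (lshift n o) = 1.
Proof. by rewrite /colty (unsplitK (inl o)). Qed.
Lemma colty_r o : colty (rshift n o) = 0.
Proof. by rewrite /colty (unsplitK (inr o)). Qed.
Lemma colev_l o : colev (lshift n o) = rev_ord o.
Proof. by rewrite /colev (unsplitK (inl o)). Qed.
Lemma colev_r o : colev (rshift n o) = rev_ord o.
Proof. by rewrite /colev (unsplitK (inr o)). Qed.

(** Its determinant is the alternant of v at [all_x]; dividing by it normalizes that coordinate of
    the image of v to 1. *)
Definition rev_vdm : 'M[K]_n := \matrix_(r, q) z r ^+ rev_ord q.

Lemma rev_vdm_neq0 : \det rev_vdm != 0.
Proof.
have -> : rev_vdm = (row_perm (perm rev_ord_inj) (Vandermonde n (\row_r z r)))^T.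
  by apply/matrixP => r q; rewrite !mxE permE.
rewrite det_tr row_permE det_mulmx det_perm mulf_neq0 ?signr_eq0 //.
rewrite det_Vandermonde; apply/prodf_neq0 => i _; apply/prodf_neq0 => j ij.
by rewrite !mxE subr_eq0 (inj_eq z_inj); apply: contraTneq ij => ->; rewrite ltnn.
Qed.

Let alt (u : V) (i : tensor_idx n) : K :=
  alternant z u (fun q => colty (i q)) (fun q => val (colev (i q))).

(** The leading term on F_m: only the alternants of total exponent d0 - m are kept, and these vanish
    on F_(m-1) by [cyclic_alternant_low]. *)
Let lam0 (m : nat) (u : V) : tensors K n :=
  [ffun i : tensor_idx n => if (\sum_q colev (i q) + m == d0)%N
     then (\det rev_vdm)^-1 * alt u i else 0].

Let lam0_linear m : linear (lam0 m).
Proof.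
move=> c u v; apply/ffunP => i; have sE (y : K^o) : c *: y = c * y by [].
rewrite !ffunE sE; case: ifP => _; last by rewrite mulr0 addr0.
by rewrite /alt alternant_linear mulrDr mulrCA.
Qed.

Lemma sum_colev_idx_set (i : tensor_idx n) q j k : colev j = (colev (i q) + k)%N :> nat ->
  (\sum_r colev (idx_set i q j r) = \sum_r colev (i r) + k)%N.
Proof.
move=> e; rewrite (bigD1 q) //= ffunE eqxx e [in RHS](bigD1 q) //= addnAC.
by congr (_ + _ + _)%N; apply: eq_bigr => r /negPf ne; rewrite ffunE ne.
Qed.

Lemma sum_colev (R : nmodType) (G : 'I_(n + n) -> R) (l : nat) (ln : (l < n)%N) :
  \sum_j G j *+ (colev j == l :> nat) =
  G (lshift n (rev_ord (Ordinal ln))) + G (rshift n (rev_ord (Ordinal ln))).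
Proof.
rewrite big_split_ord /=; congr (_ + _); rewrite (bigD1 (rev_ord (Ordinal ln))) //=.
  rewrite colev_l rev_ordK eqxx mulr1n big1 ?addr0 // => o ne.
  rewrite colev_l -[l]/(val (Ordinal ln)) val_eqE -(inj_eq rev_ord_inj) rev_ordK.
  by rewrite (negPf ne) mulr0n.
rewrite colev_r rev_ordK eqxx mulr1n big1 ?addr0 // => o ne.
rewrite colev_r -[l]/(val (Ordinal ln)) val_eqE -(inj_eq rev_ord_inj) rev_ordK.
by rewrite (negPf ne) mulr0n.
Qed.

Let lam_act x k m u : \tr x = 0 -> F m u ->
  lam0 (m + k) (eval_act z x k u) = tensor_act (current_mx x k) (lam0 m u).
Proof.
move=> tx Fu; apply/ffunP => i; rewrite !ffunE.
have low := cyclic_alternant_low Fu.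
case: eqP => [e|ne]; last first.
  rewrite big1 // => q _; rewrite big1 // => j _; rewrite mxE ffunE.
  case: eqP => [/sum_colev_idx_set ->|_]; last by rewrite mul0r.
  by rewrite -addnA [(k + m)%N]addnC; case: eqP => [/ne //|_]; rewrite mulr0.
rewrite /alt alternant_act // mulr_sumr; apply: eq_bigr => q _.
rewrite big_ord_recl big_ord1; set L := (colev (i q) + k)%N.
have key j : colev j = L :> nat ->
    alt u (idx_set i q j : tensor_idx n) = alternant z u (upd (fun q => colty (i q)) q (colty j))
                              (upd (fun q => val (colev (i q))) q L).
  by move=> jL; apply: alternant_ext => r; rewrite ffunE /upd; case: eqP.
pose G j := x (colty (i q)) (colty j) *
  ((\det rev_vdm)^-1 * alternant z u (upd (fun q => colty (i q)) q (colty j))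
                              (upd (fun q => val (colev (i q))) q L)).
transitivity (\sum_j G j *+ (colev j == L :> nat)); last first.
  apply: eq_bigr => j _; rewrite !mxE ffunE; case: eqP => [jL|_]; last by rewrite mul0r.
  by rewrite (sum_colev_idx_set jL) -addnA [(k + m)%N]addnC e eqxx key.
have o1 : lift ord0 ord0 = 1 :> 'I_2 by apply: val_inj.
case: (ltnP L n) => Ln.
  rewrite sum_colev /G !colty_l !colty_r o1 addrC mulrDr.
  by congr (_ + _); rewrite mulrCA.
rewrite [RHS]big1 => [|j _]; last first.
  by case: eqP => // jL; move: (ltn_ord (colev j)); rewrite jL ltnNge Ln.
(* For L >= n the right-hand side has no column of exponent L; the alternants on the left vanish by
   the second alternative of [alternant_low]. *)
have sE d : alternant z u (upd (fun q => colty (i q)) q d)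
                    (upd (fun q => val (colev (i q))) q L) = 0.
  apply: low; last by right; exists q; rewrite /upd eqxx.
  have -> : (\sum_r upd (fun q => val (colev (i q))) q L r = \sum_r colev (i r) + k)%N.
    rewrite (bigD1 q) //= /upd eqxx [in RHS](bigD1 q) //= addnAC; congr (_ + _ + _)%N.
    by apply: eq_bigr => r /negPf ->.
  by rewrite -addnA [(k + m)%N]addnC e.
by rewrite !sE !mulr0 addr0 mulr0.
Qed.

(** When all columns are of type x, the alternant of v is the Vandermonde determinant times that of
    the 0-1 matrix choosing the columns; if the choice is a permutation, the degree condition holds
    automatically. *)
Let lam0_lowest : lam0 0 (@lowest_vector K n two) = minors (cell_frame n 0).
Proof.
apply/ffunP => i; rewrite !ffunE /alt alternant_lowest addn0 /cell_frame toep0.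
have [all1|/forallPn [q nq]] := boolP [forall q, colty (i q) == 1]; last first.
  rewrite mulr0 if_same; apply/esym; rewrite (expand_det_col _ q) big1 // => r _.
  rewrite mxE [row_mx _ _ _ _]mxE; move: nq; rewrite /colty; case: split => o.
    by rewrite eqxx.
  by rewrite mxE mul0r.
have /choice[o oE] : forall q, exists o : 'I_n, i q = lshift n o.
  move=> q; have /forallP/(_ q) := all1; rewrite /colty; case: (splitP (i q)) => // o e _.
  by exists o; apply: val_inj.
have -> : colsub i (row_mx 1%:M 0) = \matrix_(r, q) (r == o q)%:R :> 'M[K]_n.
  by apply/matrixP => r q; rewrite !mxE oE (unsplitK (inl _)) mxE.
have dE : \det (\matrix_(r, q) z r ^+ colev (i q)) =
    \det rev_vdm * \det (\matrix_(r, q) (r == o q)%:R : 'M[K]_n).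
  rewrite -det_mulmx; congr (\det _); apply/matrixP => r q; rewrite !mxE.
  rewrite (bigD1 (o q)) //= big1 ?addr0 => [|j /negPf ne].
    by rewrite !mxE eqxx mulr1 oE colev_l.
  by rewrite !mxE ne mulr0.
rewrite dE mulrA mulVf ?rev_vdm_neq0 // mul1r; case: eqP => // ne.
have [oinj|] := pselect (injective o); last first.
  move/existsNP => [q1 /existsNP[q2 /not_implyP[e /eqP neq]]].
  by rewrite (det_col_eq neq) // => r; rewrite !mxE e.
case: ne; rewrite (eq_bigr (fun q => val (rev_ord (o q)))) => [|q _]; last first.
  by rewrite oE colev_l.
rewrite [RHS](reindex_inj rev_ord_inj) [RHS](reindex_inj oinj) //=.
Qed.

Lemma fusion_tensors : exists Psi : 'Hom(M, tensors K n),
  Psi (fusion_vector M) = minors (cell_frame n 0) /\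
  forall x k y, \tr x = 0 -> Psi (gr_act M x k y) = tensor_act (current_mx x k) (Psi y).
Proof.
have al := @eval_act_linear K n two z.
have Fact := @cyclic_filtration_act _ _ _ (@lowest_vector K n two) al.
have /choice[lam lamE] : forall m, exists f : 'Hom(V, tensors K n), forall u, f u = lam0 m u.
  move=> m; pose fM := GRing.isLinear.Build _ _ _ _ _ (lam0_linear m).
  pose fL : {linear V -> tensors K n} := HB.pack (lam0 m) fM.
  by exists (linfun fL) => u; rewrite lfunE.
have [] := @assoc_graded_hom _ _ _ _ (@cyclic_filtration0 _ _ _ _)
  (@cyclic_filtration_lin _ _ _ _) M (tensors K n) lam.
  move=> m u _ Pu; rewrite lamE; apply/ffunP => i; rewrite !ffunE; case: eqP => // e.
  case: m Pu e => [->|m /cyclic_alternant_low low] e.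
    by rewrite /alt /alternant big1 ?mulr0 // => s _; rewrite ffunE mulr0.
  have lt : (\sum_q colev (i q) + m < \sum_(q < n) q)%N by rewrite -e addnS.
  by rewrite /alt low ?mulr0 //; [exact: ltnW | left].
move=> Psi PsiE; exists Psi; split.
  by rewrite /fusion_vector PsiE; [rewrite lamE lam0_lowest | exact: cyclic_filtration_gen].
move=> x k y tx; have [d [u [Fu ->]]] := gr_symbol_sum y.
pose tM := GRing.isLinear.Build _ _ _ _ _ (tensor_act_is_linear (current_mx x k)).
pose tL : {linear tensors K n -> tensors K n} := HB.pack (tensor_act (current_mx x k)) tM.
rewrite -[RHS]/(tL _) !linear_sum; apply: eq_bigr => m _ /=.
rewrite gr_act_symbol // !PsiE //; last exact: Fact.
by rewrite !lamE lam_act.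
Qed.

Lemma fusion_dim : (\dim {: M} <= 2 ^ n)%N.
Proof.
have := @assoc_graded_dim _ _ _ _ (@cyclic_filtration0 _ _ _ _)
  (@cyclic_filtration_lin _ _ _ _) (@cyclic_filtration_mono _ _ _ _) M.
move=> le; apply: leq_trans le _.
by rewrite dim_ffun_regular card_dep_ffun foldrE big_map big_enum /= prod_nat_const !card_ord.
Qed.

End FusionTensors.

(** * Subspaces stable under t *)

Lemma tr_delta (K : fieldType) (i j : 'I_2) : i != j -> \tr (delta_mx i j : 'M[K]_2) = 0.
Proof.
move=> ij; rewrite /mxtrace big1 // => k _; rewrite mxE.
by case: (k =P i) => //= ->; rewrite (negPf ij).
Qed.

Lemma det_elem (i j : 'I_2) (A : comNzRingType) (p : A) : i != j ->
  \det (1%:M + p *: delta_mx i j) = 1.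
Proof.
move=> ij; have ord2 (k : 'I_2) : k = 0 \/ k = 1.
  by case: k => [[|[|]]] // ?; [left | right]; apply: val_inj.
rewrite (expand_det_row _ 0) !big_ord_recl big_ord0 addr0 /cofactor.
rewrite !det_mx11 !mxE /= expr0 expr1 mul1r mulN1r.
by case: (ord2 i) ij => ->; case: (ord2 j) => -> //= _;
   rewrite ?mulr0n ?mulr1n !(mulr0, mul0r, mulr1, addr0, add0r, oppr0, mul1r).
Qed.

Section Unipotents.
Context {K : numClosedFieldType} {n : nat}.

(** These are e tensor p and f tensor p in block form: [raise_mx] sends a row (A, B) to (0, A p),
    and [lower_mx] sends it to (B p, 0). *)
Definition raise_mx (p : {poly K}) : 'M[K]_(n + n) := block_mx 0 (toep n p) 0 0.
Definition lower_mx (p : {poly K}) : 'M[K]_(n + n) := block_mx 0 0 (toep n p) 0.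

Lemma raise_mx_sq p q : raise_mx p *m raise_mx q = 0.
Proof. by rewrite mulmx_block !(mulmx0, mul0mx) !addr0 block_mx_const. Qed.

Lemma lower_mx_sq p q : lower_mx p *m lower_mx q = 0.
Proof. by rewrite mulmx_block !(mulmx0, mul0mx) !addr0 block_mx_const. Qed.

Lemma row_mx_raise (m : nat) (A B : 'M[K]_(m, n)) p :
  row_mx A B *m (1%:M + raise_mx p) = row_mx A (B + A *m toep n p).
Proof.
by rewrite mulmxDr mulmx1 mul_row_block !mulmx0 !(addr0, add0r) add_row_mx addr0.
Qed.

Lemma row_mx_lower (m : nat) (A B : 'M[K]_(m, n)) p :
  row_mx A B *m (1%:M + lower_mx p) = row_mx (A + B *m toep n p) B.
Proof. by rewrite mulmxDr mulmx1 mul_row_block !mulmx0 !(addr0, add0r) add_row_mx addr0. Qed.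

Lemma current_mx_delta k :
  current_mx (delta_mx 0 1) k = raise_mx 'X^k /\
  current_mx (delta_mx 1 0) k = lower_mx 'X^k.
Proof.
have rv (a b : 'I_n) : (rev_ord a == rev_ord b + k :> nat)%N = (b == k + a :> nat)%N.
  by have := ltn_ord a; have := ltn_ord b => /= bn an; apply/eqP/eqP; lia.
split; apply/matrixP => j j'; rewrite mxE -(splitK j) -(splitK j').
- case: (split j) => a; case: (split j') => b /=;
    rewrite ?(block_mxEul, block_mxEur, block_mxEdl, block_mxEdr);
    rewrite ?colty_l ?colty_r ?colev_l ?colev_r !mxE /= ?mul0rn //.
  by rewrite -exprD coefXn rv addnC.
- case: (split j) => a; case: (split j') => b /=;
    rewrite ?(block_mxEul, block_mxEur, block_mxEdl, block_mxEdr);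
    rewrite ?colty_l ?colty_r ?colev_l ?colev_r !mxE /= ?mul0rn //.
  by rewrite -exprD coefXn rv addnC.
Qed.

Lemma sum_toep (p : {poly K}) : toep n p = \sum_(k < n) p`_k *: toep n 'X^k.
Proof.
have -> : \sum_(k < n) p`_k *: toep n 'X^k = toep n (\poly_(k < n) p`_k).
  rewrite poly_def; elim/big_rec2: _ => [|k x y _ ->]; first by rewrite toep0.
  by rewrite toepD toepZ.
by apply: toep_coef => k kn; rewrite coef_poly kn.
Qed.

Lemma sum_raise_mx p : raise_mx p = \sum_(k < n) p`_k *: raise_mx 'X^k.
Proof.
rewrite /raise_mx sum_toep; elim/big_rec2: _ => [|k x y _ <-]; first exact: block_mx_const.
by rewrite scale_block_mx add_block_mx !scaler0 !addr0.
Qed.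

Lemma sum_lower_mx p : lower_mx p = \sum_(k < n) p`_k *: lower_mx 'X^k.
Proof.
rewrite /lower_mx sum_toep; elim/big_rec2: _ => [|k x y _ <-]; first exact: block_mx_const.
by rewrite scale_block_mx add_block_mx !scaler0 !addr0.
Qed.

Lemma tensor_act_sum (c : 'I_n -> K) (A : 'I_n -> 'M[K]_(n + n)) (f : tensors K n) :
  tensor_act (\sum_k c k *: A k) f = \sum_k c k *: tensor_act (A k) f.
Proof.
apply/ffunP => i; rewrite sum_ffunE ffunE.
have sE (a : K) (y : K^o) : a *: y = a * y by [].
transitivity (\sum_k \sum_q \sum_j c k * (A k j (i q) * f (idx_set i q j))); last first.
  apply: eq_bigr => k _; rewrite ffunE sE ffunE mulr_sumr; apply: eq_bigr => q _.
  by rewrite mulr_sumr.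
rewrite [RHS]exchange_big; apply: eq_bigr => q _ /=.
rewrite [RHS]exchange_big; apply: eq_bigr => j _ /=.
rewrite summxE mulr_suml; apply: eq_bigr => k _.
by rewrite mxE mulrA.
Qed.

Lemma coef_in_qpoly (p : {poly K}) k : (k < n)%N ->
  (in_qpoly 'X^n p : {poly K})`_k = p`_k.
Proof.
move=> kn; have n0 : (0 < n)%N by apply: leq_trans kn.
have mX : mk_monic ('X^n : {poly K}) = 'X^n by rewrite mk_monic_Xn prednK.
rewrite /= mX {2}(Pdiv.RingMonic.rdivp_eq (monicXn K n) p).
by rewrite coefD coefMXn kn add0r.
Qed.

Lemma cell_frame_raise p q : cell_frame n p *m (1%:M + raise_mx q) = cell_frame n (p + q).
Proof. by rewrite /cell_frame row_mx_raise mul1mx toepD. Qed.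

Lemma unipotentK (N N' : 'M[K]_(n + n)) : N' = - N -> N *m N = 0 ->
  (1%:M + N) *m (1%:M + N') = 1%:M.
Proof.
by move=> -> NN; rewrite mulmxDl mul1mx mulmxDr mulmx1 mulmxN NN oppr0 addr0 addrNK.
Qed.

Lemma lower_mxN p : lower_mx (- p) = - lower_mx p :> 'M[K]_(n + n).
Proof. by rewrite /lower_mx opp_block_mx toepN !oppr0. Qed.

Lemma raise_mxN p : raise_mx (- p) = - raise_mx p :> 'M[K]_(n + n).
Proof. by rewrite /raise_mx opp_block_mx toepN !oppr0. Qed.

End Unipotents.

Section StableFrames.
Context {K : numClosedFieldType} {n : nat}.
Implicit Types (p q r : {poly K}) (B : 'M[K]_(n, n + n)).

Definition diag_toep r : 'M[K]_(n + n) := block_mx (toep n r) 0 0 (toep n r).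
Definition row_pair p q : 'rV[K]_(n + n) := row_mx (poly_rV p) (poly_rV q).

(* A full-rank [B] stands for an n-dimensional subspace U of (K[t]/t^n)^2, spanned
   by its rows: the left half holds the coordinate along x, the right half along y. *)
Definition stable B : Prop := (B *m diag_toep 'X <= B)%MS.

Lemma row_pair_toep p q r : row_pair p q *m diag_toep r = row_pair (p * r) (q * r).
Proof.
by rewrite /row_pair mul_row_block !mulmx0 addr0 add0r !poly_rV_toep.
Qed.

Lemma poly_rV_low p q : (forall j, (j < n)%N -> p`_j = q`_j) -> poly_rV p = poly_rV q :> 'rV[K]_n.
Proof. by move=> pq; apply/rowP => j; rewrite !mxE pq. Qed.

Lemma diag_toepM p q : diag_toep (p * q) = diag_toep p *m diag_toep q.
Proof. by rewrite mulmx_block !(mulmx0, mul0mx) !addr0 !add0r -!toepM. Qed.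

Lemma diag_toepD p q : diag_toep (p + q) = diag_toep p + diag_toep q.
Proof. by rewrite add_block_mx !addr0 -!toepD. Qed.

Lemma diag_toep_const c : diag_toep c%:P = c%:M.
Proof.
have e : toep n c%:P = c%:M.
  by apply/matrixP => i j; rewrite !mxE coefMC coefXn eq_sym mulr_natl.
by rewrite /diag_toep e -scalar_mx_block.
Qed.

Lemma stable_poly B r : stable B -> (B *m diag_toep r <= B)%MS.
Proof.
move=> sB; elim/poly_ind: r => [|r c IH].
  by rewrite -polyC0 diag_toep_const mul_mx_scalar scale0r sub0mx.
rewrite diag_toepD mulmxDr addmx_sub //.
  by rewrite diag_toepM mulmxA; apply: submx_trans sB; apply: submxMr.
by rewrite diag_toep_const mul_mx_scalar scalemx_sub.
Qed.

Lemma stable_row B p q r : stable B -> (row_pair p q <= B)%MS ->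
  (row_pair (p * r) (q * r) <= B)%MS.
Proof.
move=> sB pB; rewrite -row_pair_toep; apply: submx_trans (stable_poly r sB).
exact: submxMr.
Qed.

Lemma diag_toep_comm_raise p r :
  (1%:M + raise_mx p) *m diag_toep r = diag_toep r *m (1%:M + raise_mx p).
Proof.
rewrite mulmxDl mulmxDr mul1mx mulmx1 !mulmx_block !(mulmx0, mul0mx) !(addr0, add0r).
by rewrite toepC.
Qed.

Lemma diag_toep_comm_lower p r :
  (1%:M + lower_mx p) *m diag_toep r = diag_toep r *m (1%:M + lower_mx p).
Proof.
rewrite mulmxDl mulmxDr mul1mx mulmx1 !mulmx_block !(mulmx0, mul0mx) !(addr0, add0r).
by rewrite toepC.
Qed.

Lemma stable_raise B p : stable B -> stable (B *m (1%:M + raise_mx p)).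
Proof. by move=> sB; rewrite /stable -mulmxA diag_toep_comm_raise mulmxA submxMr. Qed.

Lemma stable_lower B p : stable B -> stable (B *m (1%:M + lower_mx p)).
Proof. by move=> sB; rewrite /stable -mulmxA diag_toep_comm_lower mulmxA submxMr. Qed.

(* The rows of [std_frame k] are t^(k+i) x for i < n - k, and t^i y for i >= n - k. *)
Definition std_idx (k : nat) : tensor_idx n :=
  [ffun i : 'I_n => if insub (k + i)%N is Some o then lshift n o else rshift n i].
Definition std_frame (k : nat) : 'M[K]_(n, n + n) :=
  \matrix_(i, c) (c == std_idx k i)%:R.

Lemma std_idx_inj k : injective (std_idx k).
Proof.
move=> i j; rewrite !ffunE; case: insubP => [o _ oi|_]; case: insubP => [o' _ oj|_] //.
- by move/lshift_inj => oo; apply/val_inj/(@addnI k); rewrite -oi -oj oo.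
- by move/eqP; rewrite eq_lrshift.
- by move/eqP; rewrite eq_rlshift.
- by move/rshift_inj.
Qed.

Lemma std_idx_l k (i o : 'I_n) : (k + i = o)%N -> std_idx k i = lshift n o.
Proof.
move=> e; rewrite ffunE insubT; first by rewrite e.
by move=> lt; congr lshift; apply: val_inj.
Qed.

Lemma std_idx_r k (i : 'I_n) : (n - k <= i)%N -> std_idx k i = rshift n i.
Proof. by move=> e; rewrite ffunE insubF // ltnNge -leq_subLR e. Qed.

Lemma minors_std k : minors (std_frame k) (std_idx k) = 1.
Proof.
rewrite ffunE -[RHS](det1 _ n); congr (\det _); apply/matrixP => i j.
by rewrite !mxE (inj_eq (@std_idx_inj k)) eq_sym.
Qed.

Lemma std_test_minor k (q : 'I_n) l : (forall r : 'I_n, std_idx k r != l) ->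
  minors (std_frame k) (idx_set (std_idx k) q l) = 0 :> K.
Proof.
move=> nl; rewrite ffunE (expand_det_col _ q) big1 // => r _.
by rewrite !mxE ffunE eqxx eq_sym (negPf (nl r)) mul0r.
Qed.

(** At most n - 1 columns of B are nonzero, so B factors through [C], whose row [i0] is zero. *)
Lemma minors_missing_col B (S : 'I_n -> 'I_(n + n)) i0 : injective S ->
  (forall a c, B a c != 0 -> exists2 i, i != i0 & c = S i) -> minors B = 0.
Proof.
move=> Sinj h.
pose C : 'M[K]_(n, n + n) := \matrix_(i, c) ((i != i0) && (c == S i))%:R.
have -> : B = colsub S B *m C.
  apply/matrixP => r c; rewrite mxE; case: (eqVneq (B r c) 0) => [Bz|/[dup] nz /h[i ii cS]].
    rewrite Bz big1 // => i _; rewrite !mxE; case: andP => [[_ /eqP e]|_]; last by rewrite mulr0.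
    by rewrite -e Bz mul0r.
  rewrite (bigD1 i) //= !mxE ii cS eqxx mulr1 big1 ?addr0 // => j ji.
  by rewrite !mxE (inj_eq Sinj) [i == j]eq_sym (negPf ji) andbF mulr0.
rewrite minors_mul; suff -> : minors C = 0 by rewrite scaler0.
apply/ffunP => i; rewrite [RHS]ffunE ffunE (expand_det_row _ i0) big1 // => j _.
by rewrite !mxE eqxx mul0r.
Qed.

Lemma minors_neq0 B : (minors B != 0) = row_free B.
Proof.
apply/idP/idP => [m0|fB].
  have [i di] : exists i, minors B i != 0.
    apply: contrapT => h; case/eqP: m0; apply/ffunP => i; rewrite [RHS]ffunE.
    by apply: contrapT => /eqP nz; apply: h; exists i.
  move: di; rewrite ffunE -unitfE -unitmxE -row_free_unit -[B]mulmx1 colsub_mul /row_free.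
  move=> /eqP e; rewrite eqn_leq rank_leq_row -{1}e mulmx1; exact: mxrankM_maxl.
have fT : row_full B^T by rewrite /row_full mxrank_tr.
have := fullrowsub_full fT; rewrite row_full_unit unitmxE unitfE -det_tr => d0.
apply: contraNneq d0 => m0.
have := congr1 (fun F : tensors K n => F (fullrankfun fT)) m0; rewrite !ffunE => <-.
by apply/eqP; congr (\det _); apply/matrixP => i j; rewrite !mxE.
Qed.

Lemma drop_polyE (p : {poly K}) k : (forall j, (j < k)%N -> p`_j = 0) ->
  p = 'X^k * drop_poly k p.
Proof.
move=> p0; rewrite -{1}(poly_take_drop k p) mulrC; suff -> : take_poly k p = 0 by rewrite add0r.
by apply/polyP => j; rewrite coef_take_poly coef0; case: ltnP => // /p0.
Qed.

(** Modulo t^n, [q] is t^j times a unit, and U is closed under multiplication by the inverse of that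
    unit. *)
Lemma stable_unit_y B q j : stable B -> (row_pair 0 q <= B)%MS ->
  (forall i, (i < j)%N -> q`_i = 0) -> q`_j != 0 -> (row_pair 0 'X^j <= B)%MS.
Proof.
move=> sB qB q0 qj; rewrite (drop_polyE q0) in qB.
have d0 : (drop_poly j q)`_0 != 0 by rewrite coef_drop_poly.
have [u du] := trunc_inverse n d0.
have := stable_row u sB qB; rewrite mul0r -mulrA.
by rewrite /row_pair -poly_rV_toep du mulmx1.
Qed.

Lemma stable_unit_x B p j : stable B -> (row_pair p 0 <= B)%MS ->
  (forall i, (i < j)%N -> p`_i = 0) -> p`_j != 0 -> (row_pair 'X^j 0 <= B)%MS.
Proof.
move=> sB qB q0 qj; rewrite (drop_polyE q0) in qB.
have d0 : (drop_poly j p)`_0 != 0 by rewrite coef_drop_poly.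
have [u du] := trunc_inverse n d0.
have := stable_row u sB qB; rewrite mul0r -mulrA.
by rewrite /row_pair -poly_rV_toep du mulmx1.
Qed.

Definition row_x B i : {poly K} := rVpoly (row i (lsubmx B)).
Definition row_y B i : {poly K} := rVpoly (row i (rsubmx B)).

Lemma row_pairE B i : row i B = row_pair (row_x B i) (row_y B i).
Proof. by rewrite /row_pair !rVpolyK -row_row_mx hsubmxK. Qed.

Lemma row_x_coef B i (o : 'I_n) : (row_x B i)`_o = B i (lshift n o).
Proof. by rewrite coef_rVpoly_ord !mxE. Qed.

Lemma row_y_coef B i (o : 'I_n) : (row_y B i)`_o = B i (rshift n o).
Proof. by rewrite coef_rVpoly_ord !mxE. Qed.

Lemma row_pair_low p q p' q' : (forall j, (j < n)%N -> p`_j = p'`_j) ->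
  (forall j, (j < n)%N -> q`_j = q'`_j) -> row_pair p q = row_pair p' q'.
Proof. by move=> pp qq; rewrite /row_pair (poly_rV_low pp) (poly_rV_low qq). Qed.

Lemma row_pair_raise p q r :
  row_pair p q *m (1%:M + raise_mx r) = row_pair p (q + p * r).
Proof. by rewrite row_mx_raise poly_rV_toep -raddfD. Qed.

Lemma row_pair_lower p q r :
  row_pair p q *m (1%:M + lower_mx r) = row_pair (p + q * r) q.
Proof. by rewrite row_mx_lower poly_rV_toep -raddfD. Qed.

Lemma row_xE B i (p q : {poly K}) j : (j < n)%N -> row i B = row_pair p q ->
  (row_x B i)`_j = p`_j /\ (row_y B i)`_j = q`_j.
Proof.
move=> jn e; rewrite -[j]/(val (Ordinal jn)) row_x_coef row_y_coef.
have eB c : B i c = row i B 0 c by rewrite mxE.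
by rewrite !eB e !(row_mxEl, row_mxEr) !mxE.
Qed.

(* U is generated over K[t] by t^k x and t^(n-k) y once it contains t^k x and is
   contained in t^k K[t]^2, by counting dimensions. *)
Lemma stable_std B k : (k < n)%N -> stable B -> minors B != 0 ->
  (forall i j, (j < k)%N -> (row_x B i)`_j = 0) ->
  (row_pair 'X^k 0 <= B)%MS -> exists2 P, \det P != 0 & B = P *m std_frame k.
Proof.
move=> kn sB mB lowx xB.
have yB : (0 < k)%N -> (row_pair 0 'X^(n - k) <= B)%MS.
  move=> k0; have nkn : (n - k < n)%N by rewrite ltn_subrL k0 (leq_ltn_trans _ kn).
  have rowyB i : (row_pair 0 (row_y B i) <= B)%MS.
    have : (row_pair (row_x B i) 0 <= B)%MS.
      rewrite (drop_polyE (lowx i)) -[0](mul0r (drop_poly k (row_x B i))).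
      exact: stable_row.
    move=> xiB; have -> : row_pair 0 (row_y B i) = row i B - row_pair (row_x B i) 0.
      by rewrite row_pairE /row_pair opp_row_mx add_row_mx subrr -raddfB subr0 raddf0.
    by rewrite addmx_sub ?row_sub // eqmx_opp.
  (* Either some y-component has order at most n - k and produces t^(n-k) y, or the rows only meet
     the n - k columns t^i x with i >= k and the k - 1 columns t^i y with i > n - k, too few for
     rank n. *)
  have [[i [j [jn yij]]]|no] := pselect (exists i j, (j <= n - k)%N /\ (row_y B i)`_j != 0).
    have exj : exists j, (row_y B i)`_j != 0 by exists j.
    case: (ex_minnP exj) => m ym min.
    have mB' : (row_pair 0 'X^m <= B)%MS.
      apply: (stable_unit_y sB (rowyB i)) ym => l lm; apply/eqP/negPn/negP => /min.
      by rewrite leqNgt lm.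
    have := stable_row 'X^(n - k - m) sB mB'; rewrite mul0r -exprD subnKC //.
    exact: leq_trans (min _ yij) jn.
  case/eqP: mB; apply: (minors_missing_col (@std_idx_inj k) (i0 := Ordinal nkn)) => a c.
  rewrite -(splitK c); case: (split c) => o /=.
    rewrite -row_x_coef => nz; have ko : (k <= o)%N.
      by rewrite leqNgt; apply: contra nz => /lowx ->.
    have lt : (o - k < n)%N by apply: leq_ltn_trans (leq_subr _ _) (ltn_ord o).
    exists (Ordinal lt); last by rewrite (@std_idx_l k _ o) //= subnKC.
    by rewrite -val_eqE /= neq_ltn ltn_sub2r.
  rewrite -row_y_coef => nz; have lt : (n - k < o)%N.
    by rewrite ltnNge; apply/negP => le; case: no; exists a, (val o).
  by exists o; [rewrite -val_eqE /= gtn_eqF | rewrite std_idx_r // ltnW].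
have : (std_frame k <= B)%MS.
  apply/row_subP => i; case: (ltnP (k + i) n) => kin.
    have -> : row i (std_frame k) = row_pair ('X^k * 'X^i) (0 * 'X^i).
      rewrite -exprD mul0r; apply/rowP => c; rewrite mxE mxE (@std_idx_l k i (Ordinal kin)) //.
      rewrite -(splitK c); case: (split c) => o /=; rewrite ?row_mxEl ?row_mxEr !mxE.
        by rewrite (inj_eq (@lshift_inj _ _)) coefXn.
      by rewrite eq_rlshift coef0.
    exact: stable_row.
  have nki : (n - k <= i)%N by rewrite leq_subLR.
  have k0 : (0 < k)%N by case: (posnP k) kin => // ->; rewrite leqNgt ltn_ord.
  have -> : row i (std_frame k) = row_pair (0 * 'X^(i - (n - k))) ('X^(n - k) * 'X^(i - (n - k))).
    rewrite -exprD mul0r subnKC //; apply/rowP => c; rewrite mxE mxE std_idx_r //.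
    rewrite -(splitK c); case: (split c) => o /=; rewrite ?row_mxEl ?row_mxEr !mxE.
      by rewrite eq_lrshift coef0.
    by rewrite (inj_eq (@rshift_inj _ _)) coefXn.
  exact/stable_row/yB.
case/submxP => Q QB; have dQ : \det Q != 0.
  apply/eqP => dQ; have := minors_std k; rewrite QB minors_mul dQ scale0r ffunE.
  by move/eqP; rewrite eq_sym oner_eq0.
exists (invmx Q); first by rewrite det_inv invr_eq0.
by rewrite QB mulKmx // unitmxE unitfE.
Qed.

(** [k] is the least order in t of a component of a row, so U lies in t^k K[t]^2. A row attaining it
    is moved to a unit multiple of t^k x: f makes its x-part of order exactly k, and e clears its
    y-part. If k > 0, the columns of x and y are zero, which kills both extreme minors. *)
Lemma stable_normal_form B : (0 < n)%N -> stable B -> minors B != 0 ->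
  exists k (c : K) p P, [/\ (k < n)%N, \det P != 0,
    B *m (1%:M + lower_mx c%:P) *m (1%:M + raise_mx p) = P *m std_frame k &
    (0 < k)%N -> minors B (@all_x n) = 0 /\ minors B (@all_y n) = 0].
Proof.
move=> n0 sB mB.
have exk : exists k, [exists i, ((row_x B i)`_k != 0) || ((row_y B i)`_k != 0)].
  apply: contrapT => h; case/eqP: mB; have -> : B = 0.
    apply/matrixP => i c; rewrite mxE -(splitK c); apply: contrapT => /eqP nz.
    case: h; move: nz; case: (split c) => o /= nz; exists (val o); apply/existsP; exists i.
      by rewrite row_x_coef nz.
    by rewrite row_y_coef nz orbT.
  apply/ffunP => i; rewrite !ffunE (expand_det_row _ (Ordinal n0)) big1 // => j _.
  by rewrite !mxE mul0r.
case: (ex_minnP exk) => k /existsP[i0 nz] min.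
have low j i : (j < k)%N -> (row_x B i)`_j = 0 /\ (row_y B i)`_j = 0.
  move=> jk; have : ~~ (((row_x B i)`_j != 0) || ((row_y B i)`_j != 0)).
    apply/negP => h; have := min j; rewrite leqNgt jk => /(_ _)/negP.
    by case=> //; apply/existsP; exists i.
  by rewrite negb_or !negbK => /andP[/eqP -> /eqP ->].
have kn : (k < n)%N.
  rewrite ltnNge; apply/negP => nk; move: nz; rewrite /row_x /row_y.
  by rewrite !nth_default ?eqxx // (leq_trans (size_poly _ _)).
(* If the x-part of row [i0] has order k, nothing is to be done; otherwise its y-part has order k
   and is added to it. *)
pose c : K := if (row_x B i0)`_k != 0 then 0 else 1.
pose px := row_x B i0 + row_y B i0 * c%:P; pose py := row_y B i0.
have pxk : px`_k != 0.
  rewrite coefD coefMC /c; case: ifP => [h|/negbFE/eqP h]; first by rewrite mulr0 addr0.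
  by move: nz; rewrite h eqxx /= mulr1 add0r.
have pxl j : (j < k)%N -> px`_j = 0.
  by move=> /(low _ i0)[e1 e2]; rewrite coefD coefMC e1 e2 mul0r addr0.
have d0 : (drop_poly k px)`_0 != 0 by rewrite coef_drop_poly.
have [u du] := trunc_inverse n d0.
(* This is - py / px modulo t^n, the common factor t^k being cancelled before inverting. *)
pose r := - (drop_poly k py * u).
exists k, c, r.
set B1 := B *m (1%:M + lower_mx c%:P); set B2 := B1 *m (1%:M + raise_mx r).
have sB2 : stable B2 by apply/stable_raise/stable_lower.
have rowB2 i : row i B2 = row_pair (row_x B i + row_y B i * c%:P)
     (row_y B i + (row_x B i + row_y B i * c%:P) * r).
  by rewrite /B2 /B1 !row_mul row_pairE row_pair_lower row_pair_raise.
have mB2 : minors B2 != 0.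
  move: mB; rewrite !minors_neq0 /B2 /B1 -mulmxA /row_free mxrankMfree //.
  rewrite row_free_unit unitmx_mul; apply/andP; split.
    by case/mulmx1_unit: (unipotentK (@lower_mxN K n c%:P) (lower_mx_sq _ _)).
  by case/mulmx1_unit: (unipotentK (@raise_mxN K n r) (raise_mx_sq _ _)).
have [P dP PE] : exists2 P, \det P != 0 & B2 = P *m std_frame k.
  apply: stable_std => //.
    move=> i j jk; have [-> _] := row_xE (ltn_trans jk kn) (rowB2 i).
    by have [e1 e2] := low _ i jk; rewrite coefD coefMC e1 e2 mul0r addr0.
  refine (stable_unit_x sB2 _ pxl pxk).
  have : (row i0 B2 <= B2)%MS by rewrite row_sub.
  rewrite rowB2 -/px -/py; suff -> : row_pair px (py + px * r) = row_pair px 0 by [].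
  rewrite /row_pair; congr row_mx; rewrite (_ : py + px * r = py - py * (drop_poly k px * u)).
    by rewrite raddfB /= -(poly_rV_toep _ py) du mulmx1 subrr raddf0.
  have pyl j : (j < k)%N -> py`_j = 0 by move/(low _ i0) => [].
  rewrite /r mulrN; congr (_ - _).
  by rewrite {1}(drop_polyE pxl) {2}(drop_polyE pyl); ring.
exists P; split=> // k0.
have zx (q : 'I_n) : nat_of_ord q = 0%N -> forall i, B i (lshift n q) = 0 /\ B i (rshift n q) = 0.
  by move=> q0 i; have := low 0%N i k0; rewrite -q0 row_x_coef row_y_coef.
by split; rewrite ffunE (expand_det_col _ (Ordinal n0)) big1 // => i _;
   rewrite mxE ffunE; have [e1 e2] := zx (Ordinal n0) erefl i; rewrite ?e1 ?e2 mul0r.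
Qed.

End StableFrames.

Section Frames.
Context {K : numClosedFieldType} {n : nat}.
Implicit Types p q : nat -> {poly K}.

Definition frame (p q : nat -> {poly K}) : 'M[K]_(n, n + n) :=
  \matrix_(i < n) row_pair (p i) (q i).

Lemma frame_l p q i o : frame p q i (lshift n o) = (p i)`_o.
Proof. by rewrite mxE row_mxEl mxE. Qed.

Lemma frame_r p q i o : frame p q i (rshift n o) = (q i)`_o.
Proof. by rewrite mxE row_mxEr mxE. Qed.

Lemma row_frame p q i : row i (frame p q) = row_pair (p i) (q i).
Proof. by rewrite rowK. Qed.

Lemma frame_pencilE p q p' q' s :
  frame p q + s *: frame p' q' = frame (fun i => p i + s *: p' i) (fun i => q i + s *: q' i).
Proof.
apply/row_matrixP => i; rewrite linearD linearZ /= !row_frame /row_pair.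
by rewrite scale_row_mx add_row_mx -!linearZ -!linearD.
Qed.

Lemma std_frameE k :
  std_frame k = frame (fun i => 'X^(k + i)) (fun i => if (i < n - k)%N then 0 else 'X^i).
Proof.
apply/matrixP => i c; rewrite mxE -(splitK c).
have [lt|ge] := ltnP i (n - k).
  have kin : (k + i < n)%N by lia.
  rewrite (@std_idx_l n k i (Ordinal kin)) //.
  case: (split c) => o /=; rewrite ?frame_l ?frame_r.
    by rewrite (inj_eq (@lshift_inj _ _)) coefXn.
  by rewrite eq_rlshift lt coef0.
rewrite std_idx_r //; case: (split c) => o /=; rewrite ?frame_l ?frame_r.
  rewrite eq_lrshift coefXn ltn_eqF //; apply: leq_trans (ltn_ord o) _.
  by rewrite -leq_subLR.
by rewrite (inj_eq (@rshift_inj _ _)) ltnNge ge coefXn.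
Qed.

Lemma std_frame0 : std_frame 0 = cell_frame n 0 :> 'M[K]_(n, n + n).
Proof.
apply/matrixP => i c; rewrite !mxE (@std_idx_l n 0 i i) // -(splitK c).
case: (split c) => o /=; rewrite ?(unsplitK (inl _)) ?(unsplitK (inr _)).
  by rewrite (inj_eq (@lshift_inj _ _)) mxE eq_sym.
by rewrite eq_rlshift mxE mulr0 coef0.
Qed.

End Frames.

(** * Pencils of t-stable subspaces through U_k *)

Section StandardPencils.
Context {K : numClosedFieldType} {n : nat}.
Implicit Types B D : 'M[K]_(n, n + n).

Definition xpow e : 'rV[K]_(n + n) := row_pair 'X^e 0.
Definition ypow e : 'rV[K]_(n + n) := row_pair 0 'X^e.

Lemma xpow_toep e : xpow e *m diag_toep 'X = xpow e.+1.
Proof. by rewrite row_pair_toep mul0r -exprSr. Qed.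

Lemma ypow_toep e : ypow e *m diag_toep 'X = ypow e.+1.
Proof. by rewrite row_pair_toep mul0r -exprSr. Qed.

Lemma xpow_ge e : (n <= e)%N -> xpow e = 0.
Proof.
move=> ne; rewrite /xpow (@row_pair_low _ _ _ 0 0 0) //.
  by rewrite /row_pair raddf0 row_mx0.
by move=> j jn; rewrite coefXn coef0 ltn_eqF // (leq_trans jn).
Qed.

Lemma ypow_ge e : (n <= e)%N -> ypow e = 0.
Proof.
move=> ne; rewrite /ypow (@row_pair_low _ _ 0 _ 0 0) //.
  by rewrite /row_pair raddf0 row_mx0.
by move=> j jn; rewrite coefXn coef0 ltn_eqF // (leq_trans jn).
Qed.

Lemma xpowE e c : xpow e 0 c = if split c is inl o then (o == e :> nat)%:R else 0.
Proof.
by rewrite -{1}(splitK c); case: (split c) => o /=;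
   rewrite ?row_mxEl ?row_mxEr mxE ?coefXn ?coef0.
Qed.

Lemma ypowE e c : ypow e 0 c = if split c is inr o then (o == e :> nat)%:R else 0.
Proof.
by rewrite -{1}(splitK c); case: (split c) => o /=;
   rewrite ?row_mxEl ?row_mxEr mxE ?coefXn ?coef0.
Qed.

Lemma row_std k i : row i (std_frame k) = if (i < n - k)%N then xpow (k + i) else ypow i.
Proof.
rewrite std_frameE row_frame; case: ifP => // /negbT lt.
apply: row_pair_low => // j jn; rewrite coefXn coef0 ltn_eqF //; lia.
Qed.

Lemma stable_rows B : (forall i, (row i B *m diag_toep 'X <= B)%MS) -> stable B.
Proof. by move=> h; apply/row_subP => i; rewrite row_mul. Qed.

Lemma row_pencil B D s i : row i (B + s *: D) = row i B + s *: row i D.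
Proof. by rewrite linearD linearZ. Qed.

Variable k : nat.

(** Added with factor s, it replaces the generator t^k x of U_k by t^k x + s t^m y; [pencil_x]
    replaces t^(n-k) y by t^(n-k) y + s t^m x. The relation t^(n-k) t^k x = 0 deforms to a multiple
    of t^(n-k) y, so stability persists. *)
Definition pencil_y (m : nat) : 'M[K]_(n, n + n) :=
  \matrix_(i < n) if (i < n - k)%N then ypow (m + i) else 0.
Definition pencil_x (m : nat) : 'M[K]_(n, n + n) :=
  \matrix_(i < n) if (i < n - k)%N then 0 else xpow (m + (i - (n - k))).
(* The derivative at 0 of a curve through U tangent to a nilpotent endomorphism
   of U / tU of the form (1, 1; -1, -1). *)
Definition pencil_xy : 'M[K]_(n, n + n) :=
  \matrix_(i < n) if i == 0%N :> nat then - (xpow k.-1 + ypow (n - k).-1)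
    else if i == (n - k)%N :> nat then xpow k.-1 + ypow (n - k).-1 else 0.

Lemma stable_pencil_y m s : stable (std_frame k + s *: pencil_y m).
Proof.
set B := _ + _; have yB j : (n - k <= j)%N -> (ypow j <= B)%MS.
  move=> h; case: (ltnP j n) => [jn|/ypow_ge ->]; last exact: sub0mx.
  suff <- : row (Ordinal jn) B = ypow j by rewrite row_sub.
  by rewrite row_pencil row_std rowK /= ltnNge h /= scaler0 addr0.
apply: stable_rows => i; rewrite row_pencil row_std rowK mulmxDl -scalemxAl.
case: ifP => [lt|/negbT ge]; last first.
  by rewrite mul0mx scaler0 addr0 ypow_toep; apply: yB; lia.
rewrite xpow_toep ypow_toep.
case: (ltnP i.+1 (n - k)) => lt1.
  have lt2 : (i.+1 < n)%N by lia.
  suff <- : row (Ordinal lt2) B = xpow (k + i).+1 + s *: ypow (m + i).+1 by rewrite row_sub.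
  by rewrite row_pencil row_std rowK /= lt1 !addnS.
rewrite xpow_ge ?add0r ?scalemx_sub //; last lia.
by apply: yB; lia.
Qed.

Lemma stable_pencil_x m s : (k <= n)%N -> stable (std_frame k + s *: pencil_x m).
Proof.
move=> kn; set B := _ + _; have xB j : (k <= j)%N -> (xpow j <= B)%MS.
  move=> h; case: (ltnP j n) => [jn|/xpow_ge ->]; last exact: sub0mx.
  have lt : (j - k < n)%N by lia.
  suff <- : row (Ordinal lt) B = xpow j by rewrite row_sub.
  rewrite row_pencil row_std rowK /= ltn_sub2r ?scaler0 ?addr0 ?subnKC //; lia.
apply: stable_rows => i; rewrite row_pencil row_std rowK mulmxDl -scalemxAl.
case: ifP => [lt|/negbT ge].
  by rewrite mul0mx scaler0 addr0 xpow_toep; apply: xB; lia.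
rewrite xpow_toep ypow_toep.
case: (ltnP i.+1 n) => lt1.
  suff <- : row (Ordinal lt1) B = ypow i.+1 + s *: xpow (m + (i - (n - k))).+1 by rewrite row_sub.
  have -> : (m + (i - (n - k))).+1 = (m + (i.+1 - (n - k)))%N by lia.
  rewrite row_pencil row_std rowK /=; have -> : (i.+1 < n - k)%N = false by lia.
  by [].
rewrite ypow_ge // add0r scalemx_sub //; apply: xB; lia.
Qed.

Lemma stable_pencil_xy s : (0 < k)%N -> (k < n)%N -> stable (std_frame k + s *: pencil_xy).
Proof.
move=> k0 kn; set B := _ + _.
have rowB (i : nat) (lt : (i < n)%N) : i != 0%N -> i != (n - k)%N ->
    row (Ordinal lt) B = if (i < n - k)%N then xpow (k + i) else ypow i.
  by move=> /negPf i0 /negPf ik; rewrite row_pencil row_std rowK /= i0 ik scaler0 addr0.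
have xB j : (k < j)%N -> (xpow j <= B)%MS.
  move=> h; case: (ltnP j n) => [jn|/xpow_ge ->]; last exact: sub0mx.
  have lt : (j - k < n)%N by lia.
  suff <- : row (Ordinal lt) B = xpow j by rewrite row_sub.
  rewrite rowB; [|lia|lia]; have -> : (j - k < n - k)%N by lia.
  by congr xpow; lia.
have yB j : (n - k < j)%N -> (ypow j <= B)%MS.
  move=> h; case: (ltnP j n) => [jn|/ypow_ge ->]; last exact: sub0mx.
  suff <- : row (Ordinal jn) B = ypow j by rewrite row_sub.
  rewrite rowB; [|lia|lia]; have -> : (j < n - k)%N = false by lia.
  by [].
have n0 : (0 < n)%N by lia.
have lt : (n - k < n)%N by lia.
pose g := xpow k.-1 + ypow (n - k).-1.
have r0 : row (Ordinal n0) B = xpow k - s *: g.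
  rewrite row_pencil row_std rowK /=; have -> : (0 < n - k)%N by lia.
  by rewrite addn0 scalerN.
have r1 : row (Ordinal lt) B = ypow (n - k) + s *: g.
  rewrite row_pencil row_std rowK /= ltnn; have -> : (n - k == 0)%N = false by lia.
  by rewrite eqxx.
have gB : (g *m diag_toep 'X <= B)%MS.
  (* The terms in s cancel: t g = t^k x + t^(n-k) y is the sum of the two deformed generators. *)
  have -> : g *m diag_toep 'X = row (Ordinal n0) B + row (Ordinal lt) B.
    rewrite r0 r1 addrACA addNr addr0 /g mulmxDl xpow_toep ypow_toep.
    by congr (xpow _ + ypow _); lia.
  by rewrite addmx_sub ?row_sub.
apply: stable_rows => i.
have [i0|ni0] := eqVneq (val i) 0%N.
  have -> : i = Ordinal n0 by apply: val_inj.
  rewrite r0 mulmxBl xpow_toep -scalemxAl addmx_sub ?eqmx_opp ?scalemx_sub //.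
  by apply: xB; lia.
have [i1|ni1] := eqVneq (val i) (n - k)%N.
  have -> : i = Ordinal lt by apply: val_inj.
  rewrite r1 mulmxDl ypow_toep -scalemxAl addmx_sub ?scalemx_sub //.
  by apply: yB; lia.
have -> : i = Ordinal (ltn_ord i) by apply: val_inj.
rewrite rowB //; case: ifP => [h|/negbT h].
  by rewrite xpow_toep; apply: xB; lia.
by rewrite ypow_toep; apply: yB; lia.
Qed.

End StandardPencils.

(** * Geometry of the fusion variety *)

Section FusionVariety.
Context {K : numClosedFieldType} {n : nat} {z : 'I_n -> K}.
Local Notation two := (fun _ : 'I_n => 2%N).
Variable M : fusion_product two z.

Definition exp_e (p : {poly K}) : 'End(M) :=
  exp_nilp (gr_act_poly M (delta_mx 0 1) (in_qpoly 'X^n p)).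
Definition exp_f (p : {poly K}) : 'End(M) :=
  exp_nilp (gr_act_poly M (delta_mx 1 0) (in_qpoly 'X^n p)).

Lemma exp_nilpE (f : 'End(M)) y :
  exp_nilp f y = \sum_(k < \dim {: M}) k`!%:R^-1 *: iter k f y.
Proof.
rewrite /exp_nilp sum_lfunE; apply: eq_bigr => k _; rewrite scale_lfunE; congr (_ *: _).
by elim: (val k) y => [|j IH] y /=; rewrite ?id_lfunE // comp_lfunE IH.
Qed.

Variable Psi : 'Hom(M, tensors K n).
Hypothesis Psi_v : Psi (fusion_vector M) = minors (cell_frame n 0).
Hypothesis Psi_act : forall x k y, \tr x = 0 ->
  Psi (gr_act M x k y) = tensor_act (current_mx x k) (Psi y).
Hypothesis dimM_leq : (\dim {: M} <= 2 ^ n)%N.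

Lemma Psi_raise p y :
  Psi (gr_act_poly M (delta_mx 0 1) (in_qpoly 'X^n p) y) = tensor_act (raise_mx p) (Psi y).
Proof.
rewrite /gr_act_poly sum_lfunE linear_sum sum_raise_mx tensor_act_sum.
apply: eq_bigr => k _; rewrite scale_lfunE linearZ /= Psi_act ?tr_delta //.
by rewrite (current_mx_delta k).1 coef_in_qpoly.
Qed.

Lemma Psi_lower p y :
  Psi (gr_act_poly M (delta_mx 1 0) (in_qpoly 'X^n p) y) = tensor_act (lower_mx p) (Psi y).
Proof.
rewrite /gr_act_poly sum_lfunE linear_sum sum_lower_mx tensor_act_sum.
apply: eq_bigr => k _; rewrite scale_lfunE linearZ /= Psi_act ?tr_delta //.
by rewrite (current_mx_delta k).2 coef_in_qpoly.
Qed.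

Lemma Psi_iter (f : 'End(M)) N k y : (forall y, Psi (f y) = tensor_act N (Psi y)) ->
  Psi (iter k f y) = iter k (tensor_act N) (Psi y).
Proof. by move=> h; elim: k => //= k IH; rewrite h IH. Qed.

(** The series is cut at n + 1 terms rather than at dim M, because n < dim M only follows once these
    minors are known to lie in the image. *)
Lemma limg_Psi_cell p : minors (cell_frame n p) \in limg Psi.
Proof.
rewrite -[p]add0r -cell_frame_raise.
rewrite -(tensor_exp_minors _ (raise_mx_sq p p) (ltnSn n)).
apply: rpred_sum => k _; apply: rpredZ.
rewrite -Psi_v -(Psi_iter _ _ (Psi_raise p)).
exact: memv_img (memvf _).
Qed.

Lemma dimM : \dim {: M} = (2 ^ n)%N.
Proof.
apply/eqP; rewrite eqn_leq dimM_leq -(limg_ker_dim Psi fullv).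
by apply: leq_trans (cell_span_dim limg_Psi_cell) (leq_addl _ _).
Qed.

Lemma n_lt_dimM : (n < \dim {: M})%N.
Proof. by rewrite dimM ltn_expl. Qed.

Lemma lker_Psi : (lker Psi == 0)%VS.
Proof.
rewrite -dimv_eq0; have := limg_ker_dim Psi fullv; rewrite capfv dimM => e.
have := cell_span_dim limg_Psi_cell; rewrite -{1}e -{2}[\dim (limg _)]add0n leq_add2r.
by rewrite leqn0.
Qed.

Lemma Psi_inj : injective Psi.
Proof. exact/lker0P/lker_Psi. Qed.

Lemma Psi_exp_e p y B : Psi y = minors B ->
  Psi (exp_e p y) = minors (B *m (1%:M + raise_mx p)).
Proof.
move=> yB; rewrite exp_nilpE linear_sum -(tensor_exp_minors _ (raise_mx_sq p p) n_lt_dimM).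
by apply: eq_bigr => k _; rewrite linearZ /= (Psi_iter _ _ (Psi_raise p)) yB.
Qed.

Lemma Psi_exp_f p y B : Psi y = minors B ->
  Psi (exp_f p y) = minors (B *m (1%:M + lower_mx p)).
Proof.
move=> yB; rewrite exp_nilpE linear_sum -(tensor_exp_minors _ (lower_mx_sq p p) n_lt_dimM).
by apply: eq_bigr => k _; rewrite linearZ /= (Psi_iter _ _ (Psi_lower p)) yB.
Qed.

Definition cell_vector p : M := exp_e p (fusion_vector M).

Lemma Psi_cell p : Psi (cell_vector p) = minors (cell_frame n p).
Proof. by rewrite /cell_vector (Psi_exp_e _ Psi_v) cell_frame_raise add0r. Qed.

Lemma cell_span (U : {vspace M}) : (forall p, cell_vector p \in U) -> U = fullv.
Proof.
move=> cU; apply/eqP; rewrite eqEdim subvf dimM.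
have : (\dim (Psi @: U) <= \dim U)%N by rewrite -(limg_ker_dim Psi U) leq_addl.
by apply: leq_trans; apply: cell_span_dim => p; rewrite -Psi_cell memv_img.
Qed.

(** [exp_nilp] is a truncated sum, so its inverse is not formal. It is checked on the cell vectors,
    which span M, where the exponential is right multiplication by 1 + N. *)
Lemma exp_eK p : cancel (exp_e p) (exp_e (- p)).
Proof.
have : (lker (exp_e (- p) \o exp_e p - \1)%VF = fullv)%VS.
  apply: cell_span => q; rewrite memv_ker add_lfunE opp_lfunE id_lfunE comp_lfunE subr_eq0.
  apply/eqP/Psi_inj; rewrite (Psi_exp_e _ (Psi_exp_e _ (Psi_cell q))) Psi_cell.
  by rewrite !cell_frame_raise addrK.
move=> h y; have := memvf y; rewrite -h memv_ker add_lfunE opp_lfunE id_lfunE comp_lfunE.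
by rewrite subr_eq0 => /eqP.
Qed.

Lemma exp_fK p : cancel (exp_f p) (exp_f (- p)).
Proof.
have : (lker (exp_f (- p) \o exp_f p - \1)%VF = fullv)%VS.
  apply: cell_span => q; rewrite memv_ker add_lfunE opp_lfunE id_lfunE comp_lfunE subr_eq0.
  apply/eqP/Psi_inj; rewrite (Psi_exp_f _ (Psi_exp_f _ (Psi_cell q))) Psi_cell.
  by rewrite -mulmxA unipotentK ?mulmx1 ?lower_mxN ?lower_mx_sq.
move=> h y; have := memvf y; rewrite -h memv_ker add_lfunE opp_lfunE id_lfunE comp_lfunE.
by rewrite subr_eq0 => /eqP.
Qed.

(** The affine space of cyclic subspaces generated by x + p y, as vectors of M; it stands in for the
    whole orbit in all equations. *)
Definition cell : set M := [set y | exists p, y = cell_vector p].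

Definition frame_in_cone B : Prop := exists2 y, Psi y = minors B & in_cone cell y.

Lemma frame_in_coneE y B : Psi y = minors B -> frame_in_cone B -> in_cone cell y.
Proof. by move=> yB [y' y'B]; rewrite -yB in y'B; rewrite (Psi_inj y'B). Qed.

Lemma in_cone_cell p : in_cone cell (cell_vector p).
Proof. by move=> d q _ q0; apply: q0; exists p. Qed.

Lemma frame_in_cone_cell p : frame_in_cone (cell_frame n p).
Proof. by exists (cell_vector p); [exact: Psi_cell | exact: in_cone_cell]. Qed.

Lemma frame_in_cone_mul (P : 'M[K]_n) B : frame_in_cone B -> frame_in_cone (P *m B).
Proof.
move=> [y yB cy]; exists (\det P *: y); last exact: in_cone_scale.
by rewrite linearZ /= yB minors_mul.
Qed.

(** The pencil has to be lifted through [Psi]. Its minors are known to lie in the image where b(s)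
    != 0, and [mpE] extends this to all s as a polynomial identity; [w] is then the velocity of the
    lifted curve at s = 0. *)
Lemma frame_pencil (b : {poly K}) B D : b != 0 ->
  (forall s, b.[s] != 0 -> frame_in_cone (B + s *: D)) ->
  (forall s, frame_in_cone (B + s *: D)) /\
  forall y, Psi y = minors B -> exists w, cone_tangent cell y w /\
    forall i, Psi w i = (minor_pencil B D i)^`().[0].
Proof.
move=> b0 hb.
pose g i : M := (Psi^-1)%VF [ffun k => (k == i)%:R].
pose r j : {poly K} := \sum_i coordv (g i) j *: minor_pencil B D i.
pose G (c : tensor_idx n -> K) := vec_of (fun j => \sum_i coordv (g i) j * c i).
have GE (F : tensors K n) : G F = (Psi^-1)%VF F.
  rewrite -[RHS]vec_of_coordv /G /vec_of; apply: eq_bigr => j _; congr (_ *: _).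
  rewrite {2}[F]ffun_basisE linear_sum /coordv linear_sum /=.
  by apply: eq_bigr => i _; rewrite !linearZ /= mulrC.
have PsiG c i : Psi (G c) i = \sum_i' Psi (g i') i * c i'.
  have -> : G c = \sum_i' c i' *: g i'.
    rewrite -[RHS]vec_of_coordv /G /vec_of; apply: eq_bigr => j _; congr (_ *: _).
    by rewrite /coordv linear_sum; apply: eq_bigr => k _; rewrite linearZ /= mulrC.
  rewrite linear_sum sum_ffunE; apply: eq_bigr => k _.
  by rewrite linearZ /= ffunE mulrC.
have r_horner s : vec_of (fun j => (r j).[s]) = G (minors (B + s *: D)).
  rewrite /G /vec_of; apply: eq_bigr => j _; congr (_ *: _).
  rewrite horner_sum; apply: eq_bigr => i _.
  by rewrite hornerZ horner_minor_pencil.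
have r_deriv s : vec_of (fun j => (r j)^`().[s]) = G (fun i => (minor_pencil B D i)^`().[s]).
  rewrite /G /vec_of; apply: eq_bigr => j _; congr (_ *: _).
  rewrite linear_sum horner_sum; apply: eq_bigr => i _.
  by rewrite linearZ /= hornerZ.
have mpE i : minor_pencil B D i = \sum_i' Psi (g i') i *: minor_pencil B D i'.
  apply/eqP; rewrite -subr_eq0; apply/eqP; apply: (poly_cofinite_roots b0) => s bs.
  have [y yB _] := hb s bs; rewrite hornerD hornerN horner_minor_pencil horner_sum.
  apply/eqP; rewrite subr_eq0; apply/eqP.
  have := PsiG (minors (B + s *: D)) i; rewrite GE -yB (lker0_lfunK lker_Psi) yB => ->.
  by apply: eq_bigr => k _; rewrite hornerZ horner_minor_pencil.
have PsiGs s : Psi (G (minors (B + s *: D))) = minors (B + s *: D).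
  apply/ffunP => i; rewrite PsiG -[RHS]horner_minor_pencil [in RHS]mpE horner_sum.
  by apply: eq_bigr => k _; rewrite hornerZ horner_minor_pencil.
have cc := @cone_curve _ _ cell r b b0.
have hc s : b.[s] != 0 -> in_cone cell (vec_of (fun j => (r j).[s])).
  by move=> /hb h; rewrite r_horner; apply: frame_in_coneE h; apply: PsiGs.
split=> [s|y yB].
  by exists (G (minors (B + s *: D))); [exact: PsiGs | rewrite -r_horner; case: (cc hc s)].
exists (G (fun i => (minor_pencil B D i)^`().[0])); split.
  have [_] := cc hc 0; rewrite r_horner r_deriv scale0r addr0.
  suff -> : G (minors B) = y by [].
  by apply: Psi_inj; have := PsiGs 0; rewrite scale0r addr0 yB.
move=> i; rewrite PsiG [in RHS]mpE linear_sum horner_sum.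
by apply: eq_bigr => k _; rewrite linearZ /= hornerZ.
Qed.

Lemma frame_in_cone_pencil (b : {poly K}) B D : b != 0 ->
  (forall s, b.[s] != 0 -> frame_in_cone (B + s *: D)) -> frame_in_cone B.
Proof.
by move=> b0 hb; have [/(_ 0)] := frame_pencil b0 hb; rewrite scale0r addr0.
Qed.

(** If p_0 != 0, the subspace is the one generated by x + (q / p) y; in general p is the limit of p
    + s. *)
Lemma frame_in_cone_cyclic (p q : {poly K}) : frame_in_cone (row_mx (toep n p) (toep n q)).
Proof.
have unit_case (p' : {poly K}) : p'`_0 != 0 -> frame_in_cone (row_mx (toep n p') (toep n q)).
  move=> p'0; have [r pr] := trunc_inverse n p'0.
  have -> : row_mx (toep n p') (toep n q) = toep n p' *m cell_frame n (r * q).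
    by rewrite /cell_frame mul_mx_row mulmx1 toepM mulmxA -toepM pr mul1mx.
  exact/frame_in_cone_mul/frame_in_cone_cell.
apply: (@frame_in_cone_pencil ('X + (p`_0)%:P) _ (row_mx 1%:M 0)).
  by rewrite -size_poly_gt0 size_XaddC.
move=> s; rewrite !hornerE => sp.
rewrite scale_row_mx add_row_mx scaler0 addr0 -toep1 -toepZ -toepD.
apply: unit_case; rewrite coefD coefZ coef1 mulr1 addrC //.
Qed.

Lemma exp_e_cone p : forall y,
  (in_cone cell y -> in_cone cell (exp_e p y)) /\
  (forall w, cone_tangent cell y w -> cone_tangent cell (exp_e p y) (exp_e p w)).
Proof.
apply: cone_map => _ [q ->]; apply: (frame_in_coneE (Psi_exp_e p (Psi_cell q))).
by rewrite cell_frame_raise; apply: frame_in_cone_cell.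
Qed.

(** Unlike exp(e p), this does not preserve the cell: x + q y becomes (1 + q p) x + q y, and 1 + q p
    need not be a unit. The frame is still of cyclic form, hence in the closed cone. *)
Lemma exp_f_cone p : forall y,
  (in_cone cell y -> in_cone cell (exp_f p y)) /\
  (forall w, cone_tangent cell y w -> cone_tangent cell (exp_f p y) (exp_f p w)).
Proof.
apply: cone_map => _ [q ->]; apply: (frame_in_coneE (Psi_exp_f p (Psi_cell q))).
rewrite /cell_frame row_mx_lower -toepM -toep1 -toepD; exact: frame_in_cone_cyclic.
Qed.

Lemma gr_act_poly_trunc x (p : trunc_poly K n) :
  gr_act_poly M x p = gr_act_poly M x (in_qpoly 'X^n (p : {poly K})).
Proof. by apply: eq_bigr => k _; rewrite coef_in_qpoly. Qed.

Lemma SL2_acts_exp_ind (P : 'M[trunc_poly K n]_2 -> 'End(M) -> Prop) :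
  P 1%:M \1%VF ->
  (forall (p : trunc_poly K n) g f, P g f ->
     P ((1%:M + p *: delta_mx 0 1) *m g) (exp_e p \o f)%VF) ->
  (forall (p : trunc_poly K n) g f, P g f ->
     P ((1%:M + p *: delta_mx 1 0) *m g) (exp_f p \o f)%VF) ->
  forall g f, SL2_acts g f -> P g f.
Proof.
move=> P1 Pe Pf g f; elim=> {g f} [|p g f _ IH|p g f _ IH] //.
  by rewrite gr_act_poly_trunc; apply: Pe.
by rewrite gr_act_poly_trunc; apply: Pf.
Qed.

Definition orbit_cone (y : M) : Prop := exists g f c,
  [/\ \det g = 1, SL2_acts g f, c != 0 & y = c *: f (fusion_vector M)].

Lemma orbit_cone_scale c y : c != 0 -> orbit_cone y -> orbit_cone (c *: y).
Proof.
move=> c0 [g [f [d [dg gf d0 ->]]]]; exists g, f, (c * d).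
by split=> //; rewrite ?mulf_neq0 // scalerA.
Qed.

Lemma orbit_cone_v : orbit_cone (fusion_vector M).
Proof.
exists 1%:M, \1%VF, 1; split; rewrite ?det1 ?oner_eq0 ?scale1r ?id_lfunE //.
exact: SL2_acts1.
Qed.

Lemma orbit_cone_exp_e p y : orbit_cone y -> orbit_cone (exp_e p y).
Proof.
move=> [g [f [c [dg gf c0 ->]]]].
exists ((1%:M + in_qpoly 'X^n p *: delta_mx 0 1) *m g), (exp_e p \o f)%VF, c.
split=> //; first by rewrite det_mulmx det_elem // mul1r.
  exact: SL2_acts_e.
by rewrite comp_lfunE linearZ.
Qed.

Lemma orbit_cone_exp_f p y : orbit_cone y -> orbit_cone (exp_f p y).
Proof.
move=> [g [f [c [dg gf c0 ->]]]].
exists ((1%:M + in_qpoly 'X^n p *: delta_mx 1 0) *m g), (exp_f p \o f)%VF, c.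
split=> //; first by rewrite det_mulmx det_elem // mul1r.
  exact: SL2_acts_f.
by rewrite comp_lfunE linearZ.
Qed.

Lemma fusion_orbitE L : fusion_orbit M L <-> orbit_cone (proj_rep L).
Proof.
split=> [[g [f [dg gf Lf]]]|[g [f [c [dg gf c0 e]]]]].
  by have [_ [c c0 e]] := proj_rep_line Lf; exists g, f, c.
exists g, f; split=> //; rewrite proj_repE e; apply/eqP.
rewrite eqEdim -memvE memvZ ?memv_line // !dim_vline scaler_eq0 (negPf c0) /=.
exact: leqnn.
Qed.

Lemma orbit_cone_cell p : orbit_cone (cell_vector p).
Proof. exact/orbit_cone_exp_e/orbit_cone_v. Qed.

(** A generator (p, q) not divisible by t remains so under both kinds of unipotents. *)
Lemma orbit_cone_frame y : orbit_cone y -> exists (p q : {poly K}) c,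
  [/\ c != 0, (p`_0 != 0) || (q`_0 != 0) &
      Psi y = c *: minors (row_mx (toep n p) (toep n q))].
Proof.
move=> [g [f [c [_ gf c0 ->]]]].
suff [p [q [pq e]]] : exists p q : {poly K}, (p`_0 != 0) || (q`_0 != 0) /\
    Psi (f (fusion_vector M)) = minors (row_mx (toep n p) (toep n q)).
  by exists p, q, c; rewrite linearZ /= e.
move: g f gf; apply: SL2_acts_exp_ind => [|r g f [p [q [pq e]]]|r g f [p [q [pq e]]]].
- by exists 1, 0; rewrite coef1 oner_eq0 id_lfunE Psi_v /cell_frame toep1.
- exists p, (q + p * (r : {poly K})); rewrite comp_lfunE (Psi_exp_e _ e).
  rewrite row_mx_raise -toepM -toepD; split=> //; rewrite coefD coef0M.
  by case: (eqVneq p`_0 0) pq => [->|] //=; rewrite mul0r addr0.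
- exists (p + q * (r : {poly K})), q; rewrite comp_lfunE (Psi_exp_f _ e).
  rewrite row_mx_lower -toepM -toepD; split=> //; rewrite coefD coef0M.
  by case: (eqVneq q`_0 0) pq => [->|]; rewrite ?orbT ?orbF // mul0r addr0.
Qed.

Lemma orbit_in_cone y : orbit_cone y -> in_cone cell y.
Proof.
move=> [g [f [c [_ gf _ ->]]]]; apply: in_cone_scale.
move: g f gf; apply: SL2_acts_exp_ind => [|r g f IH|r g f IH].
- rewrite id_lfunE; apply: (frame_in_coneE Psi_v); exact: frame_in_cone_cell.
- by rewrite comp_lfunE; apply: (exp_e_cone _ _).1.
- by rewrite comp_lfunE; apply: (exp_f_cone _ _).1.
Qed.

Lemma cell_vector_neq0 p : cell_vector p != 0.
Proof.
apply/eqP => e; have := Psi_cell p; rewrite e linear0.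
move/(congr1 (fun F : tensors K n => F all_x)); rewrite minors_all_x ffunE det1.
by move/eqP; rewrite eq_sym oner_eq0.
Qed.

Lemma cell_in_orbit a : cell a -> exists2 L, fusion_orbit M L & val L = <[a]>%VS.
Proof.
move=> [p ->]; have [L La] := proj_of (cell_vector_neq0 p); exists L => //.
apply/fusion_orbitE; have [_ [c c0 ->]] := proj_rep_line La.
exact/orbit_cone_scale/orbit_cone_cell.
Qed.

Lemma orbit_rep_in_cone L : fusion_orbit M L -> in_cone cell (proj_rep L).
Proof. by move/fusion_orbitE/orbit_in_cone. Qed.

Local Notation sh := (fusion_variety M).

Lemma fusion_varietyE L : sh L <-> in_cone cell (proj_rep L).
Proof. exact: zariski_closure_cone orbit_rep_in_cone cell_in_orbit L. Qed.

Lemma fusion_tangentE L w :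
  tangent_vector sh L w <-> cone_tangent cell (proj_rep L) w.
Proof. exact: tangent_vector_cone orbit_rep_in_cone cell_in_orbit L w. Qed.

(** * Equations of the cone and recognition of the orbit *)

Definition coord_mpoly i : {mpoly K[\dim {: M}]} := lin_mpoly (fun y => Psi y i).

Lemma pevalv_coord i y : pevalv (coord_mpoly i) y = Psi y i.
Proof. by rewrite pevalv_lin_mpoly // => c u v; rewrite linearP !ffunE. Qed.

Lemma coord_mpoly_homog i : coord_mpoly i \is 1.-homog.
Proof. exact: lin_mpoly_homog. Qed.

(* If the S-minor is invertible, all the minors are determined by those that differ
   from it in one column. *)
Definition minor_eq (S i : tensor_idx n) : {mpoly K[\dim {: M}]} :=
  coord_mpoly S * \det (\matrix_(q, q') coord_mpoly (idx_set S q (i q')))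
  - coord_mpoly S ^+ n * coord_mpoly i.

Lemma pevalv_minor_eq S i y : pevalv (minor_eq S i) y =
  Psi y S * \det (colsub i (slice (Psi y) S)) - Psi y S ^+ n * Psi y i.
Proof.
rewrite /pevalv /minor_eq rmorphB !rmorphM rmorphXn /= -!/(pevalv _ _) !pevalv_coord.
congr (_ * _ - _); rewrite /pevalv -det_map_mx; congr (\det _); apply/matrixP => a b.
by rewrite !mxE; exact: pevalv_coord.
Qed.

Lemma minor_eq_homog S i : minor_eq S i \is n.+1.-homog.
Proof.
rewrite /minor_eq; apply: rpredB.
  apply: (@dhomogM _ _ _ 1%N _ n); first exact: coord_mpoly_homog.
  by apply: det_homog => a b; rewrite mxE coord_mpoly_homog.
have hn := dhomogMn n (coord_mpoly_homog S); rewrite mul1n in hn.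
by have := dhomogM hn (coord_mpoly_homog i); rewrite addn1.
Qed.

Lemma minor_eq_cell S i a : cell a -> pevalv (minor_eq S i) a = 0.
Proof.
move=> [p ->]; rewrite pevalv_minor_eq Psi_cell slice_minors colsub_mul det_mulmx mulrA.
set B := cell_frame n p.
have eS : minors B S = \det (colsub S B) by rewrite ffunE.
have ei : minors B i = \det (colsub i B) by rewrite ffunE.
rewrite ei eS; apply/eqP; rewrite subr_eq0; apply/eqP; congr (_ * _).
by rewrite -det_mulmx mul_mx_adj det_scalar.
Qed.

(* The slice s of [minors B] at S spans the rows of B and its S-columns form a scalar
   matrix, so the coordinates of s t in the rows of s are read off at the S-columns. *)
Definition stable_eq (S : tensor_idx n) (q : 'I_n) (j : 'I_(n + n)) : {mpoly K[\dim {: M}]} :=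
  let s := \matrix_(q, l) coord_mpoly (idx_set S q l) in
  let t : 'M[{mpoly K[\dim {: M}]}]_(n + n) := map_mx (@mpolyC _ K) (diag_toep 'X) in
  coord_mpoly S * (s *m t) q j - (colsub S (s *m t) *m s) q j.

Lemma stable_eq_homog S q j : stable_eq S q j \is 2.-homog.
Proof.
have h2 a b : (\matrix_(q, l) coord_mpoly (idx_set S q l) *m
     map_mx (@mpolyC _ K) (diag_toep 'X)) a b \is 1.-homog.
  rewrite mxE; apply: rpred_sum => l _; rewrite !mxE mulrC mul_mpolyC; apply: rpredZ.
  exact: coord_mpoly_homog.
rewrite /stable_eq; apply: rpredB.
  by rewrite -[2%N]/(1 + 1)%N; apply: dhomogM => //; apply: coord_mpoly_homog.
rewrite mxE; apply: rpred_sum => l _; rewrite -[2%N]/(1 + 1)%N; apply: dhomogM.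
  by rewrite mxE.
by rewrite mxE coord_mpoly_homog.
Qed.

Lemma pevalv_stable_eq S q j y : pevalv (stable_eq S q j) y =
  (Psi y S *: (slice (Psi y) S *m diag_toep 'X)
   - colsub S (slice (Psi y) S *m diag_toep 'X) *m slice (Psi y) S) q j.
Proof.
have h2 a b : pevalv ((\matrix_(q, l) coord_mpoly (idx_set S q l) *m
     map_mx (@mpolyC _ K) (diag_toep 'X)) a b) y = (slice (Psi y) S *m diag_toep 'X) a b.
  rewrite !mxE /pevalv rmorph_sum; apply: eq_bigr => l _.
  by rewrite !mxE rmorphM /= mevalC; congr (_ * _); exact: pevalv_coord.
rewrite /pevalv /stable_eq rmorphB rmorphM /= -!/(pevalv _ _) pevalv_coord h2 !mxE.
congr (_ - _); rewrite /pevalv rmorph_sum; apply: eq_bigr => l _.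
rewrite rmorphM /=; congr (_ * _); first by rewrite mxE [RHS]mxE; exact: h2.
by rewrite !mxE; exact: pevalv_coord.
Qed.

Lemma stable_eq_cell S q j a : cell a -> pevalv (stable_eq S q j) a = 0.
Proof.
move=> [p ->]; rewrite pevalv_stable_eq Psi_cell slice_minors.
set B := cell_frame n p; set A := colsub S B.
have BN : B *m diag_toep 'X = toep n 'X *m B.
  rewrite /B /cell_frame /diag_toep mul_row_block mul_mx_row !mulmx0 mul1mx mulmx1.
  by rewrite addr0 add0r toepC.
have eS : minors B S = \det A by rewrite ffunE.
have e (X : 'M[K]_n) : X *m A *m (\adj A *m B) = \det A *: (X *m B).
  by rewrite -mulmxA [A *m _]mulmxA mul_mx_adj mul_scalar_mx scalemxAr.
by rewrite eS -mulmxA BN [\adj A *m _]mulmxA colsub_mul -/A e subrr mxE.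
Qed.

(** Where the [S]-coordinate g is nonzero, the slice divided by g serves as a normalized frame:
    [stable_eq] makes it t-stable, and [minor_eq] makes its minors proportional to [Psi y]. *)
Lemma cone_frame y : in_cone cell y -> Psi y != 0 ->
  exists c B, [/\ c != 0, stable B & Psi y = c *: minors B].
Proof.
move=> cy Py.
have [S GS] : exists S, Psi y S != 0.
  apply: contrapT => h; case/eqP: Py; apply/ffunP => i; rewrite [RHS]ffunE.
  by apply: contrapT => /eqP nz; apply: h; exists i.
set g := Psi y S in GS; exists g, (g^-1 *: slice (Psi y) S); split=> //.
  rewrite /stable -scalemxAl.
  have e : g *: (slice (Psi y) S *m diag_toep 'X) =
      colsub S (slice (Psi y) S *m diag_toep 'X) *m slice (Psi y) S.
    apply/matrixP => q j; apply/eqP; rewrite -subr_eq0; apply/eqP.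
    have := cy _ _ (stable_eq_homog S q j) (fun a => @stable_eq_cell S q j a).
    by rewrite pevalv_stable_eq !mxE.
  apply: submx_trans (scalemx_sub _ (submx_refl _)) _.
  apply/submxP; exists (colsub S (slice (Psi y) S *m diag_toep 'X)).
  by rewrite -scalemxAr -e scalerA mulVf // scale1r.
apply/ffunP => i; have sE (c : K) (x : K^o) : c *: x = c * x by [].
rewrite [RHS]ffunE sE ffunE.
have -> : colsub i (g^-1 *: slice (Psi y) S) = g^-1 *: colsub i (slice (Psi y) S).
  by apply/matrixP => a b; rewrite !mxE.
have := cy _ _ (minor_eq_homog S i) (fun a => @minor_eq_cell S i a).
rewrite pevalv_minor_eq -/g => /eqP; rewrite subr_eq0 => /eqP e.
rewrite detZ mulrCA e exprVn mulrA mulVf ?mul1r // expf_neq0 //.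
Qed.

Hypothesis n_gt0 : (0 < n)%N.
Let q0 : 'I_n := Ordinal n_gt0.

Lemma cone_normal_form y : in_cone cell y -> y != 0 -> exists k (c : K) p c0,
  [/\ (k < n)%N, c0 != 0,
      Psi (exp_e p (exp_f c%:P y)) = c0 *: minors (std_frame k) &
      (0 < k)%N -> Psi y all_x = 0 /\ Psi y all_y = 0].
Proof.
move=> cy y0; have Py : Psi y != 0.
  by apply: contraNneq y0 => e; apply/eqP/Psi_inj; rewrite e linear0.
have [b [B [b0 sB yB]]] := cone_frame cy Py.
have mB : minors B != 0 by apply: contraNneq Py; rewrite yB => ->; rewrite scaler0.
have [k [c [p [P [kn dP e lowk]]]]] := stable_normal_form n_gt0 sB mB.
exists k, c, p, (b * \det P); split=> //; first by rewrite mulf_neq0.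
  have yb : Psi (b^-1 *: y) = minors B by rewrite linearZ /= yB scalerA mulVf // scale1r.
  have := Psi_exp_e p (Psi_exp_f c%:P yb); rewrite e minors_mul !linearZ /= => /(congr1 ( *:%R b)).
  by rewrite !scalerA divff // scale1r.
by move=> /lowk[ex ey]; rewrite yB !tensorsZE ex ey mulr0.
Qed.

Lemma orbit_cone_normal y p q c0 : c0 != 0 ->
  Psi (exp_e p (exp_f q y)) = c0 *: minors (std_frame 0) -> orbit_cone y.
Proof.
move=> c00 e; have -> : y = exp_f (- q) (exp_e (- p) (c0 *: fusion_vector M)).
  rewrite -[LHS](exp_fK q) -[exp_f _ y](exp_eK p); congr (exp_f _ (exp_e _ _)).
  by apply: Psi_inj; rewrite e linearZ /= Psi_v std_frame0.
exact/orbit_cone_exp_f/orbit_cone_exp_e/orbit_cone_scale/orbit_cone_v.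
Qed.

(** The extreme coordinates of the subspace generated by (p, q) are p_0^n and q_0^n up to a common
    factor. Conversely, if they are not both zero, the normal form has k = 0 and the point is moved
    to a multiple of v. *)
Lemma orbit_coneE y : in_cone cell y -> y != 0 ->
  orbit_cone y <-> ~ (Psi y all_x = 0 /\ Psi y all_y = 0).
Proof.
move=> cy y0; split=> [oy|h].
  have [p [q [c [c0 pq ->]]]] := orbit_cone_frame oy.
  rewrite !tensorsZE minors_all_x minors_all_y !det_toep => -[/eqP + /eqP].
  rewrite !mulf_eq0 !expf_eq0 n_gt0 (negPf c0) /= => /eqP p_eq0 /eqP q_eq0.
  by move: pq; rewrite p_eq0 q_eq0 eqxx.
have [k [c [p [c0 [kn c00 e]]]]] := cone_normal_form cy y0.
have [k0|_] := posnP k; last by move=> /(_ isT)/h.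
by move: e; rewrite k0 => e _; apply: orbit_cone_normal e.
Qed.

Lemma std_frame_in_cone k : (k <= n)%N -> frame_in_cone (std_frame k).
Proof.
move=> kn.
pose D : 'M[K]_(n, n + n) := frame (fun=> 0) (fun i => if (i < n - k)%N then 'X^i else 0).
(* U_k is the limit, as s -> 0, of the cyclic subspaces generated by (t^k, s). *)
apply: (@frame_in_cone_pencil 'X _ D).
  by rewrite polyX_eq0.
move=> s; rewrite hornerX => s0.
(* For i >= n - k the cyclic frame has the row s t^i y, since t^(k+i) = 0; these rows are divided by
   s. *)
pose P : 'M[K]_n := diag_mx (\row_i if (i < n - k)%N then 1 else s^-1).
have -> : std_frame k + s *: D = P *m row_mx (toep n 'X^k) (toep n s%:P).
  rewrite std_frameE frame_pencilE; apply/row_matrixP => i.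
  rewrite row_frame row_mul row_diag_mx mxE -scalemxAl -rowE row_row_mx !row_toep.
  rewrite /row_pair scale_row_mx -!linearZ /= -exprD addnC scaler0 addr0.
  case: ifP => lt; first by rewrite !scale1r add0r mulrC mul_polyC.
  rewrite scaler0 addr0; congr row_mx.
    apply: poly_rV_low => j jn; rewrite coefZ coefXn ltn_eqF ?mulr0 //.
    by move/negbT: lt; lia.
  by rewrite mulrC mul_polyC scalerA mulVf // scale1r.
exact/frame_in_cone_mul/frame_in_cone_cyclic.
Qed.

Lemma frame_in_cone_raise p B : frame_in_cone B -> frame_in_cone (B *m (1%:M + raise_mx p)).
Proof.
move=> [y yB cy]; exists (exp_e p y); first exact: Psi_exp_e.
by apply: (exp_e_cone p y).1.
Qed.

Lemma frame_in_cone_lower p B : frame_in_cone B -> frame_in_cone (B *m (1%:M + lower_mx p)).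
Proof.
move=> [y yB cy]; exists (exp_f p y); first exact: Psi_exp_f.
by apply: (exp_f_cone p y).1.
Qed.

(** Rank is not assumed: a matrix of lower rank has zero minors and gives the vertex of the cone, so
    the lemma applies to all members of a pencil at once. *)
Lemma stable_in_cone B : stable B -> frame_in_cone B.
Proof.
move=> sB; have [m0|mB] := eqVneq (minors B) 0.
  exists 0; first by rewrite linear0 m0.
  rewrite -(scale0r (cell_vector 0)); exact/in_cone_scale/in_cone_cell.
have [k [c [p [P [kn dP e _]]]]] := stable_normal_form n_gt0 sB mB.
have -> : B = P *m std_frame k *m (1%:M + raise_mx (- p)) *m (1%:M + lower_mx (- c%:P)).
  rewrite -e -[_ *m (1%:M + raise_mx (- p))]mulmxA.
  rewrite (unipotentK (raise_mxN p)) ?raise_mx_sq // mulmx1 -mulmxA.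
  by rewrite (unipotentK (lower_mxN c%:P)) ?lower_mx_sq // mulmx1.
by apply/frame_in_cone_lower/frame_in_cone_raise/frame_in_cone_mul/std_frame_in_cone/ltnW.
Qed.

(** When a pivot column is exchanged for a column [l] that is zero in U_k, the derivative of the
    minor is the single entry [D q l]; so entries of D in such columns are coordinates of the
    tangent vector. *)
Lemma std_tangent k D y0 : Psi y0 = minors (std_frame k) ->
  (forall s, stable (std_frame k + s *: D)) ->
  exists2 w, cone_tangent cell y0 w &
    forall q l, (forall r, @std_idx n k r != l) -> Psi w (idx_set (std_idx k) q l) = D q l.
Proof.
move=> y0E sD.
have [_ /(_ y0 y0E)[w [tw wE]]] := frame_pencil (oner_neq0 {poly K})
  (fun s _ => stable_in_cone (sD s)).
exists w => // q l nl; rewrite wE deriv_minor_pencil scale0r addr0.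
(* Only the derivative of the exchanged column counts: in the other terms the zero column [l] of
   [std_frame] is still present. *)
rewrite (bigD1 q) //= big1 ?addr0 => [|q' ne].
  rewrite -[RHS](det_setcol1 q (fun r => D r l)); congr (\det _).
  apply/matrixP => a b; rewrite !mxE ffunE eqxx; case: eqP => // /eqP bq.
  by rewrite ffunE (negPf bq) (inj_eq (@std_idx_inj n k)) eq_sym.
rewrite (expand_det_col _ q) big1 // => r _.
rewrite !mxE [q == q']eq_sym (negPf ne) ffunE eqxx eq_sym.
by rewrite (negPf (nl r)) mul0r.
Qed.

(** * Tangent spaces at U_k and at v *)

Lemma tangent_space (y : M) : exists T : {vspace M}, forall w, w \in T <-> cone_tangent cell y w.
Proof.
apply: (@lin_closed_vspace K M (cone_tangent cell y)).
  move=> d p _ _; rewrite /dir_deriv big1 // => j _.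
  by rewrite /coordv linear0 mulr0.
by move=> c u w; apply: cone_tangent_lin.
Qed.

(** A linear relation [c] between n + 2 coordinates on T is evaluated on the cone vector itself and
    on the n + 1 pencils, which kill its coefficients in turn. *)
Lemma singular_tangent_dim k (y0 : M) (T : {vspace M}) : (0 < k)%N -> (k < n)%N ->
  Psi y0 = minors (std_frame k) ->
  (forall w, w \in T <-> cone_tangent cell y0 w) -> (n.+1 < \dim T)%N.
Proof.
move=> k0 kn y0E TP.
(* There are 1 + 1 + (n - k) + k tests: the pivot minor, the coefficient of t^(k-1) x in row 0 for
   [pencil_xy], and those for [pencil_y] and [pencil_x]. *)
pose J : finType := option (option ('I_(n - k) + 'I_k)).
have nkn : (n - k < n)%N by lia.
pose q1 := Ordinal nkn.
have k1n : (k.-1 < n)%N by lia.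
pose ox : 'I_n := Ordinal k1n.
have le1 : (n - k <= n)%N by lia.
have le2 : (k <= n)%N by lia.
pose S := @std_idx n k.
pose tq (j : option ('I_(n - k) + 'I_k)) : 'I_n * 'I_(n + n) :=
  match j with
  | None => (q0, lshift n ox)
  | Some (inl m) => (q0, rshift n (widen_ord le1 m))
  | Some (inr m) => (q1, lshift n (widen_ord le2 m))
  end.
pose test (j : J) : tensor_idx n := if j is Some j' then idx_set S (tq j').1 (tq j').2 else S.
have Sl (r o : 'I_n) : (o < k)%N -> S r != lshift n o.
  move=> ok; rewrite /S ffunE; case: insubP => [o' _ e|_]; last by rewrite eq_rlshift.
  rewrite (inj_eq (@lshift_inj _ _)) -val_eqE /=; apply/eqP => e'; move: e e' => /=; lia.
have Sr (r o : 'I_n) : (o < n - k)%N -> S r != rshift n o.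
  move=> ok; have [lt|ge] := ltnP r (n - k); last first.
    rewrite /S std_idx_r // (inj_eq (@rshift_inj _ _)) -val_eqE /=; lia.
  have lt' : (k + r < n)%N by lia.
  by rewrite /S (@std_idx_l n k r (Ordinal lt')) // eq_lrshift.
have nS j r : S r != (tq j).2.
  case: j => [[m|m]|] /=; [apply: Sr | apply: Sl | apply: Sl]; try exact: (ltn_ord m).
  by rewrite /= prednK.
pose kap0 (u : M) : {ffun J -> K^o} := [ffun j => Psi u (test j)].
have kap_lin : linear kap0.
  by move=> c u w; apply/ffunP => j; rewrite !ffunE linearP !ffunE.
pose kapM := GRing.isLinear.Build _ _ _ _ _ kap_lin.
pose kapL : {linear M -> {ffun J -> K^o}} := HB.pack kap0 kapM.
pose kap := linfun kapL.
have kapE u j : kap u j = Psi u (test j) by rewrite lfunE /= ffunE.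
have full : (kap @: T = fullv)%VS.
  apply/eqP/negPn/negP => /proper_vspace_functional[c [[i ci] cT]].
  have cT' w : cone_tangent cell y0 w -> \sum_j c j * Psi w (test j) = 0.
    move=> /TP/(memv_img kap)/cT; under eq_bigr do rewrite kapE.
    by [].
  have euler : cone_tangent cell y0 y0.
    apply/cone_tangent_self/(frame_in_coneE y0E).
    exact: (std_frame_in_cone (ltnW kn)).
  have cS : c None = 0.
    have := cT' _ euler; rewrite (bigD1 None) //= y0E minors_std mulr1 big1 ?addr0 //.
    by move=> [j|] // _; rewrite /test std_test_minor ?mulr0.
  have kill (D : 'M[K]_(n, n + n)) j1 :
      (forall s, stable (std_frame k + s *: D)) -> D (tq j1).1 (tq j1).2 != 0 ->
      (forall j, j != j1 -> c (Some j) = 0 \/ D (tq j).1 (tq j).2 = 0) -> c (Some j1) = 0.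
    move=> sD D1 Dj; have [w tw wE] := std_tangent y0E sD.
    have := cT' _ tw; rewrite (bigD1 (Some j1)) //= big1 ?addr0 => [/eqP|[j|] ne].
    - by rewrite wE // mulf_eq0 (negPf D1) orbF => /eqP.
    - by rewrite wE //; case: (Dj j) => [|->|->]; rewrite ?mul0r ?mulr0.
    - by rewrite cS mul0r.
  have rowE (D : 'M[K]_(n, n + n)) a l : D a l = row a D 0 l by rewrite mxE.
  have nk0 : (0 < n - k)%N by lia.
  have cy (m : 'I_(n - k)) : c (Some (Some (inl m))) = 0.
    apply: (kill (pencil_y k m)) => [s||j ne]; first exact: stable_pencil_y.
      by rewrite rowE rowK /= nk0 ypowE (unsplitK (inr _)) /= addn0 eqxx oner_eq0.
    right; rewrite rowE rowK; case: j ne => [[m'|m']|] /= ne.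
    - rewrite nk0 ypowE (unsplitK (inr _)) /= addn0.
      by case: eqP => // e; case/eqP: ne; congr (Some (inl _)); apply: val_inj.
    - by rewrite ltnn mxE.
    - by rewrite nk0 ypowE (unsplitK (inl _)).
  have cx (m : 'I_k) : c (Some (Some (inr m))) = 0.
    apply: (kill (pencil_x k m)) => [s||j ne]; first exact: stable_pencil_x.
      by rewrite rowE rowK /= ltnn xpowE (unsplitK (inl _)) /= subnn addn0 eqxx oner_eq0.
    right; rewrite rowE rowK; case: j ne => [[m'|m']|] /= ne.
    - by rewrite nk0 mxE.
    - rewrite ltnn xpowE (unsplitK (inl _)) /= subnn addn0.
      by case: eqP => // e; case/eqP: ne; congr (Some (inr _)); apply: val_inj.
    - by rewrite nk0 mxE.
  (* This pencil comes last because it also has nonzero entries at tests of the other two kinds. *)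
  have cxy : c (Some None) = 0.
    apply: (kill (pencil_xy k)) => [s||j ne]; first exact: stable_pencil_xy.
      rewrite rowE rowK /= mxE mxE xpowE ypowE (unsplitK (inl _)) /= eqxx addr0.
      by rewrite oppr_eq0 oner_eq0.
    by left; case: j ne => [[m|m]|].
  by case/eqP: ci; case: i => [[[m|m]|]|].
have : (\dim (kap @: T) <= \dim T)%N by rewrite -(limg_ker_dim kap T) leq_addl.
rewrite full dim_ffun_regular !card_option card_sum !card_ord; lia.
Qed.

(** Tangent vectors satisfy the linear equations of the cell: the x-block is the identity times the
    [all_x] coordinate, and the y-block is Toeplitz, hence determined by its first row. *)
Lemma cone_tangent_coords y w : cone_tangent cell y w ->
  Psi w all_x = 0 -> (forall l, Psi w (idx_set all_x q0 (rshift n l)) = 0) ->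
  forall q c, Psi w (idx_set all_x q c) = 0.
Proof.
move=> tw wS wy q c.
have lin (f : M -> K) : (forall a u v, f (a *: u + v) = a * f u + f v) ->
    (forall p, f (cell_vector p) = 0) -> f w = 0.
  move=> fl f0; have := tw 1%N (lin_mpoly f) (lin_mpoly_homog f).
  rewrite (@dir_deriv_affine _ _ _ _ _ (f y) (f w)) => [|s].
    by apply=> _ [p ->]; rewrite pevalv_lin_mpoly.
  by rewrite pevalv_lin_mpoly // addrC fl addrC.
have Plin i a u v : Psi (a *: u + v) i = a * Psi u i + Psi v i.
  by rewrite linearP !ffunE.
rewrite -(splitK c); case: (split c) => o /=.
  have : Psi w (idx_set all_x q (lshift n o)) - (q == o)%:R * Psi w all_x = 0.
    apply: (lin (fun u => Psi u (idx_set all_x q (lshift n o)) -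
        (q == o)%:R * Psi u all_x)) => [a u v|p].
      by rewrite !Plin; ring.
    by rewrite Psi_cell cell_coord cell_coord_x /cell_frame row_mxEl mxE mulr1 subrr.
  by rewrite wS mulr0 subr0.
case: (ltnP o q) => oq.
  apply: (lin (fun u => Psi u (idx_set all_x q (rshift n o)))) => [a u v|p]; first exact: Plin.
  by rewrite Psi_cell cell_coord /cell_frame row_mxEr mxE coefXnM oq.
have lt : (o - q < n)%N by apply: leq_ltn_trans (leq_subr _ _) (ltn_ord o).
pose o' := Ordinal lt.
have : Psi w (idx_set all_x q (rshift n o)) - Psi w (idx_set all_x q0 (rshift n o')) = 0.
  apply: (lin (fun u => Psi u (idx_set all_x q (rshift n o)) -
      Psi u (idx_set all_x q0 (rshift n o')))) => [a u v|p].
    by rewrite !Plin; ring.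
  rewrite !Psi_cell !cell_coord /cell_frame !row_mxEr !mxE !coefXnM.
  by rewrite ltnNge oq /= subn0 subrr.
by rewrite wy subr0.
Qed.

(** If w vanishes at the n + 1 tests, it vanishes at all coordinates one exchange away from [all_x].
    Along v + s w the slice is then constant and [minor_eq] is affine in s with slope [- Psi w i],
    so w = 0. *)
Lemma smooth_tangent_dim (T : {vspace M}) :
  (forall w, w \in T -> cone_tangent cell (fusion_vector M) w) -> (\dim T <= n.+1)%N.
Proof.
move=> TP; set v := fusion_vector M in TP.
have Psi_v0 : Psi v = minors (cell_frame n 0) by exact: Psi_v.
pose test (j : option 'I_n) : tensor_idx n :=
  if j is Some l then idx_set all_x q0 (rshift n l) else all_x.
pose kap0 (u : M) : {ffun option 'I_n -> K^o} := [ffun j => Psi u (test j)].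
have kap_lin : linear kap0.
  by move=> c u w; apply/ffunP => j; rewrite !ffunE linearP !ffunE.
pose kapM := GRing.isLinear.Build _ _ _ _ _ kap_lin.
pose kapL : {linear M -> {ffun option 'I_n -> K^o}} := HB.pack kap0 kapM.
pose kap := linfun kapL.
have kapE u j : kap u j = Psi u (test j) by rewrite lfunE /= ffunE.
suff ker0 : (T :&: lker kap)%VS = 0%VS.
  rewrite -(limg_dim_eq ker0); apply: leq_trans (dimvS (subvf _)) _.
  by rewrite dim_ffun_regular card_option card_ord.
apply/eqP; rewrite -subv0; apply/subvP => w; rewrite memv_cap memv_ker => /andP[wT /eqP kw].
have tw := TP w wT.
have kw0 j : Psi w (test j) = 0 by rewrite -kapE kw ffunE.
have wS : Psi w all_x = 0 := kw0 None.
have w0 := cone_tangent_coords tw wS (fun l => kw0 (Some l)).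
rewrite memv0; apply/eqP/Psi_inj; rewrite linear0; apply/ffunP => i; rewrite [RHS]ffunE.
have vx : Psi v all_x = 1 by rewrite Psi_v0 cell_coord_x.
have := tw _ _ (minor_eq_homog all_x i) (@minor_eq_cell all_x i).
rewrite (@dir_deriv_affine _ _ _ _ _ (pevalv (minor_eq all_x i) v) (- Psi w i)) => [/eqP|s].
  by rewrite oppr_eq0 => /eqP.
rewrite !pevalv_minor_eq.
have addE j : Psi (v + s *: w) j = Psi v j + s * Psi w j.
  by rewrite linearD linearZ !ffunE.
have -> : slice (Psi (v + s *: w)) all_x = slice (Psi v) all_x.
  by apply/matrixP => a b; rewrite !mxE addE w0 mulr0 addr0.
by rewrite !addE wS vx mulr0 addr0 !expr1n; ring.
Qed.

(** * Dimension of the variety *)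

Let shE := fusion_varietyE.
Let shT := fusion_tangentE.

Definition cell_at (a : 'I_n -> K) : M :=
  cell_vector (\poly_(i < n) if insub i is Some o then a o else 0).

Lemma poly_at_coef (a : 'I_n -> K) (o : 'I_n) :
  (\poly_(i < n) if insub i is Some o then a o else 0)`_o = a o.
Proof. by rewrite coef_poly ltn_ord valK. Qed.

Definition cell_coord_mpoly (r : 'I_n) (c : 'I_(n + n)) : {mpoly K[n]} :=
  match split c with
  | inl o => (r == o)%:R
  | inr o => if insub (o - r)%N is Some l then (if (r <= o)%N then 'X_l else 0) else 0
  end.

(** The parametrization of the cell by affine n-space in coordinates of M: forms on M become
    polynomials in n variables. *)
Lemma cell_mpoly : exists R : (\dim {: M}).-tuple {mpoly K[n]},
  forall p a, (p \mPo R).@[a] = pevalv p (cell_at a).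
Proof.
pose Rmin (i : tensor_idx n) : {mpoly K[n]} := \det (\matrix_(r, q) cell_coord_mpoly r (i q)).
have RminE i a : (Rmin i).@[a] = Psi (cell_at a) i.
  rewrite Psi_cell ffunE -det_map_mx; congr (\det _); apply/matrixP => r q.
  rewrite !mxE /= /cell_coord_mpoly; case: (split (i q)) => o.
    by rewrite mxE rmorph_nat.
  rewrite mxE coefXnM [in RHS]ltnNge.
  have lt : (o - r < n)%N by apply: leq_ltn_trans (leq_subr _ _) (ltn_ord o).
  rewrite insubT; case: (leqP r o) => ro /=; last by rewrite meval0.
  by rewrite mevalXU -[(o - r)%N]/(val (Ordinal lt)) poly_at_coef; congr a; apply: val_inj.
pose g i : M := (Psi^-1)%VF [ffun k => (k == i)%:R].
exists [tuple \sum_i coordv (g i) j *: Rmin i | j < \dim {: M}] => p a.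
rewrite comp_mpoly_meval; apply: meval_eq => j; rewrite tnth_mktuple.
rewrite rmorph_sum /=; transitivity (\sum_i coordv (g i) j * Psi (cell_at a) i).
  by apply: eq_bigr => i _; rewrite mevalZ RminE.
rewrite -[in RHS](lker0_lfunK lker_Psi (cell_at a)) [Psi _ in RHS]ffun_basisE.
rewrite /coordv !linear_sum /=; apply: eq_bigr => i _.
by rewrite !linearZ /= mulrC.
Qed.

Lemma pevalp_ratio d p q (L : proj M) y : p \is d.-homog -> q \is d.-homog ->
  val L = <[y]>%VS -> (pevalp q L != 0) = (pevalv q y != 0) /\
  pevalp p L / pevalp q L = pevalv p y / pevalv q y.
Proof.
move=> hp hq Ly; have [y0 [c c0 e]] := proj_rep_line Ly.
rewrite /pevalp e !(pevalv_scale _ _ hp) !(pevalv_scale _ _ hq).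
have cd : c ^+ d != 0 by rewrite expf_eq0 negb_and c0 orbT.
by rewrite mulf_eq0 (negPf cd) -mulf_div divff // mul1r.
Qed.

Lemma cell_line a : exists2 L : proj M, sh L & val L = <[cell_at a]>%VS.
Proof.
have y0 : cell_at a != 0 by apply: cell_vector_neq0 _.
have [L La] := proj_of y0; exists L => //; apply/shE.
have [_ [c _ ->]] := proj_rep_line La.
exact/in_cone_scale/in_cone_cell.
Qed.

(** The first row of the Toeplitz block gives n free coordinates. Conversely, more than n fractions
    pulled back to the cell are dependent by [mpoly_dependence], and the relation passes to the
    closure. *)
Lemma fusion_variety_dim : variety_dim sh n.
Proof.
split.
  exists 1%N, (fun l : 'I_n => coord_mpoly (idx_set all_x q0 (rshift n l))), (coord_mpoly all_x).
  have valE a l : pevalv (coord_mpoly (idx_set all_x q0 (rshift n l))) (cell_at a) = a l.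
    rewrite pevalv_coord Psi_cell cell_coord /cell_frame row_mxEr mxE expr0 mul1r.
    exact: poly_at_coef.
  have valS a : pevalv (coord_mpoly all_x) (cell_at a) = 1.
    by rewrite pevalv_coord Psi_cell cell_coord_x.
  split=> [i||| F hF].
  - exact: coord_mpoly_homog.
  - exact: coord_mpoly_homog.
  - have [L XL La] := cell_line (fun=> 0); exists L => //.
    have [-> _] := pevalp_ratio (coord_mpoly_homog all_x) (coord_mpoly_homog all_x) La.
    by rewrite valS oner_eq0.
  apply: mpoly_all_roots => a; have [L XL La] := cell_line a.
  have h l := pevalp_ratio (coord_mpoly_homog (idx_set all_x q0 (rshift n l)))
                (coord_mpoly_homog all_x) La.
  rewrite -[RHS](hF L XL); last by rewrite (h q0).1 valS oner_eq0.
  by apply: meval_eq => l; rewrite (h l).2 valE valS divr1.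
move=> k [d [p [q [hp hq [L0 XL0 qL0] indep]]]]; rewrite leqNgt; apply/negP => nk.
have [R RE] := cell_mpoly.
have [D [u [[b0 ub0] dep]]] := mpoly_dependence (fun i => p i \mPo R) (q \mPo R) nk.
pose F : {mpoly K[k]} := \sum_b u b *: 'X_[[multinom val (b i) | i < k]].
have F0 : F = 0.
  apply: indep => L XL qL.
  pose N := (k * D)%N.
  (* The powers of q make this homogeneous of degree d N, so that it vanishes on sh as soon as it
     does on the cell; division by q^N gives back F. *)
  pose H : {mpoly K[\dim {: M}]} := \sum_b u b *: (\prod_i p i ^+ b i * q ^+ (N - \sum_i b i)).
  have sb (b : {ffun 'I_k -> 'I_D}) : (\sum_i b i <= N)%N.
    rewrite /N -[k in (k * D)%N]card_ord -sum_nat_const; apply: leq_sum => i _; exact: ltnW.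
  have hH : H \is (d * N).-homog.
    apply: rpred_sum => b _; apply: rpredZ; rewrite -(subnKC (sb b)) mulnDr.
    rewrite addKn.
    apply: dhomogM; last exact: dhomogMn.
    rewrite big_distrr /=; elim/big_rec2: _ => [|i x y _ IH]; first exact: dhomog1.
    by apply: dhomogM => //; apply: dhomogMn.
  have HE x : pevalv H x =
      \sum_b u b * (\prod_i pevalv (p i) x ^+ b i * pevalv q x ^+ (N - \sum_i b i)).
    rewrite /pevalv rmorph_sum; apply: eq_bigr => b _ /=.
    rewrite mevalZ mevalM rmorph_prod rmorphXn /=; congr (_ * (_ * _)).
    by apply: eq_bigr => i _; rewrite rmorphXn.
  have H0 : pevalv H (proj_rep L) = 0.
    apply: ((shE L).1 XL _ _ hH) => _ [r ->].
    have -> : cell_vector r = cell_at (fun i => r`_i).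
      apply: Psi_inj; rewrite !Psi_cell /cell_frame; congr (minors (row_mx _ _)).
      apply: toep_coef => j jn; by rewrite -[j]/(val (Ordinal jn)) poly_at_coef.
    rewrite HE -[RHS](meval0 (fun i : 'I_n => r`_i)) -dep rmorph_sum; apply: eq_bigr => b _ /=.
    rewrite mevalZ mevalM rmorph_prod rmorphXn /= RE; congr (_ * (_ * _)).
    by apply: eq_bigr => i _; rewrite rmorphXn /= RE.
  have qN : pevalv q (proj_rep L) ^+ N != 0 by rewrite expf_neq0.
  apply: (mulfI qN); rewrite mulr0 -[RHS]H0 HE rmorph_sum mulr_sumr; apply: eq_bigr => b _ /=.
  rewrite mevalZ mevalX mulrCA; congr (_ * _).
  rewrite -{1}(subnKC (sb b)) exprD mulrAC mulrC [RHS]mulrC; congr (_ * _).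
  rewrite -prodrXr -big_split /=; apply: eq_bigr => i _.
  by rewrite mnmE expr_div_n mulrC divfK // expf_neq0.
case/eqP: ub0; have := congr1 (mcoeff [multinom val (b0 i) | i < k]) F0.
rewrite mcoeff0 raddf_sum (bigD1 b0) //= big1 ?addr0 => [|b ne].
  by rewrite mcoeffZ mcoeffX eqxx mulr1.
rewrite mcoeffZ mcoeffX; case: eqP => [e|_]; last by rewrite mulr0.
case/eqP: ne; apply/ffunP => i; apply: val_inj.
by have := congr1 (fun m : 'X_{1..k} => m i) e; rewrite !mnmE.
Qed.

(** * Boundary, singular locus and sections *)

Lemma boundaryE L : (sh `\` fusion_orbit M) L <->
  sh L /\ Psi (proj_rep L) all_x = 0 /\ Psi (proj_rep L) all_y = 0.
Proof.
have oE : sh L -> fusion_orbit M L <-> ~ (Psi (proj_rep L) all_x = 0 /\ Psi (proj_rep L) all_y = 0).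
  move=> /shE cL; rewrite fusion_orbitE.
  exact: (orbit_coneE cL (proj_rep_neq0 L)).
split=> [[XL nO]|[XL h]]; split=> //.
  by apply: contrapT => h; apply: nO; apply/oE.
by move/(oE XL).
Qed.

Lemma exp_tangent p q y w : cone_tangent cell y w ->
  cone_tangent cell (exp_e p (exp_f q y)) (exp_e p (exp_f q w)).
Proof.
move=> tw; apply: (exp_e_cone p _).2.
exact: (exp_f_cone q _).2.
Qed.

Lemma exp_tangent_inv p q y w : cone_tangent cell (exp_e p (exp_f q y)) w ->
  cone_tangent cell y (exp_f (- q) (exp_e (- p) w)).
Proof.
move=> tw; rewrite -[y](exp_fK q) -[exp_f q y](exp_eK p).
apply: (exp_f_cone (- q) _).2.
exact: (exp_e_cone (- p) _).2.
Qed.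

(** The unipotents that bring L to normal form preserve the cone and are injective, so tangent
    dimensions are compared at U_k: at least n + 2 for k > 0, at most n + 1 at v. *)
Lemma fusion_singular_locus : sh `\` fusion_orbit M = singular_locus sh.
Proof.
apply/seteqP; split=> L.
  move=> [XL nO]; split=> //; have cL := (shE L).1 XL.
  have [k [c [p [c0 [kn c00 e _]]]]] := cone_normal_form cL (proj_rep_neq0 L).
  set f := (exp_e p \o exp_f c%:P)%VF; set y0 := c0^-1 *: f (proj_rep L).
  have fy : f (proj_rep L) = c0 *: y0 by rewrite scalerA divff // scale1r.
  have y0E : Psi y0 = minors (std_frame k).
    by rewrite /y0 linearZ /= /f comp_lfunE e scalerA mulVf // scale1r.
  have k0 : (0 < k)%N.
    rewrite lt0n; apply/eqP => k0; apply: nO; apply/fusion_orbitE; rewrite k0 in e.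
    exact: (orbit_cone_normal c00 e).
  have [T TP] := tangent_space (proj_rep L); have [T0 T0P] := tangent_space y0.
  exists n, T; split; first exact: fusion_variety_dim.
    by move=> w; rewrite TP shT.
  apply: leq_trans (singular_tangent_dim k0 kn y0E T0P) _.
  pose g := (exp_f (- c%:P) \o exp_e (- p))%VF.
  rewrite -(@dim_inj_img _ _ g T0); last first.
    by move=> u w; rewrite !comp_lfunE => /(can_inj (exp_fK _))/(can_inj (exp_eK _)).
  apply: dimvS; apply/subvP => _ /memv_imgP[w /T0P tw ->]; apply/TP.
  rewrite comp_lfunE; apply: exp_tangent_inv.
  by have := cone_tangent_scale c0 tw; rewrite -fy /f comp_lfunE.
move=> [XL [d [T [[_ dmax] TP dT]]]]; split=> // OL.
(* The singularity comes with its own dimension d of sh; maximality gives n <= d, hence dim T > n +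
   1. *)
have nd := dmax n (fusion_variety_dim).1.
have cL := (shE L).1 XL.
have [k [c [p [c0 [kn c00 e lowk]]]]] := cone_normal_form cL (proj_rep_neq0 L).
have k0 : k = 0%N.
  case: (posnP k) => // k0.
  have h : (sh `\` fusion_orbit M) L by apply/boundaryE; split=> //; apply: lowk.
  by case: h.
pose f := (exp_e p \o exp_f c%:P)%VF.
have fy : f (proj_rep L) = c0 *: fusion_vector M.
  by apply: Psi_inj; rewrite comp_lfunE e linearZ /= Psi_v k0 std_frame0.
have : (\dim (f @: T) <= n.+1)%N.
  apply: smooth_tangent_dim => _ /memv_imgP[w /TP/shT tw ->].
  rewrite -(cone_tangentE _ _ _ c00) -fy /f !comp_lfunE; exact: exp_tangent.
rewrite dim_inj_img; last first.
  by move=> u w; rewrite !comp_lfunE => /(can_inj (exp_eK _))/(can_inj (exp_fK _)).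
by move=> le; move: (leq_trans dT le); rewrite ltnS ltnNge nd.
Qed.

Lemma fusion_boundary_sections : exists (E : line_bundle sh) (s1 s2 : global_section E),
  sh `\` fusion_orbit M = zero_locus s1 `&` zero_locus s2.
Proof.
have coordL i : exists f : 'Hom(M, K^o), forall y, f y = Psi y i.
  have fl : linear (fun y : M => (Psi y i : K^o)).
    by move=> c u w; rewrite linearP !ffunE.
  pose fM := GRing.isLinear.Build _ _ _ _ _ fl.
  pose fL : {linear M -> K^o} := HB.pack (fun y : M => (Psi y i : K^o)) fM.
  by exists (linfun fL) => y; rewrite lfunE.
have [fx fxE] := coordL all_x; have [fy fyE] := coordL all_y.
have [s1 s1E] := linear_section sh fx; have [s2 s2E] := linear_section sh fy.
exists (hyperplane_bundle sh), s1, s2; rewrite s1E s2E.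
apply/seteqP; split=> L.
  by move=> /boundaryE[XL [ex ey]]; split; split; rewrite ?fxE ?fyE.
by move=> [[XL ex] [_ ey]]; apply/boundaryE; rewrite -fxE -fyE.
Qed.

End FusionVariety.

Local Open Scope complex_scope.

Theorem proposition7p1 (R : realType) (n : nat) (n_gt0 : (0 < n)%N)
    (z : 'I_n -> R[i]) (z_inj : injective z)
    (M : fusion_product (fun _ : 'I_n => 2%N) z) :
  let sh : set (proj M) := fusion_variety M in
  let N : set (proj M) := sh `\` fusion_orbit M in
  N = singular_locus sh /\
  exists (E : line_bundle sh) (s1 s2 : global_section E),
    N = zero_locus s1 `&` zero_locus s2.
Proof.
have [Psi [Psi_v Psi_act]] := fusion_tensors z_inj M.
split; first exact: fusion_singular_locus Psi_v Psi_act (fusion_dim M) n_gt0.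
exact: fusion_boundary_sections Psi_v Psi_act (fusion_dim M) n_gt0.
Qed.
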